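(* Let $\{g_{\lambda(t)}\}_{t\in(-\varepsilon,\varepsilon)}$ be any of the families of left invariant metrics on a compact Lie group $G$ described in the constructions (A), (B), (C), (D), (E) of the context. Then $\|\mathrm{Ric}^{\lambda(t)}\|^2_{\lambda(t)}$ is nonconstant in $t$.
   Context: General notation. Let $G$ be a compact Lie group with Lie algebra $\mathfrak g$ and bi-invariant metric $g_0$, and let $H\subset G$ be a two-dimensional torus with Lie algebra $\mathfrak h\subset\mathfrak g$ and $g_0$-orthonormal basis $\{Z_1,Z_2\}$ of $\mathfrak h$. Given a continuous family of linear maps $j(t):\mathfrak h\to\mathfrak g$, $t\in(-\varepsilon,\varepsilon)$, write $j_Z(t)$ for $j(t)(Z)$, let $\lambda(t):\mathfrak g\to\mathfrak h\subset\mathfrak g$ be the transpose of $j(t)$ with respect to $g_0$, i.e. $g_0(\lambda(t)X,Z)=g_0(X,j_Z(t))$, and let $g_{\lambda(t)}$ be the left invariant metric on $G$ corresponding to the scalar product $(\mathrm{Id}+\lambda(t))^*g_0$ on $\mathfrak g$. $\mathrm{Ric}^{\lambda(t)}$ is its Ricci tensor and $\|\,.\,\|_{\lambda(t)}$ the norm on tensors given by $g_{\lambda(t)}$; since the metric is left invariant, $\|\mathrm{Ric}^{\lambda(t)}\|^2_{\lambda(t)}$ is a constant function on $G$ for each $t$. A continuous family $j(t):\mathfrak h\to\mathfrak{so}(m)$, $m\ge5$, respectively $j(t):\mathfrak h\to\mathfrak{su}(m)$, $m\ge3$, is called admissible if (1) the $j(t)$ are pairwise isospectral: for all $t,t'$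 and every $Z\in\mathfrak h$ there is $A\in\mathrm O(m)$, respectively $A\in\mathrm{SU}(m)$, with $j_Z(t')=Aj_Z(t)A^{-1}$; (2) the function $t\mapsto\mathrm{tr}\bigl((j_{Z_1}(t)^2+j_{Z_2}(t)^2)^2\bigr)$ is nonconstant in every interval around zero. The families considered (each consists of pairwise isospectral metrics) are the following. (A) $G=\mathrm{SO}(m)\times H$ or $G=\mathrm{Spin}(m)\times H$, $m\ge5$, where $H$ is a two-dimensional torus with an invariant metric, $g_0$ is the product of a bi-invariant metric on $\mathrm{SO}(m)$ (resp. $\mathrm{Spin}(m)$) and the metric on $H$, and $j(t):\mathfrak h\to\mathfrak{so}(m)\subset\mathfrak g=\mathfrak{so}(m)\oplus\mathfrak h$ is an admissible family. (B) $G=\mathrm{SU}(m)\times H$, $m\ge3$, where $H$ is a two-dimensional torus with an invariant metric, $g_0$ is the product of a bi-invariant metric on $\mathrm{SU}(m)$ and the metric on $H$, and $j(t):\mathfrak h\to\mathfrak{su}(m)\subset\mathfrak g$ is an admissible family. (C) $G=\mathrm{SO}(m+4)$ or $G=\mathrm{Spin}(m+4)$, $m\ge5$, $g_0$ a bi-invariant metric on $G$; $\mathfrak{so}(m)\oplus\mathfrak{so}(4)\subset\mathfrak{so}(m+4)=\mathfrak g$ is the canonical block embedding; $\mathfrak h\subset\mathfrak{so}(4)$ is the Lie algebra of a maximal torus of $\mathrm{SO}(4)$ and $H$ is the torus in $G$ with Lie algebra $\mathfrak h$; $j(t):\mathfrak h\to\mathfrak{so}(m)\subset\mathfrak g$ is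 an admissible family. (D) $G=\mathrm{SU}(m+3)$, $m\ge3$, $g_0$ a bi-invariant metric on $G$; $\mathrm{SU}(m)\times\mathrm{SU}(3)\subset\mathrm{SU}(m+3)$ is the canonical block embedding; $H$ is a maximal torus of $\mathrm{SU}(3)$; $j(t):\mathfrak h\to\mathfrak{su}(m)\subset\mathfrak g$ is an admissible family. (E) $G=\mathrm{SO}(2m+2)$ or $G=\mathrm{Spin}(2m+2)$, $m\ge3$, $g_0$ a bi-invariant metric on $G$; $\mathfrak{so}(2m)\oplus\mathfrak{so}(2)\subset\mathfrak{so}(2m+2)=\mathfrak g$ is the canonical block embedding. Let $\Psi:\mathbb C^m\to\mathbb R^{2m}$ be the real isomorphism with $e_k\mapsto e_k$, $ie_k\mapsto e_{m+k}$, let $\phi:\mathfrak{su}(m)\to\mathfrak{so}(2m)$, $\phi(X)=\Psi X\Psi^{-1}$, and $J=\begin{pmatrix} 0 & -I \\ I & 0 \end{pmatrix}\in\mathfrak{so}(2m)$, with $I$ the $m$-dimensional unit matrix. Let $H\subset G$ be the two-dimensional torus with Lie algebra $\mathfrak h=\mathbb RJ\oplus\mathfrak{so}(2)$. Let $\widehat\jmath(t):\mathfrak h\to\mathfrak{su}(m)$ be an admissible family and $j(t):=\phi\circ\widehat\jmath(t):\mathfrak h\to\mathfrak{so}(2m)\subset\mathfrak g$. *)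

(* Defs.v *)
From HB Require Import structures.
From mathcomp Require Import all_boot all_order all_algebra.
From mathcomp Require Import classical_sets set_interval reals.
From mathcomp Require Import topology normedtype.
From mathcomp Require Import complex ring.

Set Implicit Arguments.
Unset Strict Implicit.
Unset Printing Implicit Defensive.

Import Order.TTheory GRing.Theory Num.Theory.
Import numFieldNormedType.Exports.
Local Open Scope classical_set_scope.
Local Open Scope complex_scope.
Local Open Scope ring_scope.

(** Left invariant metrics.

A left invariant metric on a Lie group G is a scalar product on the Lie
algebra g of G, and left invariant tensors are tensors on g.  For left
invariant fields X, Y, Z the functions g(Y, Z) are constant, so the
Levi-Civita connection restricts to a bilinear map g x g -> g given by the
Koszul formula without derivative terms.  Only g enters, so a group and its
coverings (e.g. SO(m) and Spin(m)) give the same objects. *)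

Section LeftInvariant.
Variables (R : realType) (V : vectType R).
Implicit Types (ip : V -> V -> R) (x y z : V).

Definition scalar_product ip : Prop :=
  [/\ forall a x y z, ip (a *: x + y) z = a * ip x z + ip y z,
      forall x y, ip x y = ip y x
    & forall x, x != 0 -> 0 < ip x x].

Definition orthonormal_basis ip (e : seq V) : Prop :=
  basis_of fullv e /\
  forall i k, (i < size e)%N -> (k < size e)%N ->
    ip e`_i e`_k = (i == k)%:R.

(* The unique vector u with ip u z = f z for all z; see rieszE, riesz_uniq. *)
Definition riesz ip (f : V -> R) : V :=
  xget 0 [set u | forall z, ip u z = f z].

Variable br : V -> V -> V.

Definition koszul ip x y z : R :=
  (ip (br x y) z - ip (br y z) x + ip (br z x) y) / 2.

(* See levi_civita_torsion_free and levi_civita_metric. *)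
Definition levi_civita ip x y : V := riesz ip (koszul ip x y).

Definition curvature ip x y z : V :=
  let D := levi_civita ip in D x (D y z) - D y (D x z) - D (br x y) z.

Definition endo_trace (f : V -> V) : R :=
  \sum_(i < \dim {:V}) coord (vbasis {:V}) i (f (vbasis {:V})`_i).

Definition ricci ip x y : R := endo_trace (fun z => curvature ip z x y).

Definition gram (T : V -> V -> R) : 'M[R]_(\dim {:V}) :=
  \matrix_(i, k) T (vbasis {:V})`_i (vbasis {:V})`_k.

(* g^{ik} g^{jl} T_{ij} T_{kl}; see tensor_norm2E. *)
Definition tensor_norm2 ip (T : V -> V -> R) : R :=
  \tr (invmx (gram ip) *m gram T *m invmx (gram ip) *m (gram T)^T).

End LeftInvariant.

Section LeftInvariantTheory.
Variables (R : realType) (V : vectType R) (ip : V -> V -> R).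
Hypothesis ip_sp : scalar_product ip.

Let ipDl x y z : ip (x + y) z = ip x z + ip y z.
Proof. by case: ip_sp => /(_ 1 x y z) + _ _; rewrite scale1r mul1r. Qed.
Let ip0l z : ip 0 z = 0.
Proof. by apply: (addrI (ip 0 z)); rewrite -ipDl !addr0. Qed.
Let ipZl a x z : ip (a *: x) z = a * ip x z.
Proof.
by case: ip_sp => /(_ a x 0 z) + _ _; rewrite ip0l !addr0.
Qed.
Let ipC x y : ip x y = ip y x. Proof. by case: ip_sp. Qed.
Let ip_suml n (F : 'I_n -> V) z : ip (\sum_i F i) z = \sum_i ip (F i) z.
Proof.
by apply: (big_ind2 (fun x a => ip x z = a)) => [|x a y c <- <-|]//.
Qed.
Let ip_sumr n (F : 'I_n -> V) z : ip z (\sum_i F i) = \sum_i ip z (F i).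
Proof. by rewrite ipC ip_suml; apply: eq_bigr => i _; rewrite ipC. Qed.

Let b := vbasis {:V}.
Let b_full x : x = \sum_i coord b i x *: b`_i.
Proof. by apply: coord_vbasis; rewrite memvf. Qed.

Lemma gram_unit : gram ip \in unitmx.
Proof.
rewrite -row_free_unit -kermx_eq0; apply/eqP/row_matrixP => i.
rewrite row0; have : row i (kermx (gram ip)) *m gram ip = 0.
  by rewrite -row_mul mulmx_ker row0.
move: (row i _) => u uG.
pose x := \sum_k u 0 k *: b`_k.
have ux : ip x x = (u *m gram ip *m u^T) 0 0.
  rewrite /x ip_sumr mxE; apply: eq_bigr => k _.
  rewrite ipC ipZl ipC mulrC !mxE; congr (_ * _).
  by rewrite ip_suml; apply: eq_bigr => l _; rewrite ipZl mxE.
rewrite uG mul0mx mxE in ux.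
have x0 : x = 0.
  apply/eqP; apply: contraT => xN0.
  by case: ip_sp => _ _ /(_ _ xN0); rewrite ux ltxx.
have /freeP bfree := basis_free (vbasisP {:V}).
by apply/rowP => k; rewrite [RHS]mxE (bfree (fun k => u 0 k) x0 k).
Qed.

Lemma riesz_uniq x y : (forall z, ip x z = ip y z) -> x = y.
Proof.
move=> xy; apply/eqP; rewrite -subr_eq0; apply: contraT => d0.
case: ip_sp => _ _ /(_ _ d0).
by rewrite -[- y]scaleN1r ipDl ipZl xy mulN1r subrr ltxx.
Qed.

Lemma rieszE (f : V -> R) : (forall a x y, f (a *: x + y) = a * f x + f y) ->
  forall z, ip (riesz ip f) z = f z.
Proof.
move=> fl; apply: (@xgetPex _ 0 [set u | forall z, ip u z = f z]).
pose c := (\row_k f b`_k) *m invmx (gram ip).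
have f0 : f 0 = 0.
  by have := fl (-1) 0 0; rewrite scaler0 addr0 mulN1r addNr.
exists (\sum_k c 0 k *: b`_k) => z /=.
have cb (k : 'I_(\dim {:V})) : ip (\sum_k c 0 k *: b`_k) b`_k = f b`_k.
  transitivity ((c *m gram ip) 0 k).
    by rewrite mxE ip_suml; apply: eq_bigr => l _; rewrite ipZl [gram ip _ _]mxE.
  by rewrite mulmxKV ?gram_unit// mxE.
rewrite [in LHS](b_full z) [in RHS](b_full z) ip_sumr.
have -> (F : 'I_(\dim {:V}) -> V) : f (\sum_k F k) = \sum_k f (F k).
  apply: (big_ind2 (fun x a => f x = a)) => [|x a y d <- <-|]//.
  by have := fl 1 x y; rewrite scale1r mul1r.
apply: eq_bigr => k _; rewrite ipC ipZl ipC cb.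
by have := fl (coord b k z) b`_k 0; rewrite !addr0 f0 addr0.
Qed.

Section Connection.
Variable br : V -> V -> V.
Hypothesis br_l : forall a x y z, br (a *: x + y) z = a *: br x z + br y z.
Hypothesis brC : forall x y, br x y = - br y x.

Let ipNl x z : ip (- x) z = - ip x z.
Proof. by rewrite -scaleN1r ipZl mulN1r. Qed.

Lemma levi_civitaE x y z : ip (levi_civita br ip x y) z = koszul br ip x y z.
Proof.
apply: rieszE => a u v; rewrite /koszul.
rewrite (brC y) br_l br_l ipNl (brC y u) (brC y v) !ipNl.
rewrite [ip (br x y) (_ + _)]ipC !ipDl !ipZl !(ipC _ (br x y)).
by field.
Qed.

Lemma levi_civita_torsion_free x y :
  levi_civita br ip x y - levi_civita br ip y x = br x y.
Proof.
apply: riesz_uniq => z; rewrite ipDl ipNl !levi_civitaE /koszul.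
by rewrite (brC y x) (brC x z) (brC z y) !ipNl; field.
Qed.

Lemma levi_civita_metric x y z :
  ip (levi_civita br ip x y) z + ip y (levi_civita br ip x z) = 0.
Proof.
rewrite (ipC y) !levi_civitaE /koszul.
by rewrite (brC z x) (brC y z) (brC y x) !ipNl; field.
Qed.

End Connection.

Lemma tensor_norm2E (T : V -> V -> R) (e : (\dim {:V}).-tuple V) :
    (forall a x y z, T (a *: x + y) z = a * T x z + T y z) ->
    (forall a x y z, T z (a *: x + y) = a * T z x + T z y) ->
    orthonormal_basis ip e ->
  tensor_norm2 ip T = \sum_(i < \dim {:V}) \sum_(k < \dim {:V}) T e`_i e`_k ^+ 2.
Proof.
move=> Tl Tr [_ e_on].
pose P := \matrix_(i, k < \dim {:V}) coord b k e`_i.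
have bilE (S : V -> V -> R) :
    (forall a x y z, S (a *: x + y) z = a * S x z + S y z) ->
    (forall a x y z, S z (a *: x + y) = a * S z x + S z y) ->
    forall i k : 'I_(\dim {:V}), (P *m gram S *m P^T) i k = S e`_i e`_k.
  move=> Sl Sr i k.
  have S0l z : S 0 z = 0.
    by have := Sl (-1) 0 0 z; rewrite scaler0 addr0 mulN1r addNr.
  have S0r z : S z 0 = 0.
    by have := Sr (-1) 0 0 z; rewrite scaler0 addr0 mulN1r addNr.
  have SDl n (F : 'I_n -> V) z : S (\sum_i F i) z = \sum_i S (F i) z.
    apply: (big_ind2 (fun x a => S x z = a)) => [|x a y c <- <-|]//.
    by have := Sl 1 x y z; rewrite scale1r mul1r.
  have SDr n (F : 'I_n -> V) z : S z (\sum_i F i) = \sum_i S z (F i).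
    apply: (big_ind2 (fun x a => S z x = a)) => [|x a y c <- <-|]//.
    by have := Sr 1 x y z; rewrite scale1r mul1r.
  rewrite mxE [in RHS](b_full e`_k) SDr; apply: eq_bigr => l _.
  have := Sr (coord b l e`_k) b`_l 0 e`_i; rewrite addr0 S0r addr0 => ->.
  rewrite mulrC !mxE; congr (_ * _).
  rewrite [in RHS](b_full e`_i) SDl; apply: eq_bigr => p _.
  have := Sl (coord b p e`_i) b`_p 0 b`_l; rewrite addr0 S0l addr0 => ->.
  by rewrite !mxE.
have ipr a x y z : ip z (a *: x + y) = a * ip z x + ip z y.
  by rewrite ipC ipDl ipZl !(ipC z).
have ipl a x y z : ip (a *: x + y) z = a * ip x z + ip y z.
  by rewrite ipDl ipZl.
have PGP : P *m gram ip *m P^T = 1%:M.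
  by apply/matrixP => i k; rewrite bilE// mxE e_on ?size_tuple.
have Gi : invmx (gram ip) = P^T *m P.
  have := mulmx1C PGP; rewrite mulmxA => PPG.
  by rewrite -[RHS](mulmxK gram_unit) PPG mul1mx.
have -> : tensor_norm2 ip T =
    \tr ((P *m gram T *m P^T) *m (P *m gram T *m P^T)^T).
  rewrite /tensor_norm2 Gi !trmx_mul trmxK.
  rewrite -!mulmxA mxtrace_mulC -!mulmxA.
  by [].
rewrite /mxtrace; apply: eq_bigr => i _; rewrite mxE; apply: eq_bigr => k _.
by rewrite [X in _ * X]mxE !bilE.
Qed.

End LeftInvariantTheory.

(** Families of left invariant metrics, and the metrics g_lambda(t). *)

Record metric_family (R : realType) := MetricFamily {
  lie_alg : vectType R;
  bracket : lie_alg -> lie_alg -> lie_alg;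
  base_metric : lie_alg -> lie_alg -> R;
  torus_alg : vectType R;
  torus_incl : torus_alg -> lie_alg;
  j_map : R -> torus_alg -> lie_alg }.

Section Family.
Variables (R : realType) (F : metric_family R).
Local Notation g := (lie_alg F).
Local Notation h := (torus_alg F).
Local Notation g0 := (@base_metric R F).
Local Notation incl := (@torus_incl R F).

Definition torus_metric (Y Z : h) : R := g0 (incl Y) (incl Z).

(* The transpose of j(t): g0(lambda(t) X, Z) = g0(X, j_Z(t)) for Z in h. *)
Definition lambda (t : R) (X : g) : h :=
  riesz torus_metric (fun Z => g0 X (j_map t Z)).

Lemma lambdaE : scalar_product torus_metric ->
    (forall t X a Y Z, g0 X (j_map t (a *: Y + Z)) =
       a * g0 X (j_map t Y) + g0 X (j_map t Z)) ->
  forall t X Z, g0 (incl (lambda t X)) (incl Z) = g0 X (j_map t Z).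
Proof. by move=> sp jl t X Z; rewrite -/(torus_metric _ _) /lambda rieszE. Qed.

Definition lambda_metric (t : R) (X Y : g) : R :=
  g0 (X + incl (lambda t X)) (Y + incl (lambda t Y)).

Definition ricci_lambda (t : R) : g -> g -> R :=
  ricci (@bracket R F) (lambda_metric t).

Definition ricci_norm2 (t : R) : R :=
  tensor_norm2 (lambda_metric t) (ricci_lambda t).

End Family.

(** Complex matrices as a real vector space. *)

Definition cmx (R : realType) (n : nat) : Type := 'M[R[i]]_n.

Section ComplexMatrices.
Variables (R : realType) (n : nat).

HB.instance Definition _ := GRing.Zmodule.copy (cmx R n) 'M[R[i]]_n.

Definition cmx_scale (a : R) (X : cmx R n) : cmx R n :=
  a%:C *: (X : 'M[R[i]]_n).

Fact cmx_scaleA a b X : cmx_scale a (cmx_scale b X) = cmx_scale (a * b) X.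
Proof. by rewrite /cmx_scale scalerA rmorphM. Qed.
Fact cmx_scale1 : left_id 1 cmx_scale.
Proof. by move=> X; rewrite /cmx_scale rmorph1 scale1r. Qed.
Fact cmx_scaleDr : right_distributive cmx_scale +%R.
Proof. by move=> a X Y; rewrite /cmx_scale scalerDr. Qed.
Fact cmx_scaleDl X : {morph cmx_scale^~ X : a b / a + b}.
Proof. by move=> a b; rewrite /cmx_scale rmorphD scalerDl. Qed.

HB.instance Definition _ := GRing.Zmodule_isLmodule.Build R (cmx R n)
  cmx_scaleA cmx_scale1 cmx_scaleDr cmx_scaleDl.

Definition cmx_Re (X : cmx R n) : 'M[R]_n := \matrix_(i, k) complex.Re (X i k).
Definition cmx_Im (X : cmx R n) : 'M[R]_n := \matrix_(i, k) complex.Im (X i k).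

Fact cmx_vect : Vector.axiom (n * n + n * n) (cmx R n).
Proof.
exists (fun X => row_mx (mxvec (cmx_Re X)) (mxvec (cmx_Im X))).
  move=> a X Y; rewrite scale_row_mx add_row_mx -!linearZ -!linearD /=.
  congr (row_mx (mxvec _) (mxvec _)); apply/matrixP => i k; rewrite !mxE /=.
    by case: (X i k) (Y i k) => [u v] [u' v'] /=; rewrite mul0r subr0.
  by case: (X i k) (Y i k) => [u v] [u' v'] /=; rewrite mul0r addr0.
exists (fun v => (\matrix_(i, k) (vec_mx (lsubmx v) i k +i* vec_mx (rsubmx v) i k))).
  move=> X; apply/matrixP => i k; rewrite mxE row_mxKl row_mxKr !mxvecK !mxE.
  by case: (X i k).
move=> v; rewrite -[RHS]hsubmxK -[in RHS](vec_mxK (lsubmx v)).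
rewrite -[in RHS](vec_mxK (rsubmx v)).
by congr (row_mx (mxvec _) (mxvec _)); apply/matrixP => i k; rewrite 2!mxE.
Qed.

HB.instance Definition _ := Lmodule_hasFinDim.Build R (cmx R n) cmx_vect.

End ComplexMatrices.

(** The compact matrix groups and their Lie algebras. *)

Definition conj_mx (T : comUnitRingType) n (A X : 'M[T]_n) : 'M[T]_n :=
  A *m X *m invmx A.
Definition comm_br (T : pzRingType) n (X Y : 'M[T]_n) : 'M[T]_n :=
  X *m Y - Y *m X.
Definition corner_ul (T : nmodType) m n (X : 'M[T]_m) : 'M[T]_(m + n) :=
  block_mx X 0 0 0.
Definition corner_dr (T : nmodType) m n (X : 'M[T]_n) : 'M[T]_(m + n) :=
  block_mx 0 0 0 X.

Section Orthogonal.
Variables (R : realType) (n : nat).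

Definition orthogonal (A : 'M[R]_n) : Prop := A *m A^T = 1%:M.
Definition special_orthogonal (A : 'M[R]_n) : Prop :=
  orthogonal A /\ \det A = 1.

Definition so_defect (X : 'M[R]_n) : 'M[R]_n := X + X^T.
Fact so_defect_linear : linear so_defect.
Proof. by move=> a X Y; rewrite /so_defect linearP scalerDr addrACA. Qed.
HB.instance Definition _ :=
  GRing.isLinear.Build R 'M[R]_n 'M[R]_n _ so_defect so_defect_linear.

Definition so_space : {vspace 'M[R]_n} := lker (linfun so_defect).
Definition so : vectType R := subvs_of so_space.

Lemma so_spaceP X : (X \in so_space) = (X^T == - X).
Proof. by rewrite memv_ker lfunE /= /so_defect addrC addr_eq0. Qed.

Definition so_mx (X : so) : 'M[R]_n := vsval X.
(* X as an element of so(n); meaningful if X is skew-symmetric (mk_soK). *)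
Definition mk_so (X : 'M[R]_n) : so := vsproj so_space X.

Lemma mk_soK X : X^T = - X -> so_mx (mk_so X) = X.
Proof. by move/eqP; rewrite -so_spaceP => /vsprojK. Qed.

Definition so_br (X Y : so) : so := mk_so (comm_br (so_mx X) (so_mx Y)).
Definition so_Ad (A : 'M[R]_n) (X : so) : so := mk_so (conj_mx A (so_mx X)).

Lemma so_skew X : (so_mx X)^T = - so_mx X.
Proof. by apply/eqP; rewrite -so_spaceP; apply: subvsP. Qed.

Lemma so_brE X Y : so_mx (so_br X Y) = comm_br (so_mx X) (so_mx Y).
Proof.
apply: mk_soK; rewrite linearB /= !trmx_mul !so_skew.
by rewrite !mulmxN !mulNmx !opprK opprB.
Qed.

Lemma so_AdE A X : orthogonal A -> so_mx (so_Ad A X) = conj_mx A (so_mx X).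
Proof.
move=> AO; have Au : A \in unitmx by case/mulmx1_unit: AO.
have Ai : invmx A = A^T.
  by rewrite -[LHS]mulmx1 -AO mulmxA mulVmx// mul1mx.
apply: mk_soK; rewrite /conj_mx Ai !trmx_mul trmxK so_skew.
by rewrite mulNmx mulmxN mulmxA.
Qed.

(* A left invariant metric is bi-invariant iff its scalar product is
   Ad-invariant; Ad(Spin(n)) = Ad(SO(n)), so this also describes the bi-invariant metrics on
   Spin(n). *)
Definition so_biinvariant (ip : so -> so -> R) : Prop :=
  scalar_product ip /\
  forall A, special_orthogonal A ->
    forall X Y, ip (so_Ad A X) (so_Ad A Y) = ip X Y.

End Orthogonal.

Section Unitary.
Variables (R : realType) (n : nat).
Local Open Scope sesquilinear_scope.

Definition special_unitary (A : 'M[R[i]]_n) : Prop :=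
  A \is unitarymx /\ \det A = 1.

Definition su_defect (X : cmx R n) : cmx R n :=
  (X : 'M[R[i]]_n) + (X : 'M[R[i]]_n) ^t*.
Definition cmx_tr (X : cmx R n) : cmx R 1 := (\tr (X : 'M[R[i]]_n))%:M.

Fact su_defect_linear : linear su_defect.
Proof.
move=> a X Y; apply/matrixP => i k; rewrite !mxE rmorphD rmorphM /=.
rewrite mulrDr addrACA [_^* in LHS]conj_Creal//.
by rewrite complex_real.
Qed.
Fact cmx_tr_linear : linear cmx_tr.
Proof.
move=> a X Y; apply/matrixP => i k; rewrite /cmx_tr linearP.
by rewrite !mxE mulrnDl mulrnAr.
Qed.
HB.instance Definition _ :=
  GRing.isLinear.Build R (cmx R n) (cmx R n) _ su_defect su_defect_linear.
HB.instance Definition _ :=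
  GRing.isLinear.Build R (cmx R n) (cmx R 1) _ cmx_tr cmx_tr_linear.

Definition su_space : {vspace cmx R n} :=
  (lker (linfun su_defect) :&: lker (linfun cmx_tr))%VS.
Definition su : vectType R := subvs_of su_space.

Lemma su_spaceP (X : 'M[R[i]]_n) :
  ((X : cmx R n) \in su_space) = (X ^t* == - X) && (\tr X == 0).
Proof.
rewrite memv_cap !memv_ker !lfunE /= /su_defect /cmx_tr.
rewrite addrC addr_eq0; congr (_ && _).
apply/eqP/eqP => [/matrixP/(_ 0 0)|->]; first by rewrite !mxE.
by apply/matrixP => i k; rewrite !mxE mul0rn.
Qed.

Definition su_mx (X : su) : 'M[R[i]]_n := vsval X.
(* Meaningful if X is skew-Hermitian of trace 0 (mk_suK). *)
Definition mk_su (X : 'M[R[i]]_n) : su := vsproj su_space X.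

Lemma mk_suK (X : 'M[R[i]]_n) : X ^t* = - X -> \tr X = 0 -> su_mx (mk_su X) = X.
Proof.
move=> Xh Xt; apply: (@vsprojK _ _ su_space (X : cmx R n)).
by rewrite su_spaceP Xh Xt !eqxx.
Qed.

Definition su_br (X Y : su) : su := mk_su (comm_br (su_mx X) (su_mx Y)).
Definition su_Ad (A : 'M[R[i]]_n) (X : su) : su := mk_su (conj_mx A (su_mx X)).

Lemma su_skew X : (su_mx X) ^t* = - su_mx X.
Proof.
by have := subvsP X; rewrite (su_spaceP (su_mx X)) => /andP[/eqP].
Qed.

Lemma su_traceless X : \tr (su_mx X) = 0.
Proof.
by have := subvsP X; rewrite (su_spaceP (su_mx X)) => /andP[_ /eqP].
Qed.

Lemma su_brE X Y : su_mx (su_br X Y) = comm_br (su_mx X) (su_mx Y).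
Proof.
apply: mk_suK; last by rewrite linearB /= mxtrace_mulC subrr.
rewrite linearB /= map_mxB !trmx_mul !map_mxM !su_skew.
by rewrite !mulmxN !mulNmx !opprK opprB.
Qed.

Lemma su_AdE A X : special_unitary A ->
  su_mx (su_Ad A X) = conj_mx A (su_mx X).
Proof.
move=> [AU _]; apply: mk_suK; rewrite /conj_mx; last first.
  by rewrite mxtrace_mulC mulmxA mulVmx ?unitarymx_unit// mul1mx su_traceless.
rewrite invmx_unitary// !trmx_mul !map_mxM trmxCK su_skew.
by rewrite mulNmx mulmxN mulmxA.
Qed.

Definition su_biinvariant (ip : su -> su -> R) : Prop :=
  scalar_product ip /\
  forall A, special_unitary A ->
    forall X Y, ip (su_Ad A X) (su_Ad A Y) = ip X Y.

End Unitary.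

(* The Lie algebras of the maximal tori of a compact Lie group are the maximal
   abelian subalgebras of its Lie algebra. *)
Definition maximal_torus_alg (R : realType) (V : vectType R)
    (br : V -> V -> V) (T : {vspace V}) : Prop :=
  let abelian (U : {vspace V}) := {in U &, forall x y, br x y = 0} in
  abelian T /\ forall U, abelian U -> (T <= U)%VS -> (U <= T)%VS.

(** Admissible families. *)

Section Admissible.
Variables (R : realType) (eps : R) (h : vectType R) (Z1 Z2 : h).

Definition inI (t : R) : Prop := - eps < t < eps.

Definition continuous_family (V : vectType R) (j : R -> 'Hom(h, V)) : Prop :=
  forall Z (i : 'I_(\dim {:V})),
    {within `]- eps, eps[, continuous (fun t => coord (vbasis {:V}) i (j t Z))}.

Definition nonconstant_near0 (T : Type) (f : R -> T) : Prop :=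
  forall a b, - eps <= a -> a < 0 -> 0 < b -> b <= eps ->
    exists s t, a < s < b /\ a < t < b /\ f s <> f t.

Definition so_admissible m (j : R -> 'Hom(h, so R m)) : Prop :=
  [/\ continuous_family j,
      forall t t', inI t -> inI t' -> forall Z, exists2 A, orthogonal A &
        so_mx (j t' Z) = conj_mx A (so_mx (j t Z))
    & nonconstant_near0 (fun t =>
        \tr ((so_mx (j t Z1) ^+ 2 + so_mx (j t Z2) ^+ 2) ^+ 2))].

Definition su_admissible m (j : R -> 'Hom(h, su R m)) : Prop :=
  [/\ continuous_family j,
      forall t t', inI t -> inI t' -> forall Z, exists2 A, special_unitary A &
        su_mx (j t' Z) = conj_mx A (su_mx (j t Z))
    & nonconstant_near0 (fun t =>
        \tr ((su_mx (j t Z1) ^+ 2 + su_mx (j t Z2) ^+ 2) ^+ 2))].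

End Admissible.

(** The map phi : su(m) -> so(2m), phi(X) = Psi X Psi^-1. *)

Section Realification.
Variables (R : realType) (m : nat).

Definition Psi (v : 'cV[R[i]]_m) : 'cV[R]_(m + m) :=
  col_mx (\col_k complex.Re (v k 0)) (\col_k complex.Im (v k 0)).

Definition realify (X : 'M[R[i]]_m) : 'M[R]_(m + m) :=
  block_mx (cmx_Re X) (- cmx_Im X) (cmx_Im X) (cmx_Re X).

Lemma realifyE X v : realify X *m Psi v = Psi (X *m v).
Proof.
have ReS n (F : 'I_n -> R[i]) : complex.Re (\sum_k F k) = \sum_k complex.Re (F k).
  by apply: (big_ind2 (fun x a => complex.Re x = a)) => // -[? ?] ? [? ?] ? <- <-.
have ImS n (F : 'I_n -> R[i]) : complex.Im (\sum_k F k) = \sum_k complex.Im (F k).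
  by apply: (big_ind2 (fun x a => complex.Im x = a)) => // -[? ?] ? [? ?] ? <- <-.
rewrite mul_block_col; congr col_mx; apply/colP => i; rewrite !mxE ?ReS ?ImS.
  rewrite -big_split /=; apply: eq_bigr => k _; rewrite !mxE.
  by case: (X i k) (v k 0) => [a b] [c d] /=; rewrite mulNr.
rewrite -big_split /=; apply: eq_bigr => k _; rewrite !mxE.
by case: (X i k) (v k 0) => [a b] [c d] /=; rewrite addrC.
Qed.

Definition phi (X : su R m) : so R (m + m) := mk_so (realify (su_mx X)).

Lemma phiE X : so_mx (phi X) = realify (su_mx X).
Proof.
apply: mk_soK; rewrite tr_block_mx opp_block_mx opprK.
have XE i k : su_mx X k i = - (su_mx X i k)^*%C.
  by have /matrixP/(_ k i) := su_skew X; rewrite !mxE => /(congr1 -%R);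
     rewrite opprK.
by congr block_mx; apply/matrixP => i k; rewrite !mxE XE;
   case: (su_mx X i k) => a b /=; rewrite ?opprK.
Qed.

Definition Jmx : 'M[R]_(m + m) := block_mx 0 (- 1%:M) 1%:M 0.

Lemma Jmx_so : so_mx (mk_so Jmx) = Jmx.
Proof.
apply: mk_soK; rewrite /Jmx tr_block_mx !trmx0 linearN /= trmx1.
by rewrite opp_block_mx oppr0 opprK.
Qed.

End Realification.

(** The five constructions. *)

Section Constructions.
Variables (R : realType) (eps : R).

Definition so_ul m n (X : so R m) : so R (m + n) := mk_so (corner_ul n (so_mx X)).
Definition so_dr m n (X : so R n) : so R (m + n) := mk_so (corner_dr m (so_mx X)).
Definition su_ul m n (X : su R m) : su R (m + n) := mk_su (corner_ul n (su_mx X)).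
Definition su_dr m n (X : su R n) : su R (m + n) := mk_su (corner_dr m (su_mx X)).

Lemma so_ulE m n X : so_mx (@so_ul m n X) = corner_ul n (so_mx X).
Proof.
apply: mk_soK.
by rewrite /corner_ul tr_block_mx !trmx0 so_skew opp_block_mx !oppr0.
Qed.

Lemma so_drE m n X : so_mx (@so_dr m n X) = corner_dr m (so_mx X).
Proof.
apply: mk_soK.
by rewrite /corner_dr tr_block_mx !trmx0 so_skew opp_block_mx !oppr0.
Qed.

Lemma su_ulE m n X : su_mx (@su_ul m n X) = corner_ul n (su_mx X).
Proof.
apply: mk_suK; last by rewrite mxtrace_block su_traceless mxtrace0 addr0.
by rewrite tr_block_mx map_block_mx su_skew !trmx0 !map_mx0 opp_block_mx !oppr0.
Qed.

Lemma su_drE m n X : su_mx (@su_dr m n X) = corner_dr m (su_mx X).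
Proof.
apply: mk_suK; last by rewrite mxtrace_block su_traceless mxtrace0 add0r.
by rewrite tr_block_mx map_block_mx su_skew !trmx0 !map_mx0 opp_block_mx !oppr0.
Qed.

Definition prod_ip (V W : vectType R) (ipV : V -> V -> R) (ipW : W -> W -> R)
    (x y : V * W) : R := ipV x.1 y.1 + ipW x.2 y.2.
(* The direct sum of the Lie algebra V and the abelian Lie algebra W. *)
Definition prod_br (V W : vectType R) (br : V -> V -> V) (x y : V * W) : V * W :=
  (br x.1 y.1, 0).

(* G = SO(m) x H or Spin(m) x H *)
Definition familyA m (h : vectType R) (gS : so R m -> so R m -> R)
    (gH : h -> h -> R) (j : R -> 'Hom(h, so R m)) : metric_family R :=
  @MetricFamily R (so R m * h)%type (prod_br (@so_br R m)) (prod_ip gS gH)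
    h (fun Z => (0, Z)) (fun t Z => (j t Z, 0)).

(* G = SU(m) x H *)
Definition familyB m (h : vectType R) (gS : su R m -> su R m -> R)
    (gH : h -> h -> R) (j : R -> 'Hom(h, su R m)) : metric_family R :=
  @MetricFamily R (su R m * h)%type (prod_br (@su_br R m)) (prod_ip gS gH)
    h (fun Z => (0, Z)) (fun t Z => (j t Z, 0)).

(* G = SO(m + 4) or Spin(m + 4) *)
Definition familyC m (g0 : so R (m + 4) -> so R (m + 4) -> R)
    (h : {vspace so R 4}) (j : R -> 'Hom(subvs_of h, so R m)) :
    metric_family R :=
  @MetricFamily R (so R (m + 4)) (@so_br R (m + 4)) g0
    (subvs_of h) (fun Z => so_dr m (vsval Z)) (fun t Z => so_ul 4 (j t Z)).

(* G = SU(m + 3) *)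
Definition familyD m (g0 : su R (m + 3) -> su R (m + 3) -> R)
    (h : {vspace su R 3}) (j : R -> 'Hom(subvs_of h, su R m)) :
    metric_family R :=
  @MetricFamily R (su R (m + 3)) (@su_br R (m + 3)) g0
    (subvs_of h) (fun Z => su_dr m (vsval Z)) (fun t Z => su_ul 3 (j t Z)).

(* h = R J + so(2) inside so(2m + 2) *)
Definition torusE m : {vspace so R ((m + m) + 2)} :=
  (<[so_ul 2 (mk_so (Jmx R m))]> +
   << [seq so_dr (m + m) X | X <- vbasis {:so R 2}] >>)%VS.

(* G = SO(2m + 2) or Spin(2m + 2) *)
Definition familyE m (g0 : so R ((m + m) + 2) -> so R ((m + m) + 2) -> R)
    (j : R -> 'Hom(subvs_of (torusE m), su R m)) : metric_family R :=
  @MetricFamily R (so R ((m + m) + 2)) (@so_br R ((m + m) + 2)) g0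
    (subvs_of (torusE m)) (fun Z => vsval Z) (fun t Z => so_ul 2 (phi (j t Z))).

(* In each case Z1, Z2 is a g0-orthonormal basis of h; in particular H is
   two-dimensional. *)
Inductive construction : metric_family R -> Prop :=
| ConstructionA m (h : vectType R) gS gH j (Z1 Z2 : h) of
    (5 <= m)%N & so_biinvariant gS & scalar_product gH &
    orthonormal_basis (@torus_metric R (@familyA m h gS gH j)) [:: Z1; Z2] &
    so_admissible eps Z1 Z2 j :
    construction (@familyA m h gS gH j)
| ConstructionB m (h : vectType R) gS gH j (Z1 Z2 : h) of
    (3 <= m)%N & su_biinvariant gS & scalar_product gH &
    orthonormal_basis (@torus_metric R (@familyB m h gS gH j)) [:: Z1; Z2] &
    su_admissible eps Z1 Z2 j :
    construction (@familyB m h gS gH j)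
| ConstructionC m g0 (h : {vspace so R 4}) j (Z1 Z2 : subvs_of h) of
    (5 <= m)%N & so_biinvariant g0 & maximal_torus_alg (@so_br R 4) h &
    orthonormal_basis (@torus_metric R (@familyC m g0 h j)) [:: Z1; Z2] &
    so_admissible eps Z1 Z2 j :
    construction (@familyC m g0 h j)
| ConstructionD m g0 (h : {vspace su R 3}) j (Z1 Z2 : subvs_of h) of
    (3 <= m)%N & su_biinvariant g0 & maximal_torus_alg (@su_br R 3) h &
    orthonormal_basis (@torus_metric R (@familyD m g0 h j)) [:: Z1; Z2] &
    su_admissible eps Z1 Z2 j :
    construction (@familyD m g0 h j)
| ConstructionE m g0 j (Z1 Z2 : subvs_of (torusE m)) of
    (3 <= m)%N & so_biinvariant g0 &
    orthonormal_basis (@torus_metric R (@familyE m g0 j)) [:: Z1; Z2] &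
    su_admissible eps Z1 Z2 j :
    construction (@familyE m g0 j).

End Constructions.

(* Main.v *)
From HB Require Import structures.
Require Import Defs.
From mathcomp Require Import all_boot all_order fingroup perm all_algebra.
From mathcomp Require Import boolp reals.
From mathcomp Require Import complex ring lra.
Import Order.TTheory GRing.Theory Num.Theory.
Set Implicit Arguments.
Unset Strict Implicit.
Unset Printing Implicit Defensive.
Local Open Scope complex_scope.
Local Open Scope sesquilinear_scope.
Local Open Scope ring_scope.

(** Write j_k = j(t)(Z_k) for the orthonormal basis Z_1, Z_2 of h, A_k = ad j_k,
B_k = ad Z_k and w_k = Z_k + j_k; all A_k commute with all B_l.  Transporting
the metric by Id + lambda, the Levi-Civita connection of g_lambda is that of g_0
plus rank one corrections built from Z_k and j_k, and for a unimodular Lie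
algebra Ric(x, y) = - tr (L_x L_y) with L_x z = nabla_z x.  Evaluating the traces,
the Ricci operator becomes

  1/2 sum_k (ad(w_k)^2 - ad(Z_k)^2) + 1/4 (Id + lambda) K (Id + lambda)^T,

where K represents minus the Killing form.  Each j(t)(Z) is carried to j(t')(Z) by
an isometric automorphism that fixes h pointwise.  After polarization in Z,
every term of the squared norm is therefore independent of t, except for
1/2 tr (ad(w_1)^2 ad(w_2)^2).  As tr ((X + a Y)^4) is constant too, tr (X^2 Y^2) is,
up to a constant, - 1/6 tr ([X, Y]^2).  This applies to X, Y = ad(w_1), ad(w_2), where
[w_1, w_2] = [j_1, j_2], and to X, Y = j_1, j_2 in the standard representation.  So both
the squared norm of Ric and tr ((j_1^2 + j_2^2)^2) are, up to constants, nonzero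
multiples of tr ([j_1, j_2]^2), the Killing form of so(n) and su(n) being a nonzero
multiple of the trace form. *)

(** The automorphism carrying j(s)(Z) to j(t)(Z) depends on Z, so none is available that moves j_1
    and j_2 simultaneously. There is one for each vector j_1 + a j_2 of the pencil; the values a =
    0, 1, -1 suffice, and what they leave open in the quartic traces is the commutator [j_1, j_2].

    Bi-invariance is given only under Ad of the connected group, while isospectrality in so(m)
    allows A in O(m). To make conjugation by such an A an isometry, the invariant scalar products of
    so(n), n >= 5, are shown to be multiples of the trace form. On su(n) the conjugating matrices
    are already special unitary, and only ad-invariance of g_0 has to be extracted from
    Ad-invariance; a Cayley transform does this without differentiation.

    No orthonormal basis of g is chosen: forms and operators are compared through Gram matrices in a
    fixed basis. *)

Lemma opp_self_eq0 (T : numDomainType) (x : T) : x = - x -> x = 0.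
Proof.
move=> /eqP; rewrite -addr_eq0 -mulr2n -mulr_natr mulf_eq0 pnatr_eq0 orbF.
by move=> /eqP.
Qed.

Lemma linear_fun0 (R : pzRingType) (U V : lmodType R) (f : U -> V) : linear f -> f 0 = 0.
Proof.
by move=> lf; have := lf (-1) 0 0; rewrite scaler0 addr0 scaleN1r addNr.
Qed.

Lemma Re_sum (R : realType) I (r : seq I) (F : I -> R[i]) :
  complex.Re (\sum_(i <- r) F i) = \sum_(i <- r) complex.Re (F i).
Proof. by apply: (big_morph (@complex.Re R)) => // -[? ?] [? ?]. Qed.

Lemma Im_sum (R : realType) I (r : seq I) (F : I -> R[i]) :
  complex.Im (\sum_(i <- r) F i) = \sum_(i <- r) complex.Im (F i).
Proof. by apply: (big_morph (@complex.Im R)) => // -[? ?] [? ?]. Qed.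

(** * Traces and bilinear forms *)

Section EndoMatrix.
Variables (R : realType) (V : vectType R).
Local Notation b := (vbasis {:V}).
Local Notation n := (\dim {:V}).
Implicit Types (f g : V -> V) (x y : V).

Definition coords x : 'cV[R]_n := \col_i coord b i x.
Definition endo_mx f : 'M[R]_n := \matrix_(i, k) coord b i (f b`_k).

Lemma endo_traceE f : endo_trace f = \tr (endo_mx f).
Proof. by apply: eq_bigr => i _; rewrite mxE. Qed.

Lemma coords_linear : linear coords.
Proof. by move=> a x y; apply/colP => i; rewrite !mxE linearP. Qed.
HB.instance Definition _ := GRing.isLinear.Build R V 'cV[R]_n _ coords coords_linear.

Lemma vbasis_sum x : x = \sum_i coord b i x *: b`_i.
Proof. exact: coord_vbasis (memvf x). Qed.

Lemma coords_vbasis (i : 'I_n) : coords b`_i = delta_mx i 0.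
Proof.
apply/matrixP => k l; rewrite !mxE ord1 eqxx andbT coord_free //.
  by rewrite eq_sym.
exact: basis_free (vbasisP _).
Qed.

Lemma coords_endo f x : linear f -> coords (f x) = endo_mx f *m coords x.
Proof.
move=> lf; pose F := GRing.isLinear.Build R V V _ f lf.
pose f' : {linear V -> V} := HB.pack f F.
rewrite {1}(vbasis_sum x) -[f]/(f' : V -> V) !linear_sum /=.
apply/matrixP => i l; rewrite summxE mxE; apply: eq_bigr => k _.
by rewrite -[f]/(f' : V -> V) !linearZ !mxE mulrC.
Qed.

Lemma endo_mx_comp f g : linear f ->
  endo_mx (fun x => f (g x)) = endo_mx f *m endo_mx g.
Proof.
move=> lf; apply/matrixP => i k.
have /matrixP/(_ i 0) := coords_endo (g b`_k) lf.
by rewrite !mxE => ->; apply: eq_bigr => l _; rewrite !mxE.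
Qed.

Lemma endo_mxD f g : endo_mx (fun x => f x + g x) = endo_mx f + endo_mx g.
Proof. by apply/matrixP => i k; rewrite !mxE linearD. Qed.

Lemma endo_mxZ a f : endo_mx (fun x => a *: f x) = a *: endo_mx f.
Proof. by apply/matrixP => i k; rewrite !mxE linearZ. Qed.

Lemma endo_mxN f : endo_mx (fun x => - f x) = - endo_mx f.
Proof. by apply/matrixP => i k; rewrite !mxE linearN. Qed.

Lemma endo_mx_id : endo_mx (fun x => x) = 1%:M.
Proof.
apply/matrixP => i k; rewrite !mxE coord_free 1?eq_sym //.
exact: basis_free (vbasisP _).
Qed.

Lemma endo_mx_sum I (r : seq I) (P : pred I) (F : I -> V -> V) :
  endo_mx (fun x => \sum_(i <- r | P i) F i x) = \sum_(i <- r | P i) endo_mx (F i).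
Proof.
apply/matrixP => i k; rewrite summxE !mxE linear_sum /=.
by apply: eq_bigr => l _; rewrite mxE.
Qed.

Lemma eq_endo_mx f g : f =1 g -> endo_mx f = endo_mx g.
Proof. by move=> fg; apply/matrixP => i k; rewrite !mxE fg. Qed.

(* The vectors u_i need not be independent, so that the trace can be computed
   from any spanning family. *)
Lemma endo_trace_frame (I : finType) (p : I -> V -> R) (u : I -> V) f :
    (forall i a x y, p i (a *: x + y) = a * p i x + p i y) ->
    (forall x, x = \sum_i p i x *: u i) -> linear f ->
  endo_trace f = \sum_i p i (f (u i)).
Proof.
move=> pl pu lf; pose F := GRing.isLinear.Build R V V _ f lf.
pose f' : {linear V -> V} := HB.pack f F.
have p0 i : p i 0 = 0.
  by have := pl i (-1) 0 0; rewrite scaler0 addr0 mulN1r addNr.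
have pS i J (r : seq J) G : p i (\sum_(j <- r) G j) = \sum_(j <- r) p i (G j).
  apply: (big_morph (p i)) => // x y.
  by have := pl i 1 x y; rewrite scale1r mul1r.
have pZ i a x : p i (a *: x) = a * p i x.
  by have := pl i a x 0; rewrite p0 !addr0.
have fE x : f x = \sum_i p i x *: f (u i).
  rewrite {1}(pu x) -[f]/(f' : V -> V) linear_sum.
  by apply: eq_bigr => i _; rewrite linearZ.
rewrite /endo_trace.
under eq_bigr do rewrite fE linear_sum.
rewrite exchange_big /=; apply: eq_bigr => i _.
rewrite [in RHS](vbasis_sum (f (u i))) pS; apply: eq_bigr => k _.
by rewrite pZ linearZ /= mulrC.
Qed.

Lemma endo_trace_comm f g : linear f -> linear g ->
  endo_trace (fun x => f (g x)) = endo_trace (fun x => g (f x)).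
Proof.
move=> lf lg; rewrite !endo_traceE (endo_mx_comp g lf) (endo_mx_comp f lg).
exact: mxtrace_mulC.
Qed.

End EndoMatrix.

Section BilinearForm.
Variables (R : realType) (V : vectType R) (ip : V -> V -> R).
Hypothesis ip_sp : scalar_product ip.

Lemma ip_sym x y : ip x y = ip y x. Proof. by case: ip_sp. Qed.

Lemma ip_l_linear a x y z : ip (a *: x + y) z = a * ip x z + ip y z.
Proof. by case: ip_sp => ->. Qed.
Lemma ip_r_linear a x y z : ip z (a *: x + y) = a * ip z x + ip z y.
Proof. by rewrite !(ip_sym z) ip_l_linear. Qed.

Lemma ipDl x y z : ip (x + y) z = ip x z + ip y z.
Proof. by have := ip_l_linear 1 x y z; rewrite scale1r mul1r. Qed.
Lemma ip0l z : ip 0 z = 0.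
Proof. by apply: (addrI (ip 0 z)); rewrite -ipDl !addr0. Qed.
Lemma ipZl a x z : ip (a *: x) z = a * ip x z.
Proof. by have := ip_l_linear a x 0 z; rewrite ip0l !addr0. Qed.
Lemma ipNl x z : ip (- x) z = - ip x z.
Proof. by rewrite -scaleN1r ipZl mulN1r. Qed.
Lemma ip_suml z I (r : seq I) (P : pred I) F :
  ip (\sum_(i <- r | P i) F i) z = \sum_(i <- r | P i) ip (F i) z.
Proof. by apply: (big_morph (ip^~ z)) => [x y|]; rewrite ?ipDl ?ip0l. Qed.

Lemma ipDr x y z : ip x (y + z) = ip x y + ip x z.
Proof. by rewrite !(ip_sym x) ipDl. Qed.
Lemma ip0r x : ip x 0 = 0. Proof. by rewrite ip_sym ip0l. Qed.
Lemma ipZr x a z : ip x (a *: z) = a * ip x z.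
Proof. by rewrite !(ip_sym x) ipZl. Qed.
Lemma ipNr x z : ip x (- z) = - ip x z.
Proof. by rewrite !(ip_sym x) ipNl. Qed.
Lemma ip_sumr x I (r : seq I) (P : pred I) F :
  ip x (\sum_(i <- r | P i) F i) = \sum_(i <- r | P i) ip x (F i).
Proof. by rewrite ip_sym ip_suml; apply: eq_bigr => i _; rewrite ip_sym. Qed.

Lemma gram_tr : (gram ip)^T = gram ip.
Proof. by apply/matrixP => i k; rewrite !mxE ip_sym. Qed.

End BilinearForm.

Section Gram.
Variables (R : realType) (V : vectType R) (B : V -> V -> R).
Hypothesis Bl : forall a x y z, B (a *: x + y) z = a * B x z + B y z.
Hypothesis Br : forall a x y z, B z (a *: x + y) = a * B z x + B z y.
Local Notation c := (@coords R V).

Lemma bilinear_coords x y : B x y = ((c x)^T *m gram B *m c y) 0 0.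
Proof.
have Bsl z n (a : 'I_n -> R) (F : 'I_n -> V) :
    B (\sum_i a i *: F i) z = \sum_i a i * B (F i) z.
  elim/big_rec2: _ => [|i u v _ <-]; last by rewrite Bl.
  by have := Bl (-1) 0 0 z; rewrite scaler0 addr0 mulN1r addNr.
have Bsr z n (a : 'I_n -> R) (F : 'I_n -> V) :
    B z (\sum_i a i *: F i) = \sum_i a i * B z (F i).
  elim/big_rec2: _ => [|i u v _ <-]; last by rewrite Br.
  by have := Br (-1) 0 0 z; rewrite scaler0 addr0 mulN1r addNr.
rewrite {1}(vbasis_sum x) {1}(vbasis_sum y) Bsr mxE; apply: eq_bigr => k _.
rewrite Bsl mulrC !mxE; congr (_ * _).
by apply: eq_bigr => i _; rewrite !mxE.
Qed.

Lemma gram_comp f g : linear f -> linear g ->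
  gram (fun x y => B (f x) (g y)) = (endo_mx f)^T *m gram B *m endo_mx g.
Proof.
move=> lf lg; apply/matrixP => i k; rewrite mxE bilinear_coords.
rewrite !coords_endo // !coords_vbasis trmx_mul !mulmxA trmx_delta.
by rewrite -[in LHS](mulmxA (delta_mx 0 i)) -[in LHS](mulmxA (delta_mx 0 i)) -rowE -colE !mxE.
Qed.

End Gram.

Section SkewTrace.
Variables (R : realType) (V : vectType R) (ip : V -> V -> R).
Hypothesis ip_sp : scalar_product ip.

Lemma gram_endo f : linear f ->
  gram (fun x y => ip x (f y)) = gram ip *m endo_mx f.
Proof.
move=> lf; have li : linear (fun x : V => x) by [].
rewrite (gram_comp _ _ li lf) ?endo_mx_id ?trmx1 ?mul1mx //.
  exact: ip_l_linear.
exact: ip_r_linear.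
Qed.

(** With [G] the Gram matrix and [M] the matrix of [f], the product [G M] is skew while [G^-1] is
    symmetric; transposing [G^-1 (G M)] under the trace therefore changes its sign. *)
Lemma skew_trace0 f : linear f -> (forall x y, ip (f x) y = - ip x (f y)) ->
  endo_trace f = 0.
Proof.
move=> lf skf; have := gram_endo lf.
set A := gram _; set M := endo_mx f; set G := gram ip => AE.
have AT : A^T = - A.
  by apply/matrixP => i k; rewrite !mxE -skf (ip_sym ip_sp).
have Gu : G \in unitmx by exact: gram_unit.
have ME : M = invmx G *m A by rewrite AE mulKmx.
suff: \tr M = - \tr M by rewrite endo_traceE -/M; lra.
rewrite {1}ME -mxtrace_tr trmx_mul AT trmx_inv gram_tr // mulNmx linearN /=.
by rewrite mxtrace_mulC ME.
Qed.

End SkewTrace.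

(** * Ricci curvature of the deformed metrics *)

Section UnimodularRicci.
Variables (R : realType) (V : vectType R) (br : V -> V -> V) (ip : V -> V -> R).
Hypothesis ip_sp : scalar_product ip.
Hypothesis br_l : forall a x y z, br (a *: x + y) z = a *: br x z + br y z.
Hypothesis brC : forall x y, br x y = - br y x.
Hypothesis unimodular : forall x, endo_trace (br x) = 0.
Local Notation D := (levi_civita br ip).

Lemma br_r a x y z : br z (a *: x + y) = a *: br z x + br z y.
Proof. by rewrite !(brC z) br_l opprD scalerN. Qed.

Lemma levi_civita_linear_l z : linear (fun x => D x z).
Proof.
move=> a x y; apply: (riesz_uniq ip_sp) => w.
rewrite (ipDl ip_sp) (ipZl ip_sp) !levi_civitaE // /koszul.
rewrite !br_l !br_r !(ipDl ip_sp, ipZl ip_sp, ipDr ip_sp, ipZr ip_sp); ring.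
Qed.

Lemma levi_civita_linear_r z : linear (D z).
Proof.
move=> a x y; apply: (riesz_uniq ip_sp) => w.
rewrite (ipDl ip_sp) (ipZl ip_sp) !levi_civitaE // /koszul.
rewrite !br_l !br_r !(ipDl ip_sp, ipZl ip_sp, ipDr ip_sp, ipZr ip_sp); ring.
Qed.

(** The map z -> D_z w has trace tr D_w - tr ad(w) = 0, since D_w is skew and the algebra
    unimodular; this removes z -> D_z D_x y. Splitting [z, x] as D_z x - D_x z, the terms D_x D_z y
    and D_(D_x z) y have equal traces and cancel, which leaves D_(D_z x) y. *)
Lemma ricci_unimodular x y :
  ricci br ip x y = - endo_trace (fun z => D (D z x) y).
Proof.
have DE z w : D z w = D w z + br z w.
  by rewrite -(levi_civita_torsion_free ip_sp br_l brC z w) addrC subrK.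
have trL w : endo_trace (fun z => D z w) = 0.
  have tD : endo_trace (D w) = 0.
    apply: (skew_trace0 ip_sp); first exact: levi_civita_linear_r.
    move=> u v; apply/eqP; rewrite -subr_eq0 opprK; apply/eqP.
    exact: levi_civita_metric.
  rewrite endo_traceE (eq_endo_mx (g := fun z => D w z - br w z)); last first.
    by move=> z; rewrite [LHS]DE brC.
  by rewrite endo_mxD endo_mxN linearB /= -!endo_traceE tD unimodular subrr.
have curvE z : curvature br ip z x y =
    D z (D x y) - D x (D z y) - D (D z x) y + D (D x z) y.
  rewrite /curvature /= -(levi_civita_torsion_free ip_sp br_l brC z x).
  have lD := levi_civita_linear_l y; have := lD (-1) (D x z) (D z x).
  rewrite !scaleN1r [- _ + D z x]addrC => ->.
  by rewrite opprD opprK [in RHS]addrAC !addrA.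
rewrite /ricci endo_traceE (eq_endo_mx curvE) !(endo_mxD, endo_mxN).
rewrite !(linearD, linearN) /= -!endo_traceE trL sub0r.
rewrite (endo_trace_comm (levi_civita_linear_r x) (levi_civita_linear_l y)).
by rewrite addrAC addNr add0r.
Qed.

End UnimodularRicci.

(** The last condition is bi-invariance in infinitesimal form: every ad(y) is skew. *)
Definition metric_lie_algebra (R : realType) (V : vectType R)
    (br : V -> V -> V) (ip : V -> V -> R) : Prop :=
  [/\ scalar_product ip,
      forall a x y z, br (a *: x + y) z = a *: br x z + br y z,
      forall x y, br x y = - br y x,
      forall x y z, br x (br y z) = br (br x y) z + br y (br x z)
    & forall x y z, ip (br x y) z = ip x (br y z)].

Section MetricLieAlgebra.
Variables (R : realType) (V : vectType R) (br : V -> V -> V) (ip : V -> V -> R).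
Hypothesis mla : metric_lie_algebra br ip.

Let ip_sp : scalar_product ip. Proof. by case: mla. Qed.

Lemma br_linear_l a x y z : br (a *: x + y) z = a *: br x z + br y z.
Proof. by case: mla. Qed.
Lemma brC x y : br x y = - br y x. Proof. by case: mla. Qed.
Lemma br_jacobi x y z : br x (br y z) = br (br x y) z + br y (br x z).
Proof. by case: mla. Qed.
Lemma ip_br x y z : ip (br x y) z = ip x (br y z). Proof. by case: mla. Qed.

Lemma brDl x y z : br (x + y) z = br x z + br y z.
Proof. by have := br_linear_l 1 x y z; rewrite !scale1r. Qed.
Lemma br0l z : br 0 z = 0.
Proof. by apply: (addrI (br 0 z)); rewrite -brDl !addr0. Qed.
Lemma brZl a x z : br (a *: x) z = a *: br x z.
Proof. by have := br_linear_l a x 0 z; rewrite br0l !addr0. Qed.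
Lemma brNl x z : br (- x) z = - br x z.
Proof. by rewrite -scaleN1r brZl scaleN1r. Qed.
Lemma br_suml z I (r : seq I) (P : pred I) F :
  br (\sum_(i <- r | P i) F i) z = \sum_(i <- r | P i) br (F i) z.
Proof. by apply: (big_morph (br^~ z)) => [x y|]; rewrite ?brDl ?br0l. Qed.

Lemma brDr x y z : br x (y + z) = br x y + br x z.
Proof. by rewrite !(brC x) brDl opprD. Qed.
Lemma br0r x : br x 0 = 0. Proof. by rewrite brC br0l oppr0. Qed.
Lemma brZr x a z : br x (a *: z) = a *: br x z.
Proof. by rewrite !(brC x) brZl scalerN. Qed.
Lemma brNr x z : br x (- z) = - br x z.
Proof. by rewrite !(brC x) brNl. Qed.
Lemma br_sumr x I (r : seq I) (P : pred I) F :
  br x (\sum_(i <- r | P i) F i) = \sum_(i <- r | P i) br x (F i).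
Proof. by rewrite brC br_suml -sumrN; apply: eq_bigr => i _; rewrite -brC. Qed.
Lemma br_linear x : linear (br x).
Proof. by move=> a y z; rewrite brDr brZr. Qed.
Lemma brxx x : br x x = 0.
Proof.
apply/eqP; have /eqP := brC x x; rewrite -subr_eq0 opprK -mulr2n -scaler_nat.
by rewrite scaler_eq0 pnatr_eq0.
Qed.

Lemma ip_br_skew x y z : ip (br x y) z = - ip y (br x z).
Proof. by rewrite brC (ipNl ip_sp) ip_br. Qed.

Lemma ip_br_swap x y z : ip (br x y) z = - ip (br y x) z.
Proof. by rewrite brC (ipNl ip_sp). Qed.
Lemma ip_br_cycle x y z : ip (br x y) z = ip (br y z) x.
Proof. by rewrite ip_br (ip_sym ip_sp). Qed.

Lemma br_unimodular x : endo_trace (br x) = 0.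
Proof.
apply: (skew_trace0 ip_sp); first exact: br_linear.
by move=> y z; rewrite ip_br_skew.
Qed.

End MetricLieAlgebra.

(** * Rank one operators *)

Section RankOne.
Variables (R : realType) (V : vectType R) (ip : V -> V -> R).
Hypothesis ip_sp : scalar_product ip.

Definition rank1_mx (u v : V) := endo_mx (fun x => ip v x *: u).

Lemma rank1_linear (u v : V) : linear (fun x : V => ip v x *: u).
Proof. by move=> a x y; rewrite ip_r_linear // scalerDl scalerA. Qed.

Lemma trace_rank1 u v : \tr (rank1_mx u v) = ip v u.
Proof.
rewrite [in RHS](vbasis_sum u) ip_sumr //; apply: eq_bigr => i _.
by rewrite mxE linearZ ipZr //= mulrC.
Qed.

Lemma endo_rank1 f u v : linear f -> endo_mx f *m rank1_mx u v = rank1_mx (f u) v.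
Proof.
move=> lf; rewrite -endo_mx_comp //; apply: eq_endo_mx => x.
have f0 := linear_fun0 lf.
by have := lf (ip v x) u 0; rewrite f0 !addr0.
Qed.

Lemma rank1_rank1 u v u' v' : rank1_mx u v *m rank1_mx u' v' = ip v u' *: rank1_mx u v'.
Proof.
rewrite endo_rank1; last exact: rank1_linear.
by rewrite -endo_mxZ; apply: eq_endo_mx => x; rewrite !scalerA mulrC.
Qed.

(** This factorization through a line turns the trace of a product with rank one factors into a
    product of scalars. *)
Lemma rank1_coords u v : rank1_mx u v = coords u *m (coords v)^T *m gram ip.
Proof.
have gE x : ip v x = ((coords v)^T *m gram ip *m coords x) 0 0.
  by apply: bilinear_coords; [exact: ip_l_linear | exact: ip_r_linear].
apply/matrixP => i k; rewrite mxE linearZ /= gE coords_vbasis -colE -mulmxA.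
by rewrite [RHS]mxE big_ord1 [coords u i 0]mxE mulrC mxE.
Qed.

End RankOne.

Section Killing.
Variables (R : realType) (V : vectType R) (br : V -> V -> V) (ip : V -> V -> R).
Hypothesis mla : metric_lie_algebra br ip.

Definition killing x y : R := endo_trace (fun v => br x (br y v)).

Lemma killingE x y : killing x y = \tr (endo_mx (br x) *m endo_mx (br y)).
Proof. by rewrite /killing endo_traceE endo_mx_comp //; exact: br_linear mla x. Qed.

Lemma ad_mx_linear : linear (fun x : V => endo_mx (br x)).
Proof.
move=> a x y; rewrite -endo_mxZ -endo_mxD; apply: eq_endo_mx => v.
exact: br_linear_l mla _ _ _ _.
Qed.

Lemma killing_sym x y : killing x y = killing y x.
Proof. by rewrite !killingE mxtrace_mulC. Qed.

Lemma killing_linear_l a x y v : killing (a *: x + y) v = a * killing x v + killing y v.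
Proof. by rewrite !killingE ad_mx_linear mulmxDl -scalemxAl linearP. Qed.

Lemma killing_linear_r a x y v : killing v (a *: x + y) = a * killing v x + killing v y.
Proof. by rewrite !(killing_sym v) killing_linear_l. Qed.

End Killing.

(** With P = X^2 + Y^2 and Q = XY + YX, the squares of X + Y and X - Y are P + Q and P - Q, so their
    quartic traces add up to 2 tr P^2 + 2 tr Q^2. By cyclicity this contains 8 tr (X^2 Y^2) + 4 tr
    (XYXY); subtracting 2 tr ([X, Y]^2) = 4 tr (XYXY) - 4 tr (X^2 Y^2) eliminates tr (XYXY) and
    gives the coefficient 12. *)
Lemma mxtrace_sq_sq (T : comNzRingType) n (X Y : 'M[T]_n) :
  let t4 A := \tr (A *m A *m (A *m A)) in
  \tr (X *m X *m (Y *m Y)) *+ 12 = t4 (X + Y) + t4 (X - Y) - t4 X *+ 2 - t4 Y *+ 2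
    - \tr (comm_br X Y *m comm_br X Y) *+ 2.
Proof.
pose P := X *m X + Y *m Y; pose Q := X *m Y + Y *m X.
have sqD : (X + Y) *m (X + Y) = P + Q.
  by rewrite mulmxDl !mulmxDr [Y *m X + _]addrC addrACA.
have sqB : (X - Y) *m (X - Y) = P - Q.
  by rewrite mulmxBl !mulmxBr opprB addrACA -opprD.
have e1 : \tr (X *m Y *m (Y *m X)) = \tr (X *m X *m (Y *m Y)).
  by rewrite mulmxA mxtrace_mulC !mulmxA.
have e3 : \tr (Y *m X *m (Y *m X)) = \tr (X *m Y *m (X *m Y)).
  by rewrite -!mulmxA mxtrace_mulC !mulmxA.
have trN (A : 'M[T]_n) : \tr (- A) = - \tr A by rewrite raddfN.
have quad (A B : 'M[T]_n) : [/\ \tr ((A + B) *m (A + B)) =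
    \tr (A *m A) + \tr (A *m B) *+ 2 + \tr (B *m B)
  & \tr ((A - B) *m (A - B)) =
    \tr (A *m A) - \tr (A *m B) *+ 2 + \tr (B *m B)].
  rewrite !mulmxDl !mulmxDr !mulNmx !mulmxN !(mxtraceD, trN).
  by rewrite (mxtrace_mulC B A); split; ring.
have [qP qN] := quad P Q; rewrite /= sqD sqB qP qN.
have [-> _] := quad (X *m X) (Y *m Y); have [-> _] := quad (X *m Y) (Y *m X).
have [_ ->] := quad (X *m Y) (Y *m X).
rewrite e1 e3; ring.
Qed.

(** Raising an index of [T] with [ip] gives [P^-1 S P], once for each factor because [T] is
    symmetric, and the trace does not see the conjugation by [P]. *)
Lemma tensor_norm2_op (R : realType) (V : vectType R) (ip T : V -> V -> R)
    (P G S : 'M[R]_(\dim {:V})) :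
    P \in unitmx -> G \in unitmx -> G^T = G -> (G *m S)^T = G *m S ->
    gram ip = P^T *m G *m P -> gram T = P^T *m (G *m S) *m P ->
  tensor_norm2 ip T = \tr (S *m S).
Proof.
move=> Pu Gu Gs GSs ipE TE; rewrite /tensor_norm2 ipE TE.
have Pu' : P^T \in unitmx by rewrite unitmx_tr.
set A := P^T *m G *m P; have Au : A \in unitmx by rewrite !unitmx_mul Pu' Gu.
have E : invmx A *m (P^T *m (G *m S) *m P) = invmx P *m S *m P.
  apply: (can_inj (mulKmx Au)); rewrite mulKVmx // /A !mulmxA mulmxK //.
rewrite !trmx_mul trmxK -[S^T *m G^T]trmx_mul GSs.
rewrite E [P^T *m (_ *m P)]mulmxA -mulmxA E -!mulmxA mulKVmx //.
by rewrite mxtrace_mulC -!mulmxA mulmxV // mulmx1.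
Qed.

Section KillingOperator.
Variables (R : realType) (V : vectType R) (br : V -> V -> V) (ip : V -> V -> R).
Hypothesis mla : metric_lie_algebra br ip.
Let ip_sp : scalar_product ip. Proof. by case: mla. Qed.
Local Notation G := (gram ip).

(* The matrix of the self-adjoint operator K with ip (K x) y = - killing x y. *)
Definition killing_mx : 'M[R]_(\dim {:V}) := - (invmx G *m gram (killing br)).
Local Notation K := killing_mx.

Lemma gram_killing_mx : G *m K = - gram (killing br).
Proof. by rewrite mulmxN mulKVmx // gram_unit. Qed.

(** This is ip(x, X y) for the operator with matrix [X]. *)
Definition op_form (X : 'M[R]_(\dim {:V})) x y := ((coords x)^T *m (G *m X) *m coords y) 0 0.

Lemma op_form_killing x y : op_form K x y = - killing br x y.
Proof.
rewrite /op_form gram_killing_mx mulmxN mulNmx mxE -bilinear_coords //.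
  exact: killing_linear_l mla.
exact: killing_linear_r mla.
Qed.

Lemma trace_mul_rank1 X u v : \tr (X *m rank1_mx ip u v) = op_form X v u.
Proof.
rewrite rank1_coords // /op_form -mulmxA mulmxA mxtrace_mulC !mulmxA.
by rewrite /mxtrace big_ord1.
Qed.

Lemma trace_mul_rank1_rank1 X u v : \tr (X *m rank1_mx ip u u *m (X *m rank1_mx ip v v)) =
  op_form X v u * op_form X u v.
Proof.
transitivity (\tr ((coords v)^T *m (G *m X) *m coords u *m
                   ((coords u)^T *m (G *m X) *m coords v))); last first.
  by rewrite /mxtrace big_ord1 mxE big_ord1.
rewrite !rank1_coords // !mulmxA mxtrace_mulC !mulmxA.
by rewrite [in LHS]mxtrace_mulC !mulmxA.
Qed.

End KillingOperator.

(** * Connection, Ricci tensor and squared norm for the sheared metric *)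

Section Deformation.
Variables (R : realType) (V : vectType R) (br : V -> V -> V) (ip : V -> V -> R).
Hypothesis mla : metric_lie_algebra br ip.
Variables (I : finType) (z j : I -> V).
Hypothesis z_on : forall k l, ip (z k) (z l) = (k == l)%:R.
Hypothesis br_zz : forall k l, br (z k) (z l) = 0.
Hypothesis br_jz : forall k l, br (j k) (z l) = 0.
Hypothesis ip_jz : forall k l, ip (j k) (z l) = 0.

Let ip_sp : scalar_product ip. Proof. by case: mla. Qed.
Let ipE := (ipDl ip_sp, ipZl ip_sp, ipNl ip_sp, ipDr ip_sp, ipZr ip_sp,
  ipNr ip_sp, ip_suml ip_sp, ip_sumr ip_sp).
Let brE := (brDl mla, brZl mla, brNl mla, brDr mla, brZr mla,
  brNr mla, br_suml mla, br_sumr mla).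
Let br_zj k l : br (z k) (j l) = 0.
Proof. by rewrite (brC mla) br_jz oppr0. Qed.
Let ip_zj k l : ip (z k) (j l) = 0.
Proof. by rewrite (ip_sym ip_sp) ip_jz. Qed.

(* With j k = j(t)(z k), torus_part is lambda(t), sheared_ip is g_lambda(t), and
   coshear is the transpose of shear. *)
Definition torus_part (x : V) : V := \sum_k ip x (j k) *: z k.
Definition shear x : V := x + torus_part x.
Definition unshear x : V := x - torus_part x.
Definition coshear x : V := x + \sum_k ip x (z k) *: j k.
Definition sheared_ip x y : R := ip (shear x) (shear y).

Lemma torus_part_linear : linear torus_part.
Proof.
move=> a x y; rewrite /torus_part scaler_sumr -big_split; apply: eq_bigr => k _.
by rewrite !ipE scalerDl scalerA.
Qed.

(** lambda takes values in h, which is orthogonal to the image of j. Its square being 0, Id - lambda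
    inverts Id + lambda. *)
Lemma torus_part_idem x : torus_part (torus_part x) = 0.
Proof.
rewrite [LHS]big1 // => k _; rewrite !ipE big1 ?scale0r // => l _.
by rewrite ipE ip_zj mulr0.
Qed.

Lemma shear_linear : linear shear.
Proof. by move=> a x y; rewrite /shear torus_part_linear scalerDr addrACA. Qed.
Lemma unshear_linear : linear unshear.
Proof.
move=> a x y; rewrite /unshear torus_part_linear scalerDr opprD addrACA.
by rewrite scalerN.
Qed.
Lemma coshear_linear : linear coshear.
Proof.
move=> a x y; rewrite /coshear scalerDr addrACA; congr (_ + _).
rewrite scaler_sumr -big_split; apply: eq_bigr => k _.
by rewrite !ipE scalerDl scalerA.
Qed.

Let torus_partD x y : torus_part (x + y) = torus_part x + torus_part y.
Proof. by have := torus_part_linear 1 x y; rewrite !scale1r. Qed.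
Let torus_partN x : torus_part (- x) = - torus_part x.
Proof.
have := torus_part_linear (-1) x 0; rewrite !scaleN1r !addr0 => ->.
by rewrite /torus_part [X in _ + X]big1 ?addr0 // => k _; rewrite (ip0l ip_sp) scale0r.
Qed.

Lemma shearK : cancel shear unshear.
Proof.
move=> x; rewrite /shear /unshear torus_partD torus_part_idem addr0.
by rewrite addrK.
Qed.
Lemma unshearK : cancel unshear shear.
Proof.
move=> x; rewrite /shear /unshear torus_partD torus_partN torus_part_idem.
by rewrite oppr0 addr0 subrK.
Qed.

Lemma coshearE x y : ip (coshear x) y = ip x (shear y).
Proof.
rewrite !ipE; congr (_ + _); apply: eq_bigr => k _.
by rewrite !ipE mulrC (ip_sym ip_sp y).
Qed.

Lemma sheared_ip_sp : scalar_product sheared_ip.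
Proof.
split=> [a x y w|x y|x x0]; first by rewrite /sheared_ip shear_linear !ipE.
  exact: (ip_sym ip_sp).
case: (ip_sp) => _ _; apply; apply: contra x0 => /eqP sx.
by rewrite -(shearK x) sx /unshear /torus_part big1 ?subr0 // => k _; rewrite (ip0l ip_sp) scale0r.
Qed.

(** The bracket transported by [shear] has only corrections linear in lambda. Quadratic ones contain
    either [z_k, z_l] = 0 or ip([u, z_k], j_l) = ip(u, [z_k, j_l]) = 0. *)
Lemma ip_br_sheared x y w :
  ip (shear (br (unshear x) (unshear y))) w = ip (br x y) w +
   \sum_k (ip (br x y) (j k) * ip (z k) w - ip x (j k) * ip (br (z k) y) w
           - ip y (j k) * ip (br x (z k)) w).
Proof.
have brP u k : torus_part (br u (z k)) = 0.
  rewrite /torus_part big1 // => l _.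
  by rewrite (ip_br mla) br_zj (ip0r ip_sp) scale0r.
have brP' u k : torus_part (br (z k) u) = 0.
  by rewrite (brC mla) torus_partN brP oppr0.
have tS (F : I -> V) : torus_part (\sum_k F k) = \sum_k torus_part (F k).
  apply: (big_morph torus_part) => //.
  by rewrite /torus_part big1 // => k _; rewrite (ip0l ip_sp) scale0r.
have tZ a u : torus_part (a *: u) = a *: torus_part u.
  have := torus_part_linear a u 0; rewrite !addr0 => ->.
  by rewrite [X in _ + X]big1 ?addr0 // => k _; rewrite (ip0l ip_sp) scale0r.
have -> : br (unshear x) (unshear y) = br x y -
    \sum_k (ip x (j k) *: br (z k) y) - \sum_k (ip y (j k) *: br x (z k)).
  rewrite /unshear /torus_part !brE [X in _ - (_ - X)]big1; last first.
    move=> k _; rewrite !brE big1 ?scaler0 // => l _.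
    by rewrite brE br_zz scaler0.
  rewrite subr0 addrAC; congr (_ - _ - _); apply: eq_bigr => k _; by rewrite brE.
have tz (F : I -> V) : (forall k, torus_part (F k) = 0) ->
    torus_part (\sum_k F k) = 0.
  by move=> F0; rewrite tS big1.
rewrite /shear !torus_partD !torus_partN.
rewrite (tz (fun k => ip x (j k) *: br (z k) y)) => [|k]; last by rewrite tZ brP' scaler0.
rewrite (tz (fun k => ip y (j k) *: br x (z k))) => [|k]; last by rewrite tZ brP scaler0.
rewrite !subr0.
rewrite /torus_part !ipE !sumrB.
under eq_bigr do rewrite ipE.
under [X in _ - X + _]eq_bigr do rewrite ipE.
under [X in _ + X = _]eq_bigr do rewrite ipE.
ring.
Qed.

(* The covariant derivative of x in the direction of y, transported by shear. *)
Definition nabla x y : V := (- 2^-1) *: (br (coshear x) y +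
  \sum_k (ip (br (j k) x) y *: z k + ip (z k) y *: br (j k) x
          + (2 * ip (j k) y) *: br (z k) x)).

(** The triple product ip([a, b], c) is alternating; once all of them are brought to a common order,
    the two sides agree separately for each k. *)
Lemma nabla_koszul x y w :
  (ip (shear (br (unshear y) (unshear x))) w
   - ip (shear (br (unshear x) (unshear w))) y
   + ip (shear (br (unshear w) (unshear y))) x) / 2 = ip (nabla x y) w.
Proof.
have last2 a b c : ip (br a b) c = - ip (br a c) b.
  by rewrite (ip_br_skew mla) (ip_sym ip_sp).
have cyc a b c : ip (br a b) c = ip (br c a) b by rewrite -(ip_br_cycle mla).
rewrite !ip_br_sheared /nabla /coshear !brE !ipE.
rewrite (cyc w y x) (last2 x w y) (ip_br_swap mla y x w).
set S1 := \sum_k _; set S2 := \sum_k _; set S3 := \sum_k _.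
set T1 := \sum_k _; set T2 := \sum_k _.
suff: S1 - S2 + S3 = - (T1 + T2) by lra.
rewrite -sumrB -!big_split -sumrN /=; apply: eq_bigr => k _.
rewrite !brE !ipE.
rewrite (cyc y x) (last2 _ y x) (ip_br_swap mla y) (cyc x w) (last2 _ w y).
rewrite (ip_br_swap mla x (z k)) (cyc w y) (last2 _ w y) (last2 _ y x).
rewrite (ip_br_swap mla w) (last2 _ w x) !(ip_sym ip_sp (j k)) !(ip_sym ip_sp (z k)).
ring.
Qed.

(** [shear] is an isometry from [sheared_ip] to [ip], so the Koszul formula can be evaluated for
    [ip] and the transported bracket. Since [nabla x y] differentiates [x] along [y], the arguments
    are swapped. *)
Lemma levi_civita_sheared x y :
  levi_civita br sheared_ip y x = unshear (nabla (shear x) (shear y)).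
Proof.
apply: (riesz_uniq sheared_ip_sp) => w.
rewrite (levi_civitaE sheared_ip_sp) => [|a u v s|u v]; last 2 first.
- exact: (br_linear_l mla).
- exact: (brC mla).
have := nabla_koszul (shear x) (shear y) (shear w).
by rewrite !shearK /koszul /sheared_ip unshearK.
Qed.

Local Notation r1 := (rank1_mx ip).
Local Notation ad := (fun x => endo_mx (br x)).
Local Notation G := (gram ip).
Local Notation K := (killing_mx br ip).
Local Notation kil := (killing br).

Definition ric_part (y : V) : V := 2^-1 *: \sum_k
  (br (z k + j k) (br (z k + j k) y) - br (z k) (br (z k) y)).

(** ad(j_k) and ad(z_k) commute. This expanded form is the one that the curvature traces produce;
    the difference of squares is the one to which automorphisms moving w_k and fixing z_k apply. *)
Lemma ric_partE y :
  ric_part y = \sum_k (2^-1 *: br (j k) (br (j k) y) + br (j k) (br (z k) y)).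
Proof.
rewrite /ric_part scaler_sumr; apply: eq_bigr => k _.
have e : br (z k) (br (j k) y) = br (j k) (br (z k) y).
  by rewrite (br_jacobi mla) br_zj (br0l mla) add0r.
rewrite !brE e; move: (br (z k) (br (z k) y)) => d.
rewrite -[d + _ + _]addrA [d + _]addrC addrK addrA -mulr2n addrC.
by rewrite scalerDr -scaler_nat scalerA mulVf ?scale1r ?pnatr_eq0.
Qed.

Definition nabla_rest x := \sum_k (r1 (z k) (br (j k) x) + r1 (br (j k) x) (z k)
  + 2 *: r1 (br (z k) x) (j k)).

Lemma nabla_mx x : endo_mx (nabla x) = (- 2^-1) *: (ad (coshear x) + nabla_rest x).
Proof.
rewrite endo_mxZ endo_mxD; congr (_ *: (_ + _)).
rewrite endo_mx_sum; apply: eq_bigr => k _; rewrite !endo_mxD -endo_mxZ.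
by congr (_ + _ + _); apply: eq_endo_mx => v; rewrite scalerA.
Qed.

Let ip_z_adj k l x : ip (z k) (br (j l) x) = 0.
Proof. by rewrite -(ip_br mla) br_zj (ip0l ip_sp). Qed.
Let ip_adj_z k l x : ip (br (j l) x) (z k) = 0.
Proof. by rewrite (ip_sym ip_sp) ip_z_adj. Qed.
Let ip_z_adz k l x : ip (z k) (br (z l) x) = 0.
Proof. by rewrite -(ip_br mla) br_zz (ip0l ip_sp). Qed.
Let ip_j_adz k l x : ip (j k) (br (z l) x) = 0.
Proof. by rewrite -(ip_br mla) br_jz (ip0l ip_sp). Qed.

Lemma nabla_linear x : linear (nabla x).
Proof.
move=> a u v; rewrite /nabla (br_linear mla (coshear x)).
rewrite scalerA mulrC -scalerA -scalerDr; congr (_ *: _).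
rewrite scalerDr addrACA; congr (_ + _).
rewrite scaler_sumr -big_split /=; apply: eq_bigr => k _.
rewrite !(ipDr ip_sp, ipZr ip_sp) !scalerDr !scalerA mulrDr [2 * (a * _)]mulrCA.
by rewrite !scalerDl (addrACA (_ *: z k)) (addrACA (_ + _)).
Qed.

Lemma tr_ad_rest u x : \tr (ad u *m nabla_rest x) =
   - 2 * \sum_k ip u (br (j k) (br (z k) x)).
Proof.
rewrite mulmx_sumr linear_sum mulr_sumr; apply: eq_bigr => k _ /=.
rewrite !mulmxDr -!scalemxAr !(endo_rank1 _ _ _ (br_linear mla u)).
rewrite !linearD linearZ /= !trace_rank1 //.
rewrite -(ip_br mla (z k)) -(ip_br mla (j k)).
rewrite (ip_sym ip_sp _ (br u (z k))) (ip_br_swap mla (z k)).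
by rewrite subrr add0r (ip_br_swap mla (j k)) (ip_br mla) mulrN mulNr.
Qed.

(** Only products of [r1 (z k) _] with [r1 _ (z l)], in either order, survive: h is orthogonal to
    the j_k and to the images of ad(z_l) and ad(j_l), and j_k is orthogonal to the image of
    ad(z_l). *)
Lemma tr_rest_rest x y : \tr (nabla_rest x *m nabla_rest y) =
   - 2 * \sum_k ip x (br (j k) (br (j k) y)).
Proof.
have trkl k l : \tr ((r1 (z k) (br (j k) x) + r1 (br (j k) x) (z k) +
      2 *: r1 (br (z k) x) (j k)) *m (r1 (z l) (br (j l) y) +
      r1 (br (j l) y) (z l) + 2 *: r1 (br (z l) y) (j l))) =
    - 2 * (k == l)%:R * ip x (br (j k) (br (j l) y)).
  rewrite !(mulmxDr, mulmxDl) -!scalemxAr -!scalemxAl !rank1_rank1 //.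
  rewrite !(linearD, linearZ) /= !trace_rank1 //.
  rewrite !(ip_adj_z, ip_z_adj, ip_z_adz, ip_j_adz, ip_jz) !z_on.
  rewrite (eq_sym l) (ip_sym ip_sp (br (j l) y)) (ip_br_skew mla).
  by ring.
rewrite mulmx_suml linear_sum mulr_sumr; apply: eq_bigr => k _ /=.
rewrite mulmx_sumr linear_sum /= (bigD1 k) //= big1 ?addr0 => [|l lk].
  by rewrite trkl eqxx mulr1.
by rewrite trkl eq_sym (negPf lk) mulr0 mul0r.
Qed.

(** The product of two commuting skew operators is symmetric. *)
Lemma ad_jz_sym k x y : ip x (br (j k) (br (z k) y)) = ip y (br (j k) (br (z k) x)).
Proof.
have e v : br (z k) (br (j k) v) = br (j k) (br (z k) v).
  by rewrite (br_jacobi mla) br_zj (br0l mla) add0r.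
rewrite (ip_sym ip_sp) (ip_br_skew mla) (ip_br_skew mla (z k)) opprK.
by rewrite e.
Qed.

Lemma coshear_adjz k x y : ip (coshear x) (br (j k) (br (z k) y)) = ip x (br (j k) (br (z k) y)).
Proof.
rewrite /coshear !ipE big1 ?addr0 // => l _.
by rewrite ipE -(ad_jz_sym k) br_zj (br0r mla) (ip0r ip_sp) mulr0.
Qed.

(** Both factors of the trace formula for Ric become maps [nabla], each with the prefactor -1/2.
    Their ad parts give the Killing term with coefficient -1/4; the two mixed traces contribute the
    products ad(j_k) ad(z_k), and the trace of the two rank one parts contributes 1/2 ad(j_k)^2. *)
Lemma sheared_ricci x y : ricci br sheared_ip x y =
  - 4^-1 * killing br (coshear (shear x)) (coshear (shear y))
  + ip (shear x) (ric_part (shear y)).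
Proof.
have D_E u v : levi_civita br sheared_ip u v = unshear (nabla (shear v) (shear u)).
  exact: levi_civita_sheared.
rewrite (ricci_unimodular sheared_ip_sp); last 3 first.
- exact: br_linear_l mla.
- exact: brC mla.
- exact: br_unimodular mla.
set u := shear x; set v := shear y.
pose f w := nabla v (nabla u (shear w)).
have lf : linear f.
  move=> a w w'; rewrite /f shear_linear /=.
  by rewrite (nabla_linear u) (nabla_linear v).
rewrite endo_traceE (eq_endo_mx (g := fun w => unshear (f w))); last first.
  by move=> w; rewrite D_E D_E unshearK.
(* Moving [unshear] round the trace lets it cancel the innermost [shear]. *)
rewrite -endo_traceE (endo_trace_comm unshear_linear lf) endo_traceE.
rewrite (eq_endo_mx (g := fun w => nabla v (nabla u w))); last first.
  by move=> w; rewrite /f unshearK.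
rewrite endo_mx_comp; last exact: nabla_linear.
rewrite !nabla_mx -scalemxAl -scalemxAr !linearZ /= !(mulmxDl, mulmxDr) !linearD /=.
rewrite [\tr (nabla_rest v *m ad _)]mxtrace_mulC !tr_ad_rest tr_rest_rest.
rewrite -(killingE mla) (killing_sym mla).
have cross a b : \sum_k ip (coshear a) (br (j k) (br (z k) b)) =
    \sum_k ip a (br (j k) (br (z k) b)).
  by apply: eq_bigr => k _; exact: coshear_adjz.
have -> : \sum_k ip (coshear v) (br (j k) (br (z k) u)) =
    \sum_k ip u (br (j k) (br (z k) v)).
  by rewrite cross; apply: eq_bigr => k _; rewrite ad_jz_sym.
have -> : \sum_k ip v (br (j k) (br (j k) u)) = \sum_k ip u (br (j k) (br (j k) v)).
  apply: eq_bigr => k _; rewrite (ip_sym ip_sp) !(ip_br_skew mla (j k)).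
  by rewrite opprK.
rewrite cross ric_partE ip_sumr //.
under [in RHS]eq_bigr do rewrite (ipDr ip_sp) (ipZr ip_sp).
by rewrite big_split /= -mulr_sumr; field.
Qed.

Local Notation P := (endo_mx shear).
Local Notation Theta := (endo_mx coshear).
Local Notation T := ric_part.
Let w k := z k + j k.

Let Gu : G \in unitmx. Proof. exact: gram_unit. Qed.
Let lshear : linear shear. Proof. exact: shear_linear. Qed.
Let lcoshear : linear coshear. Proof. exact: coshear_linear. Qed.

Lemma ric_part_linear : linear T.
Proof.
move=> a x y; rewrite /ric_part scalerA mulrC -scalerA -scalerDr; congr (_ *: _).
rewrite scaler_sumr -big_split; apply: eq_bigr => k _ /=.
rewrite !(br_linear mla (w k), br_linear mla (z k)) scalerBr.
by rewrite opprD addrACA.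
Qed.

Lemma ric_part_mx : endo_mx T = 2^-1 *: \sum_k (ad (w k) *m ad (w k) - ad (z k) *m ad (z k)).
Proof.
rewrite endo_mxZ endo_mx_sum; congr (_ *: _); apply: eq_bigr => k _.
rewrite endo_mxD endo_mxN (endo_mx_comp (br (w k)) (br_linear mla (w k))).
by rewrite (endo_mx_comp (br (z k)) (br_linear mla (z k))).
Qed.

Lemma ric_part_sym x y : ip x (T y) = ip (T x) y.
Proof.
have e u : ip (br u (br u x)) y = ip x (br u (br u y)).
  by rewrite !(ip_br_skew mla) opprK.
rewrite /ric_part (ipZr ip_sp) (ipZl ip_sp) (ip_sumr ip_sp) (ip_suml ip_sp).
congr (_ * _); apply: eq_bigr => k _.
by rewrite (ipDr ip_sp) (ipNr ip_sp) (ipDl ip_sp) (ipNl ip_sp) !e.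
Qed.

Lemma ric_part_z k : T (z k) = 0.
Proof.
rewrite /ric_part big1 ?scaler0 // => l _.
have e : br (z l + j l) (z k) = 0 by rewrite (brDl mla) br_zz br_jz addr0.
by rewrite e br_zz !(br0r mla) subrr.
Qed.

Lemma shear_unit : P \in unitmx.
Proof.
suff /mulmx1_unit[] : P *m endo_mx unshear = 1%:M by [].
rewrite -endo_mx_comp // -endo_mx_id; apply: eq_endo_mx => x.
exact: unshearK.
Qed.

Lemma gram_coshear : Theta^T *m G = G *m P.
Proof.
have lid : linear (fun x : V => x) by [].
have := gram_comp (ip_l_linear ip_sp) (ip_r_linear ip_sp) lcoshear lid.
rewrite endo_mx_id mulmx1 => <-.
rewrite -gram_endo //; apply/matrixP => i k; rewrite !mxE.
exact: coshearE.
Qed.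

Lemma ricci_norm2_sheared_op :
  let S := endo_mx T + 4^-1 *: (P *m K *m Theta) in
  tensor_norm2 sheared_ip (ricci br sheared_ip) = \tr (S *m S).
Proof.
pose rho x y := - 4^-1 * kil (coshear x) (coshear y) + ip x (T y).
have rho_sym x y : rho x y = rho y x.
  by rewrite /rho (killing_sym mla) ric_part_sym (ip_sym ip_sp).
have rhol a x y v : rho (a *: x + y) v = a * rho x v + rho y v.
  rewrite /rho lcoshear (killing_linear_l mla) (ip_l_linear ip_sp); ring.
have rhor a x y v : rho v (a *: x + y) = a * rho v x + rho v y.
  by rewrite !(rho_sym v) rhol.
have rhoE : gram rho = G *m (endo_mx T + 4^-1 *: (P *m K *m Theta)).
  rewrite mulmxDr -(gram_endo ip_sp ric_part_linear) -scalemxAr !mulmxA.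
  rewrite -gram_coshear -(mulmxA _ G) gram_killing_mx // mulmxN mulNmx.
  rewrite -gram_comp //; last 2 first.
  - exact: killing_linear_l mla.
  - exact: killing_linear_r mla.
  by apply/matrixP => i k; rewrite !mxE /rho addrC mulNr mulrN.
apply: (tensor_norm2_op shear_unit Gu (gram_tr ip_sp)).
- by rewrite -rhoE; apply/matrixP => i k; rewrite !mxE.
- rewrite -gram_comp //; [exact: ip_l_linear | exact: ip_r_linear].
rewrite -rhoE -gram_comp //; apply/matrixP => i k; rewrite !mxE.
exact: sheared_ricci.
Qed.

(** Completing the square: since the z_k are orthonormal, the product is Id plus the sum of z_k
    j_k^T + j_k z_k^T + j_k j_k^T, and this summand is w_k w_k^T - z_k z_k^T. *)
Lemma coshear_shear_mx : Theta *m P = 1%:M + \sum_k (r1 (w k) (w k) - r1 (z k) (z k)).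
Proof.
rewrite -endo_mx_comp // -endo_mx_id.
under [in RHS]eq_bigr do rewrite -endo_mxN -endo_mxD.
rewrite -endo_mx_sum -endo_mxD; apply: eq_endo_mx => x.
rewrite /coshear /shear /torus_part -addrA; congr (_ + _).
rewrite -big_split /=; apply: eq_bigr => k _.
rewrite /w (ipDl ip_sp) !ipE.
rewrite (bigD1 k) //= big1 ?addr0 => [|l lk]; last by rewrite ipE z_on (negPf lk) mulr0.
rewrite ipE z_on eqxx mulr1 scalerDr !scalerDl (ip_sym ip_sp x (z k)) (ip_sym ip_sp x (j k)).
by rewrite -(addrA (ip (z k) x *: z k)) addrAC subrr add0r.
Qed.

(** [T] annihilates h, hence the image of lambda; the next lemma is the adjoint statement. *)
Lemma ric_part_shear_mx : endo_mx T *m P = endo_mx T.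
Proof.
have -> : P = 1%:M + \sum_k r1 (z k) (j k).
  rewrite -endo_mx_id -endo_mx_sum -endo_mxD; apply: eq_endo_mx => x.
  by congr (_ + _); apply: eq_bigr => k _; rewrite (ip_sym ip_sp).
rewrite mulmxDr mulmx1 mulmx_sumr big1 ?addr0 // => k _.
rewrite (endo_rank1 _ _ _ ric_part_linear) ric_part_z.
by apply/matrixP => i l; rewrite !mxE scaler0 linear0.
Qed.

Lemma coshear_ric_part_mx : Theta *m endo_mx T = endo_mx T.
Proof.
rewrite -(endo_mx_comp T lcoshear); apply: eq_endo_mx => x.
rewrite /coshear big1 ?addr0 // => k _.
by rewrite -ric_part_sym ric_part_z (ip0r ip_sp) scale0r.
Qed.

(** Everything is expressed through ad, [K] and the Killing form at the vectors w_k and z_k, so that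
    the invariance under automorphisms can be applied to each term. The factor 1/16 is the square of
    the 1/4 in front of the Killing operator. *)
Definition norm_form : R := \tr (endo_mx T *m endo_mx T) + 2^-1 * \tr (endo_mx T *m K)
  + 16^-1 * (\tr (K *m K)
   + 2 * (\sum_k (op_form ip (K *m K) (w k) (w k) - op_form ip (K *m K) (z k) (z k)))
   + \sum_k \sum_l (kil (w k) (w l) ^+ 2 - kil (w k) (z l) ^+ 2
         - kil (z k) (w l) ^+ 2 + kil (z k) (z l) ^+ 2)).

(** Under the trace, [P] and [Theta] disappear from the mixed terms, because [T] absorbs both, and
    occur in the last term only as [Theta P], which is Id plus rank one operators. *)
Lemma ricci_norm2_sheared :
  tensor_norm2 sheared_ip (ricci br sheared_ip) = norm_form.
Proof.
rewrite ricci_norm2_sheared_op /=.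
have TP := ric_part_shear_mx; have TT := coshear_ric_part_mx.
set t := endo_mx T in TP TT *.
rewrite /=; have -> : \tr ((t + 4^-1 *: (P *m K *m Theta)) *m (t + 4^-1 *: (P *m K *m Theta))) =
    \tr (t *m t) + 2^-1 * \tr (t *m K) + 16^-1 * \tr (K *m (Theta *m P) *m (K *m (Theta *m P))).
  have e1 : \tr (t *m (P *m K *m Theta)) = \tr (t *m K).
    by rewrite !mulmxA TP mxtrace_mulC mulmxA TT.
  have e2 : \tr (P *m K *m Theta *m t) = \tr (t *m K) by rewrite mxtrace_mulC.
  have e3 : \tr (P *m K *m Theta *m (P *m K *m Theta)) =
      \tr (K *m (Theta *m P) *m (K *m (Theta *m P))).
    by rewrite -!mulmxA mxtrace_mulC !mulmxA.
  rewrite !(mulmxDl, mulmxDr) -!scalemxAl -!scalemxAr !mxtraceD !mxtraceZ.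
  by rewrite e1 e2 e3; field.
rewrite /norm_form coshear_shear_mx; congr (_ + _ * _).
set W := \sum_k (r1 (w k) (w k) - _).
have -> : \tr (K *m (1%:M + W) *m (K *m (1%:M + W))) =
    \tr (K *m K) + 2 * \tr (K *m K *m W) + \tr (K *m W *m (K *m W)).
  rewrite !mulmxDr mulmx1 !mulmxDl !mxtraceD (mxtrace_mulC (K *m W) K) !mulmxA.
  by ring.
congr (_ + _ * _ + _).
  rewrite mulmx_sumr linear_sum; apply: eq_bigr => k _ /=.
  by rewrite mulmxBr linearB /= !(trace_mul_rank1 mla).
rewrite mulmx_sumr mulmx_suml linear_sum; apply: eq_bigr => k _ /=.
rewrite mulmx_sumr linear_sum; apply: eq_bigr => l _ /=.
have trB (A B : 'M[R]_(\dim {:V})) : \tr (A - B) = \tr A - \tr B by rewrite raddfB.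
rewrite !mulmxBr !mulmxBl !trB !(trace_mul_rank1_rank1 mla).
rewrite !(op_form_killing mla).
rewrite (killing_sym mla (w l) (w k)) (killing_sym mla (z l) (w k)).
rewrite (killing_sym mla (w l) (z k)) (killing_sym mla (z l) (z k)).

ring.
Qed.

End Deformation.

(** * Dependence of the norm on the family *)

Definition isometric_automorphism (R : realType) (V : vectType R)
    (br : V -> V -> V) (ip : V -> V -> R) (f : V -> V) : Prop :=
  [/\ linear f, forall x y, f (br x y) = br (f x) (f y)
    & forall x y, ip (f x) (f y) = ip x y].

Section AutomorphismInvariance.
Variables (R : realType) (V : vectType R) (br : V -> V -> V) (ip : V -> V -> R).
Hypothesis mla : metric_lie_algebra br ip.
Let ip_sp : scalar_product ip. Proof. by case: mla. Qed.
Variable f : V -> V.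
Hypothesis f_aut : isometric_automorphism br ip f.
Local Notation G := (gram ip).
Local Notation K := (killing_mx br ip).
Local Notation M := (endo_mx f).
Local Notation ad := (fun x => endo_mx (br x)).
Let lf : linear f. Proof. by case: f_aut. Qed.

Lemma gram_aut : M^T *m G *m M = G.
Proof.
rewrite -(gram_comp (ip_l_linear ip_sp) (ip_r_linear ip_sp) lf lf).
by apply/matrixP => i k; rewrite !mxE; case: f_aut => _ _ ->.
Qed.

Lemma aut_unit : M \in unitmx.
Proof.
have Gu : G \in unitmx by exact: gram_unit.
suff /mulmx1_unit[] : invmx G *m M^T *m G *m M = 1%:M by [].
by rewrite -!mulmxA [M^T *m _]mulmxA gram_aut mulVmx.
Qed.

Lemma ad_aut x : ad (f x) *m M = M *m ad x.
Proof.
rewrite -(endo_mx_comp f (br_linear mla (f x))) -(endo_mx_comp (br x) lf).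
by apply: eq_endo_mx => y; case: f_aut => _ -> _.
Qed.

Lemma mxtrace_intertwined (X Y : 'M[R]_(\dim {:V})) : X *m M = M *m Y -> \tr X = \tr Y.
Proof.
move=> XY; rewrite -(mulmxK aut_unit X) XY mxtrace_mulC mulmxA.
by rewrite mulVmx ?mul1mx // aut_unit.
Qed.

Lemma intertwined_mul (X X' Y Y' : 'M[R]_(\dim {:V})) :
  X *m M = M *m Y -> X' *m M = M *m Y' -> X *m X' *m M = M *m (Y *m Y').
Proof. by move=> XY XY'; rewrite -mulmxA XY' mulmxA XY mulmxA. Qed.

Lemma killing_aut x y : killing br (f x) (f y) = killing br x y.
Proof.
by rewrite !(killingE mla); apply: mxtrace_intertwined; apply: intertwined_mul; exact: ad_aut.
Qed.

(** [K] is determined by [ip] and the Killing form, both of which an isometric automorphism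
    preserves. *)
Lemma killing_mx_aut : K *m M = M *m K.
Proof.
have Gu : G \in unitmx by exact: gram_unit.
have kE : M^T *m gram (killing br) *m M = gram (killing br).
  rewrite -gram_comp //; last 2 first.
  - exact: killing_linear_l mla.
  - exact: killing_linear_r mla.
  by apply/matrixP => i k; rewrite !mxE killing_aut.
apply: (can_inj (mulKmx Gu)).
apply: (can_inj (mulKmx (_ : M^T \in unitmx))); first by rewrite unitmx_tr aut_unit.
rewrite [G *m (M *m K)]mulmxA [RHS]mulmxA [M^T *m (G *m M)]mulmxA gram_aut.
by rewrite [G *m (K *m M)]mulmxA !(gram_killing_mx mla) mulNmx mulmxN mulmxA kE.
Qed.

Lemma op_form_aut (X : 'M[R]_(\dim {:V})) x y : X *m M = M *m X ->
  op_form ip X (f x) (f y) = op_form ip X x y.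
Proof.
move=> XM; rewrite /op_form !coords_endo // trmx_mul.
have -> : (coords x)^T *m M^T *m (G *m X) *m (M *m coords y) =
   (coords x)^T *m (M^T *m G *m (X *m M)) *m coords y by rewrite !mulmxA.
by rewrite XM [M^T *m G *m _]mulmxA gram_aut.
Qed.

End AutomorphismInvariance.

Lemma comm_ad_mx (R : realType) (V : vectType R) (br : V -> V -> V) (ip : V -> V -> R)
    (mla : metric_lie_algebra br ip) x y :
  comm_br (endo_mx (br x)) (endo_mx (br y)) = endo_mx (br (br x y)).
Proof.
rewrite /comm_br -(endo_mx_comp (br y) (br_linear mla x)).
rewrite -(endo_mx_comp (br x) (br_linear mla y)) -endo_mxN -endo_mxD.
by apply: eq_endo_mx => v; rewrite (br_jacobi mla x) addrK.
Qed.

Section Variation.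
Variables (R : realType) (V : vectType R) (br : V -> V -> V) (ip : V -> V -> R).
Hypothesis mla : metric_lie_algebra br ip.
Variables (I : finType) (z j j' : I -> V).
Hypothesis br_zz : forall k l, br (z k) (z l) = 0.
Hypothesis br_jz : forall k l, br (j k) (z l) = 0.
Hypothesis br_jz' : forall k l, br (j' k) (z l) = 0.
Hypothesis pencil_aut : forall k l (a : R), exists f,
  [/\ isometric_automorphism br ip f, forall i, f (z i) = z i
    & f (j k + a *: j l) = j' k + a *: j' l].
Local Notation kil := (killing br).
Local Notation ad := (fun x => endo_mx (br x)).
Let w k := z k + j k.
Let w' k := z k + j' k.
Let K := killing_mx br ip.
Let t4 (A : 'M[R]_(\dim {:V})) := \tr (A *m A *m (A *m A)).

Let pencil k l a : exists f,
  [/\ isometric_automorphism br ip f, forall i, f (z i) = z i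
    & f (w k + a *: w l) = w' k + a *: w' l].
Proof.
have [f [fa fz fj]] := pencil_aut k l a; exists f; split=> //.
have fD x y : f (x + y) = f x + f y.
  by case: fa => lf _ _; have := lf 1 x y; rewrite !scale1r.
have fZ x : f (a *: x) = a *: f x.
  by case: fa => lf _ _; have := lf a x 0; rewrite !addr0 (_ : f 0 = 0) ?addr0 //;
     apply: (addrI (f 0)); rewrite -fD !addr0.
rewrite /w /w' !scalerDr addrACA fD fj fD fZ !fz.
by rewrite addrACA.
Qed.

Let single k : exists f,
  [/\ isometric_automorphism br ip f, forall i, f (z i) = z i & f (w k) = w' k].
Proof.
have [f [fa fz fw]] := pencil k k 0; exists f; split=> //.
by move: fw; rewrite !scale0r !addr0.
Qed.

(** Polarization: the quadratic form is preserved at w_k, at w_l and, by yet another automorphism,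
    at w_k + w_l. *)
Lemma killing_torus_part k l : kil (w' k) (w' l) = kil (w k) (w l).
Proof.
have kk i : kil (w' i) (w' i) = kil (w i) (w i).
  by have [f [fa fz <-]] := single i; rewrite (killing_aut mla fa).
have [f [fa fz fw]] := pencil k l 1.
have := killing_aut mla fa (w k + 1 *: w l) (w k + 1 *: w l).
have kD x y v : kil (x + y) v = kil x v + kil y v.
  by have := killing_linear_l mla 1 x y v; rewrite scale1r mul1r.
have sq x y : kil (x + y) (x + y) = kil x x + 2 * kil x y + kil y y.
  by rewrite kD !(killing_sym mla _ (x + y)) !kD (killing_sym mla y x); ring.
rewrite fw !scale1r (sq (w k)) (sq (w' k)) !kk; lra.
Qed.

(** The quartic traces of ad(w_k), ad(w_l) and ad(w_k) +- ad(w_l) are all invariant, so in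
    [mxtrace_sq_sq] only the commutator term varies; its coefficient is -2/12. *)
Lemma ad_quartic_variation k l :
  \tr (ad (w' k) *m ad (w' k) *m (ad (w' l) *m ad (w' l)))
  - \tr (ad (w k) *m ad (w k) *m (ad (w l) *m ad (w l))) =
  - 6^-1 * (kil (br (j' k) (j' l)) (br (j' k) (j' l))
           - kil (br (j k) (j l)) (br (j k) (j l))).
Proof.
have adl := ad_mx_linear mla.
have t4_aut f x : isometric_automorphism br ip f -> t4 (ad (f x)) = t4 (ad x).
  move=> fa; apply: (mxtrace_intertwined mla fa).
  by do !(apply: intertwined_mul => //); exact: (ad_aut mla fa).
have t4w a : t4 (ad (w' k) + a *: ad (w' l)) = t4 (ad (w k) + a *: ad (w l)).
  have [f [fa fz fw]] := pencil k l a.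
  by rewrite ![_ + a *: _]addrC -!adl ![a *: _ + _]addrC -fw t4_aut.
have t4k i : t4 (ad (w' i)) = t4 (ad (w i)).
  by have [f [fa fz <-]] := single i; exact: t4_aut.
have c_w jj : (forall a b, br (jj a) (z b) = 0) ->
    br (z k + jj k) (z l + jj l) = br (jj k) (jj l).
  move=> jz; rewrite (brDl mla) !(brDr mla) br_zz jz (brC mla (z k)) jz.
  by rewrite oppr0 !add0r.
have := mxtrace_sq_sq (ad (w k)) (ad (w l)).
have := mxtrace_sq_sq (ad (w' k)) (ad (w' l)).
rewrite /= -!/(t4 _) !(comm_ad_mx mla) -!(killingE mla) !c_w //.
have := t4w 1; rewrite !scale1r => ->; have := t4w (-1); rewrite !scaleN1r => ->.
rewrite !t4k; lra.
Qed.

(** A term in which a single w_k meets only [K] or the z_l is invariant under an automorphism that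
    moves w_k and fixes h; the Killing products of two w's are polarized. There remains tr
    (ad(w_k)^2 ad(w_l)^2), which enters tr (T^2) with coefficient 1/4, and 1/4 times -1/6 is
    -1/24. *)
Lemma norm_form_variation :
  norm_form br ip z j' - norm_form br ip z j =
  - 24^-1 * \sum_k \sum_l (kil (br (j' k) (j' l)) (br (j' k) (j' l))
           - kil (br (j k) (j l)) (br (j k) (j l))).
Proof.
pose D jj k := ad (z k + jj k) *m ad (z k + jj k) - ad (z k) *m ad (z k).
have trTT jj : \tr (endo_mx (ric_part br z jj) *m endo_mx (ric_part br z jj)) =
    4^-1 * \sum_k \sum_l \tr (D jj k *m D jj l).
  rewrite (ric_part_mx mla) -scalemxAl -scalemxAr !mxtraceZ mulrA -invfM -natrM.
  congr (_ * _); rewrite mulmx_suml linear_sum; apply: eq_bigr => k _ /=.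
  by rewrite mulmx_sumr linear_sum.
have trTK jj : \tr (endo_mx (ric_part br z jj) *m K) = 2^-1 * \sum_k \tr (D jj k *m K).
  rewrite (ric_part_mx mla) -scalemxAl mxtraceZ mulmx_suml linear_sum.
  by congr (_ * _).
have Ka f : isometric_automorphism br ip f -> K *m endo_mx f = endo_mx f *m K.
  exact: killing_mx_aut.
have DK k : \tr (D j' k *m K) = \tr (D j k *m K).
  have [f [fa fz fw]] := single k; apply: (mxtrace_intertwined mla fa).
  apply: intertwined_mul; last exact: Ka.
  rewrite /D -/(w' k) -/(w k) -fw -{1 2}fz mulmxBl mulmxBr.
  by congr (_ - _); apply: intertwined_mul; exact: (ad_aut mla fa).
have DB k (C : 'M_(\dim {:V})) : (forall f, isometric_automorphism br ip f ->
     (forall i, f (z i) = z i) -> C *m endo_mx f = endo_mx f *m C) ->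
   \tr (ad (w' k) *m ad (w' k) *m C) = \tr (ad (w k) *m ad (w k) *m C).
  move=> Cf; have [f [fa fz <-]] := single k; apply: (mxtrace_intertwined mla fa).
  apply: intertwined_mul; last exact: Cf.
  by apply: intertwined_mul; exact: (ad_aut mla fa).
have BBf k f : isometric_automorphism br ip f -> (forall i, f (z i) = z i) ->
    ad (z k) *m ad (z k) *m endo_mx f = endo_mx f *m (ad (z k) *m ad (z k)).
  move=> fa fz; apply: intertwined_mul; have := ad_aut mla fa (z k); by rewrite fz.
have DD k l : \tr (D j' k *m D j' l) - \tr (D j k *m D j l) =
   - 6^-1 * (kil (br (j' k) (j' l)) (br (j' k) (j' l)) - kil (br (j k) (j l)) (br (j k) (j l))).
  rewrite -ad_quartic_variation /D -/(w' k) -/(w k) -/(w' l) -/(w l).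
  have trB (A B : 'M[R]_(\dim {:V})) : \tr (A - B) = \tr A - \tr B by rewrite raddfB.
  rewrite !(mulmxBl, mulmxBr) !trB.
  rewrite (DB k _ (BBf l)) (mxtrace_mulC (ad (z k) *m _)) (DB l _ (BBf k)).
  rewrite (mxtrace_mulC (ad (z k) *m _ ) (ad (w l) *m _)); ring.
have kz k l : kil (w' k) (z l) = kil (w k) (z l).
  have [f [fa fz <-]] := single k; by rewrite -[in LHS](fz l) (killing_aut mla fa).
have k2 k : op_form ip (K *m K) (w' k) (w' k) = op_form ip (K *m K) (w k) (w k).
  have [f [fa fz <-]] := single k; apply: (op_form_aut mla fa).
  by apply: intertwined_mul; exact: Ka.
have -> : norm_form br ip z j' = 4^-1 * \sum_k \sum_l \tr (D j' k *m D j' l) +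
    (norm_form br ip z j - 4^-1 * \sum_k \sum_l \tr (D j k *m D j l)).
  rewrite /norm_form !trTT !trTK -!(addrA (4^-1 * _)) [X in _ = _ + X]addrC subrK.
  congr (_ + _).
  congr (_ * (_ * _) + _ * (_ + _ * _ + _)).
  - by apply: eq_bigr => k _; exact: DK.
  - by apply: eq_bigr => k _; rewrite -/(w' k) k2.
  apply: eq_bigr => k _; apply: eq_bigr => l _.
  by rewrite -/(w' k) -/(w' l) killing_torus_part kz !(killing_sym mla (z k)) kz.
set S' := \sum_k \sum_l \tr (D j' k *m _).
set S := \sum_k \sum_l \tr (D j k *m _).
transitivity (4^-1 * (S' - S)); first by ring.
rewrite -sumrB mulr_sumr [RHS]mulr_sumr.
apply: eq_bigr => k _; rewrite -sumrB !mulr_sumr; apply: eq_bigr => l _.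
by rewrite DD; field.
Qed.

End Variation.

(** * Passage to the metrics g_lambda(t) *)

Section FamilyNorm.
Variables (R : realType) (F : metric_family R) (Z1 Z2 : torus_alg F).
Local Notation br := (@bracket R F).
Local Notation g0 := (@base_metric R F).
Local Notation incl := (@torus_incl R F).
Local Notation jm := (@j_map R F).
Hypothesis mla : metric_lie_algebra br g0.
Hypothesis incl_linear : linear incl.
Hypothesis Z_on : orthonormal_basis (@torus_metric R F) [:: Z1; Z2].
Let g0_sp : scalar_product g0. Proof. by case: mla. Qed.
Let e (k : 'I_2) : torus_alg F := [:: Z1; Z2]`_k.
Let z k := incl (e k).

Let e_span Z : exists c : 'I_2 -> R, Z = \sum_k c k *: e k.
Proof.
case: Z_on => Zb _; exists (fun k => coord [tuple Z1; Z2] k Z).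
exact: (coord_basis (X := [tuple Z1; Z2]) Zb (memvf Z)).
Qed.

Let z_on k l : g0 (z k) (z l) = (k == l)%:R.
Proof. by case: Z_on => _ /(_ k l (ltn_ord k) (ltn_ord l)). Qed.

Let inclZ a x : incl (a *: x) = a *: incl x.
Proof.
have incl0 := linear_fun0 incl_linear.
by have := incl_linear a x 0; rewrite incl0 !addr0.
Qed.

Let incl_comb (c : 'I_2 -> R) : incl (\sum_k c k *: e k) = \sum_k c k *: z k.
Proof.
elim/big_rec2: _ => [|k x y _ <-]; last by rewrite incl_linear.
by have := inclZ 0 0; rewrite !scale0r.
Qed.

Let ip_comb (c : 'I_2 -> R) k : g0 (\sum_l c l *: z l) (z k) = c k.
Proof.
rewrite (ip_suml g0_sp) (bigD1 k) //= big1 ?addr0 => [|l lk].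
  by rewrite (ipZl g0_sp) z_on eqxx mulr1.
by rewrite (ipZl g0_sp) z_on (negPf lk) mulr0.
Qed.

Let torus_sp : scalar_product (@torus_metric R F).
Proof.
split=> [a x y v|x y|x]; rewrite /torus_metric.
- by rewrite incl_linear (ip_l_linear g0_sp).
- exact: (ip_sym g0_sp).
have [c ->] := e_span x => xN0; case: g0_sp => _ _; apply.
apply: contra xN0 => /eqP; rewrite incl_comb => cz.
by rewrite big1 // => k _; rewrite -(ip_comb c) cz (ip0l g0_sp) scale0r.
Qed.

Section Norm.
Variable t : R.
Hypothesis j_linear : linear (jm t).
Let j k := jm t (e k).

Lemma incl_lambda x : incl (lambda t x) = torus_part g0 z j x.
Proof.
have lE k : g0 (incl (lambda t x)) (z k) = g0 x (j k).
  rewrite /z -/(torus_metric _ _) /lambda (rieszE torus_sp) // => a u v.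
  by rewrite j_linear (ip_r_linear g0_sp).
have [c lc] := e_span (lambda t x).
rewrite lc incl_comb; apply: eq_bigr => k _.
by rewrite -lE lc incl_comb ip_comb.
Qed.

Lemma ricci_norm2_sheared_ip : ricci_norm2 F t =
  tensor_norm2 (sheared_ip g0 z j) (ricci br (sheared_ip g0 z j)).
Proof.
rewrite /ricci_norm2 /ricci_lambda.
suff -> : lambda_metric t = sheared_ip g0 z j by [].
apply/funext => x; apply/funext => y.
by rewrite /lambda_metric /sheared_ip /shear !incl_lambda.
Qed.

End Norm.

Variables s t : R.
Hypothesis js_linear : linear (jm s).
Hypothesis jt_linear : linear (jm t).
Hypothesis incl_abelian : forall Y Z, br (incl Y) (incl Z) = 0.
Hypothesis br_j_incl : forall u Y Z, br (jm u Y) (incl Z) = 0.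
Hypothesis ip_j_incl : forall u Y Z, g0 (jm u Y) (incl Z) = 0.
Hypothesis isospectral : forall Z, exists f,
  [/\ isometric_automorphism br g0 f, forall Y, f (incl Y) = incl Y
    & f (jm s Z) = jm t Z].

(** Of the four pairs of indices the two diagonal ones give [j_k, j_k] = 0 and the other two agree,
    which doubles 1/24 to 1/12. *)
Lemma ricci_norm2_variation :
  ricci_norm2 F t - ricci_norm2 F s =
  - 12^-1 * (killing br (br (jm t Z1) (jm t Z2)) (br (jm t Z1) (jm t Z2))
           - killing br (br (jm s Z1) (jm s Z2)) (br (jm s Z1) (jm s Z2))).
Proof.
rewrite !ricci_norm2_sheared_ip //.
have zz k l : br (z k) (z l) = 0 by exact: incl_abelian.
rewrite !(ricci_norm2_sheared mla z_on zz) //; try by move=> k l; rewrite /z ?br_j_incl ?ip_j_incl.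
rewrite (norm_form_variation mla zz) => [|k l|k l|k l a]; rewrite ?br_j_incl //; last first.
  have [f [fa fi fj]] := isospectral (e k + a *: e l); exists f; split=> // [i|]; first exact: fi.
  have jE u : linear (jm u) -> jm u (e k + a *: e l) = jm u (e k) + a *: jm u (e l).
    by move=> ju; rewrite addrC ju addrC.
  by rewrite /= -(jE s js_linear) -(jE t jt_linear).
rewrite !big_ord_recl !big_ord0 /= !addr0.
have k0 v : killing br 0 v = 0.
  by have := killing_linear_l mla (-1) 0 0 v; rewrite scaler0 addr0 mulN1r addNr.
have kNl x v : killing br (- x) v = - killing br x v.
  by have := killing_linear_l mla (-1) x 0 v; rewrite addr0 k0 addr0 scaleN1r mulN1r.
have kN x : killing br (- x) (- x) = killing br x x.
  by rewrite kNl (killing_sym mla) kNl opprK.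
rewrite /e /= !(brxx mla) !(brC mla (jm _ Z2)) !kN !k0 !subrr; by field.
Qed.

End FamilyNorm.

(** * The special orthogonal Lie algebras *)

Lemma comm_br_linear_l (T : comNzRingType) m (a : T) (X Y Z : 'M[T]_m) :
  comm_br (a *: X + Y) Z = a *: comm_br X Z + comm_br Y Z.
Proof.
rewrite /comm_br mulmxDl mulmxDr -scalemxAl -scalemxAr scalerBr.
by rewrite opprD addrACA.
Qed.

Lemma comm_brC (T : comNzRingType) m (X Y : 'M[T]_m) : comm_br X Y = - comm_br Y X.
Proof. by rewrite /comm_br opprB. Qed.

Lemma comm_br_jacobi (T : comNzRingType) m (X Y Z : 'M[T]_m) :
  comm_br X (comm_br Y Z) = comm_br (comm_br X Y) Z + comm_br Y (comm_br X Z).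
Proof.
rewrite /comm_br !mulmxBl !mulmxBr !mulmxA !opprB.
move: (X *m Y *m Z) (X *m Z *m Y) (Y *m Z *m X) (Z *m Y *m X) (Y *m X *m Z) (Z *m X *m Y).
move=> a b c d e f; apply/matrixP => i k; rewrite !mxE; ring.
Qed.

(** * Traces over the matrix units *)

Section ElementaryMatrices.
Variables (T : comNzRingType) (n : nat).
Implicit Types A B X : 'M[T]_n.

Lemma mul_delta_mulE A B i k a b : (A *m delta_mx i k *m B) a b = A a i * B k b.
Proof.
rewrite mxE (bigD1 k) //= big1 ?addr0 => [|l lk].
  rewrite mxE (bigD1 i) //= big1 ?addr0 ?mxE ?eqxx ?mulr1 // => l li.
  by rewrite mxE (negPf li) mulr0.
rewrite mxE big1 ?mul0r // => m _.
by rewrite mxE (negPf lk) andbF mulr0.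
Qed.

Lemma sum_mul_delta A B :
  \sum_i \sum_k (A *m delta_mx i k *m B) i k = \tr A * \tr B.
Proof.
rewrite /mxtrace mulr_suml; apply: eq_bigr => i _; rewrite mulr_sumr.
by apply: eq_bigr => k _; rewrite mul_delta_mulE.
Qed.

Lemma sum_mul_delta_tr A B :
  \sum_i \sum_k (A *m delta_mx k i *m B) i k = \tr (A *m B^T).
Proof.
apply: eq_bigr => i _; rewrite mxE; apply: eq_bigr => k _.
by rewrite mul_delta_mulE mxE.
Qed.

Lemma comm_br_twice X (E : 'M[T]_n) : comm_br X (comm_br X E) =
  X *m X *m E *m 1%:M - (X *m E *m X) *+ 2 + 1%:M *m E *m (X *m X).
Proof.
rewrite /comm_br mulmxBr mulmxBl mulmx1 mul1mx !mulmxA opprB addrA.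
by rewrite addrAC -[_ - _ - _]addrA -opprD -mulr2n.
Qed.

(** The left side is the trace of ad(X)^2 on the space of all n by n matrices. *)
Lemma trace_ad_sq X :
  \sum_i \sum_k comm_br X (comm_br X (delta_mx i k)) i k =
  (\tr (X *m X) *+ n - \tr X ^+ 2) *+ 2.
Proof.
transitivity (\sum_i \sum_k ((X *m X *m delta_mx i k *m 1%:M) i k
   - (X *m delta_mx i k *m X) i k *+ 2 + (1%:M *m delta_mx i k *m (X *m X)) i k)).
  by apply: eq_bigr => i _; apply: eq_bigr => k _;
     rewrite comm_br_twice mxE [X in X + _]mxE -mulmxnE; congr (_ + _ + _); rewrite mxE.
under eq_bigr do rewrite big_split sumrB sumrMnl /=.
rewrite big_split sumrB sumrMnl /= !sum_mul_delta mxtrace1.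
rewrite -mulr_natr; ring.
Qed.

(** Here ad(X)^2 is composed with transposition; together with [trace_ad_sq] this gives the trace on
    the skew-symmetric matrices. *)
Lemma trace_ad_sq_tr X :
  \sum_i \sum_k comm_br X (comm_br X (delta_mx k i)) i k =
  (\tr (X *m X) - \tr (X *m X^T)) *+ 2.
Proof.
transitivity (\sum_i \sum_k ((X *m X *m delta_mx k i *m 1%:M) i k
   - (X *m delta_mx k i *m X) i k *+ 2 + (1%:M *m delta_mx k i *m (X *m X)) i k)).
  apply: eq_bigr => i _; apply: eq_bigr => k _.
  by rewrite comm_br_twice mxE [X in X + _]mxE -mulmxnE; congr (_ + _ + _); rewrite mxE.
under eq_bigr do rewrite big_split sumrB sumrMnl /=.
rewrite big_split sumrB sumrMnl /= !sum_mul_delta_tr trmx1 mulmx1 mul1mx mxtrace_tr.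
ring.
Qed.

End ElementaryMatrices.

Section SpecialOrthogonalAlgebra.
Local Arguments so_mx : simpl never.
Variables (R : realType) (n : nat).
Local Notation so := (so R n).
Implicit Types X Y Z : so.

Lemma so_mx_inj : injective (@so_mx R n). Proof. exact: val_inj. Qed.
Lemma so_mx_linear : linear (@so_mx R n : so -> 'M[R]_n).
Proof. by move=> a X Y; rewrite /so_mx linearP. Qed.
HB.instance Definition _ :=
  GRing.isLinear.Build R so 'M[R]_n _ (@so_mx R n) so_mx_linear.

Lemma so_mxD X Y : so_mx (X + Y) = so_mx X + so_mx Y. Proof. by []. Qed.
Lemma so_mxN X : so_mx (- X) = - so_mx X. Proof. by []. Qed.
Lemma so_mxZ a X : so_mx (a *: X) = a *: so_mx X. Proof. by []. Qed.
Lemma so_mx_sum I (r : seq I) (P : pred I) (F : I -> so) :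
  so_mx (\sum_(i <- r | P i) F i) = \sum_(i <- r | P i) so_mx (F i).
Proof. exact: (linear_sum (@so_mx R n)). Qed.

Lemma mk_so_linear : linear (@mk_so R n : 'M[R]_n -> so).
Proof. by move=> a X Y; rewrite /mk_so linearP. Qed.
HB.instance Definition _ :=
  GRing.isLinear.Build R 'M[R]_n so _ (@mk_so R n) mk_so_linear.

Lemma orthogonal_inv (A : 'M[R]_n) : Defs.orthogonal A -> invmx A = A^T.
Proof.
move=> AO; have Au : A \in unitmx by case/mulmx1_unit: AO.
by rewrite -[LHS]mulmx1 -AO mulmxA mulVmx // mul1mx.
Qed.

Definition so_elt (i k : 'I_n) : so := mk_so (delta_mx i k - delta_mx k i).

Lemma so_eltE i k : so_mx (so_elt i k) = delta_mx i k - delta_mx k i.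
Proof. by rewrite mk_soK // linearB /= !trmx_delta opprB. Qed.

Lemma so_eltN i k : so_elt k i = - so_elt i k.
Proof. by apply: so_mx_inj; rewrite so_mxN !so_eltE opprB. Qed.

(** The sum runs over all ordered pairs, whence the factor 1/2. The family is redundant, but it
    makes the matrix entries the coefficients in [endo_trace_frame]. *)
Lemma so_elt_sum X : X = \sum_(p : 'I_n * 'I_n) so_mx X p.1 p.2 *: (2^-1 *: so_elt p.1 p.2).
Proof.
apply: so_mx_inj; rewrite so_mx_sum.
rewrite -(pair_bigA _ (fun i k => so_mx (so_mx X i k *: (2^-1 *: so_elt i k)))) /=.
have tE i k : so_mx (so_mx X i k *: (2^-1 *: so_elt i k)) =
    (so_mx X i k / 2) *: delta_mx i k - (so_mx X i k / 2) *: delta_mx k i.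
  by rewrite scalerA so_mxZ so_eltE scalerBr.
under eq_bigr => i _ do (under eq_bigr => k _ do rewrite tE; rewrite sumrB).
rewrite sumrB [X in _ - X]exchange_big /= -sumrB [LHS]matrix_sum_delta.
apply: eq_bigr => i _; rewrite -sumrB; apply: eq_bigr => k _.
rewrite -scalerBl; congr (_ *: _).
have /matrixP/(_ k i) := so_skew X; rewrite !mxE => ->; by field.
Qed.

Lemma so_br_linear_l a X Y Z : so_br (a *: X + Y) Z = a *: so_br X Z + so_br Y Z.
Proof.
by apply: so_mx_inj; rewrite so_mxD so_mxZ !so_brE so_mxD so_mxZ comm_br_linear_l.
Qed.

Lemma so_brC X Y : so_br X Y = - so_br Y X.
Proof. by apply: so_mx_inj; rewrite so_mxN !so_brE comm_brC. Qed.

Lemma so_br_jacobi X Y Z : so_br X (so_br Y Z) = so_br (so_br X Y) Z + so_br Y (so_br X Z).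
Proof. by apply: so_mx_inj; rewrite so_mxD !so_brE comm_br_jacobi. Qed.

Lemma so_Ad_linear A : Defs.orthogonal A -> linear (@so_Ad R n A).
Proof.
move=> AO a X Y; apply: so_mx_inj; rewrite so_mxD so_mxZ !so_AdE // so_mxD so_mxZ.
by rewrite /conj_mx mulmxDr mulmxDl -scalemxAr -scalemxAl.
Qed.

Lemma conj_comm_br (T : comUnitRingType) m (A X Y : 'M[T]_m) : A \in unitmx ->
  conj_mx A (comm_br X Y) = comm_br (conj_mx A X) (conj_mx A Y).
Proof.
move=> Au; rewrite /conj_mx /comm_br mulmxBr mulmxBl.
by congr (_ - _); rewrite !mulmxA mulmxKV.
Qed.

Lemma conj_mx_trace (T : comUnitRingType) m (A X Y : 'M[T]_m) : A \in unitmx ->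
  \tr (conj_mx A X *m conj_mx A Y) = \tr (X *m Y).
Proof.
by move=> Au; rewrite /conj_mx !mulmxA mulmxKV // mxtrace_mulC !mulmxA mulVmx // mul1mx.
Qed.

Lemma orthogonal_unit (A : 'M[R]_n) : Defs.orthogonal A -> A \in unitmx.
Proof. by move=> AO; case/mulmx1_unit: AO. Qed.

Lemma so_Ad_br A X Y : Defs.orthogonal A ->
  so_Ad A (so_br X Y) = so_br (so_Ad A X) (so_Ad A Y).
Proof.
move=> AO; apply: so_mx_inj.
by rewrite so_brE !so_AdE // so_brE conj_comm_br // orthogonal_unit.
Qed.

Section BiinvariantForm.
Variable ip : so -> so -> R.
Hypothesis ip_bi : so_biinvariant ip.
Hypothesis n_ge5 : (5 <= n)%N.
Let ip_sp : scalar_product ip. Proof. by case: ip_bi. Qed.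

(* Conjugation by the signed permutation matrix diag(d) s. *)
Lemma ip_signed_perm (s : 'S_n) (d : 'I_n -> R) i k p q :
    (forall x, d x * d x = 1) -> \prod_x d x * (-1) ^+ s = 1 ->
  ip (so_elt (s i) (s k)) (so_elt (s p) (s q)) =
  d i * d k * (d p * d q) * ip (so_elt i k) (so_elt p q).
Proof.
move=> d2 detd; pose D := diag_mx (\row_x d x); pose A := D *m perm_mx s.
have DT : D^T = D by rewrite tr_diag_mx.
have DD : D *m D = 1%:M.
  by apply/matrixP => x y; rewrite mul_diag_mx !mxE mulrnAr d2.
have pp : perm_mx s *m (perm_mx s)^T = 1%:M :> 'M[R]_n.
  by rewrite tr_perm_mx -perm_mxM mulgV perm_mx1.
have AO : Defs.orthogonal A.
  by rewrite /Defs.orthogonal trmx_mul mulmxA -(mulmxA D) pp mulmx1 DT.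
have AS : special_orthogonal A.
  split=> //; rewrite det_mulmx det_diag det_perm.
  by under eq_bigr do rewrite mxE.
have AE x y : so_Ad A (so_elt (s x) (s y)) = (d x * d y) *: so_elt x y.
  apply: so_mx_inj; rewrite so_AdE // so_mxZ !so_eltE /conj_mx orthogonal_inv //.
  rewrite trmx_mul DT tr_perm_mx !mulmxA -(mulmxA D) -row_permE.
  rewrite -(mulmxA D) -col_permE.
  apply/matrixP => a b; rewrite mul_mx_diag mul_diag_mx !mxE !(inj_eq perm_inj).
  have e u v : d a * d b * ((a == u) && (b == v))%:R =
      d u * d v * ((a == u) && (b == v))%:R.
    by have [->|_] := eqVneq a u; have [->|_] := eqVneq b v; rewrite ?mulr0.
  by rewrite mulrAC !mulrBr !e (mulrC (d y)).
case: ip_bi => _ /(_ A AS) <-.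
by rewrite !AE (ipZl ip_sp) (ipZr ip_sp) mulrA.
Qed.

Lemma exists_outside (r : seq 'I_n) : (size r < n)%N -> exists p, p \notin r.
Proof.
move=> rn; apply/existsP; rewrite -negb_forall; apply/negP => /forallP rA.
suff: (n <= size r)%N by rewrite leqNgt rn.
rewrite -[X in (X <= _)%N](card_ord n) (leq_trans _ (card_size r)) //.
by apply/subset_leq_card/fintype.subsetP => x _.
Qed.

(** As n >= 5, there is an index x outside i, k, p, q. Changing the signs of the coordinates i and x
    has determinant 1, negates the first element and fixes the second. For so(4), which is not
    simple, the assertion fails. *)
Lemma so_elt_orth i k p q : i != k -> i \notin [:: p; q] -> ip (so_elt i k) (so_elt p q) = 0.
Proof.
move=> ik ipq; have [x] := @exists_outside [:: i; k; p; q] n_ge5.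
rewrite !inE !negb_or => /and4P[xi xk xp xq].
pose d y : R := if (y == i) || (y == x) then -1 else 1.
have d2 y : d y * d y = 1 by rewrite /d; case: ifP => _; ring.
have dd : \prod_y d y * (-1) ^+ (1%g : 'S_n) = 1.
  rewrite odd_perm1 expr0 mulr1 (bigD1 i) //= (bigD1 x) //= big1 ?mulr1.
    by rewrite /d !eqxx orbT mulrNN mulr1.
  by move=> y /andP[yi yx]; rewrite /d (negPf yi) (negPf yx).
have := ip_signed_perm i k p q d2 dd; rewrite !perm1.
move: ipq; rewrite !inE negb_or => /andP[ip' iq].
have d1 y : i != y -> x != y -> d y = 1.
  by move=> iy xy; rewrite /d eq_sym (negPf iy) eq_sym (negPf xy).
have di : d i = -1 by rewrite /d eqxx.
by rewrite di !d1 // !mulr1 mulN1r => /opp_self_eq0.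
Qed.

Let N i k := ip (so_elt i k) (so_elt i k).

(** Transpositions carry any pair of distinct indices to any other. One sign change corrects the
    determinant and drops out of the norm, where it enters squared. *)
Lemma so_elt_norm i k p q : i != k -> p != q -> N i k = N p q.
Proof.
have N_tperm a b x y : N (tperm a b x) (tperm a b y) = N x y.
  have [->|ab] := eqVneq a b; first by rewrite tperm1 !perm1.
  pose d y : R := if y == a then -1 else 1.
  have d2 u : d u * d u = 1 by rewrite /d; case: ifP => _; ring.
  rewrite /N (@ip_signed_perm (tperm a b) d) //.
    by rewrite mulrACA !d2 !mul1r.
  rewrite odd_tperm ab expr1 (bigD1 a) //= big1 ?mulr1; last first.
    by move=> u ua; rewrite /d (negPf ua).
  by rewrite /d eqxx mulrNN mulr1.
move=> ik pq; rewrite -(N_tperm i p) tpermL.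
have pk : p != tperm i p k by rewrite -{1}(tpermL i p) (inj_eq perm_inj).
move: (tperm i p k) pk => l pl.
by rewrite -(N_tperm l q) tpermL tpermD // eq_sym.
Qed.

Lemma so_biinvariant_form : exists c, forall X Y, ip X Y = c * \tr (so_mx X *m so_mx Y).
Proof.
have i0 : 'I_n := Ordinal (leq_trans (isT : (0 < 5)%N) n_ge5).
have [k0] := @exists_outside [:: i0] (leq_trans (isT : (1 < 5)%N) n_ge5).
rewrite inE eq_sym => ik0; pose c := N i0 k0.
have skew i k X : so_mx X k i = - so_mx X i k.
  by have /matrixP/(_ i k) := so_skew X; rewrite !mxE.
have ip_elt i k p q : ip (so_elt i k) (so_elt p q) =
    c * ((i == p)%:R * (k == q)%:R - (i == q)%:R * (k == p)%:R).
  have elt0 u : so_elt u u = 0 by apply: so_mx_inj; rewrite so_eltE subrr.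
  have [<-|ik] := eqVneq i k.
    by rewrite elt0 (ip0l ip_sp) [X in _ - X]mulrC subrr mulr0.
  have [<-|pq] := eqVneq p q; first by rewrite elt0 (ip0r ip_sp) subrr mulr0.
  have main u v : u != v -> u = i -> ip (so_elt i k) (so_elt u v) = c * (k == v)%:R.
    move=> uv ui; rewrite ui; rewrite ui in uv; have [<-|kv] := eqVneq k v.
      by rewrite mulr1; exact: so_elt_norm.
    rewrite so_eltN (ipNl ip_sp) so_elt_orth ?oppr0 ?mulr0 // 1?eq_sym //.
    by rewrite !inE negb_or eq_sym ik kv.
  have [ip'|ip'] := eqVneq i p.
    rewrite main // ip' (negPf pq) mul0r subr0 mul1r //.
  have [iq|iq] := eqVneq i q.
    rewrite (so_eltN q p) (ipNr ip_sp) main ?(eq_sym q) // mul0r sub0r mul1r mulrN //.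
  by rewrite so_elt_orth // ?inE ?negb_or ?ip' ?iq // !mul0r subrr mulr0.
(* The square of an elementary skew matrix has trace -2, and [c] is its [ip]-norm. *)
exists (- (c / 2)) => X Y.
rewrite {1}(so_elt_sum X) {1}(so_elt_sum Y) (ip_suml ip_sp).
transitivity (\sum_(r : 'I_n * 'I_n) (c / 4) * (so_mx X r.1 r.2 *
     (so_mx Y r.1 r.2 - so_mx Y r.2 r.1))).
  apply: eq_bigr => -[i k] _ /=; rewrite (ip_sumr ip_sp).
  transitivity (\sum_(r : 'I_n * 'I_n) c / 4 * so_mx X i k * (so_mx Y r.1 r.2 *
     ((i == r.1)%:R * (k == r.2)%:R - (i == r.2)%:R * (k == r.1)%:R))).
    apply: eq_bigr => -[p q] _ /=.
    rewrite !(ipZl ip_sp) !(ipZr ip_sp) ip_elt; by field.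
  rewrite -mulr_sumr mulrA; congr (_ * _).
  under eq_bigr do rewrite mulrBr; rewrite sumrB; congr (_ - _).
    rewrite (bigD1 (i, k)) //= !eqxx !mulr1 big1 ?addr0 // => -[p q] /=.
    by rewrite xpair_eqE negb_and !(eq_sym _ i) !(eq_sym _ k)
    => /orP[/negPf->|/negPf->]; rewrite ?mul0r ?mulr0.
  rewrite (bigD1 (k, i)) //= !eqxx !mulr1 big1 ?addr0 // => -[p q] /=.
  by rewrite xpair_eqE negb_and !(eq_sym _ i) !(eq_sym _ k)
    => /orP[/negPf->|/negPf->]; rewrite ?mul0r ?mulr0.
rewrite /mxtrace mulr_sumr; under [RHS]eq_bigr do rewrite mxE mulr_sumr.
rewrite pair_bigA; apply: eq_bigr => -[i k] _ /=.
rewrite (skew i k Y); by field.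
Qed.

Lemma so_metric_lie_algebra : metric_lie_algebra (@so_br R n) ip.
Proof.
split=> //.
- exact: so_br_linear_l.
- exact: so_brC.
- exact: so_br_jacobi.
have [c ipE] := so_biinvariant_form => X Y Z.
rewrite !ipE !so_brE /comm_br mulmxBl mulmxBr !mulmxA; congr (_ * _).
move: (so_mx X) (so_mx Y) (so_mx Z) => A B C.
by rewrite !raddfB /= -(mulmxA B) (mxtrace_mulC B).
Qed.

(** Invariance of [ip] is given for determinant 1 only, but a multiple of the trace form is
    preserved by conjugation with any orthogonal matrix. *)
Lemma so_Ad_isometric_automorphism A : Defs.orthogonal A ->
  isometric_automorphism (@so_br R n) ip (@so_Ad R n A).
Proof.
move=> AO; split=> [|X Y|X Y]; first exact: so_Ad_linear.
  exact: so_Ad_br.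
have [c ipE] := so_biinvariant_form.
by rewrite !ipE !so_AdE // conj_mx_trace // orthogonal_unit.
Qed.

End BiinvariantForm.

Lemma so_killing X : killing (@so_br R n) X X = (n%:R - 2) * \tr (so_mx X *m so_mx X).
Proof.
have brr : linear (so_br X).
  by move=> a Y Z; rewrite !(so_brC X) so_br_linear_l opprD scalerN.
pose p (r : 'I_n * 'I_n) Y := so_mx Y r.1 r.2.
have pl r a Y Z : p r (a *: Y + Z) = a * p r Y + p r Z.
  by rewrite /p so_mxD so_mxZ !mxE.
have ll : linear (fun Y => so_br X (so_br X Y)) by move=> a Y Z; rewrite !brr.
rewrite /killing (endo_trace_frame pl so_elt_sum ll) /p.
under eq_bigr do rewrite !so_brE so_mxZ so_eltE.
set A := so_mx X.
(* The projection onto skew matrices is half of identity minus transposition. *)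
transitivity (2^-1 * (\sum_i \sum_k comm_br A (comm_br A (delta_mx i k)) i k
  - \sum_i \sum_k comm_br A (comm_br A (delta_mx k i)) i k)).
  rewrite -sumrB mulr_sumr -(pair_bigA _ (fun i k =>
    comm_br A (comm_br A (2^-1 *: (delta_mx i k - delta_mx k i))) i k)) /=.
  apply: eq_bigr => i _; rewrite -sumrB mulr_sumr; apply: eq_bigr => k _.
  have cZ a B C : comm_br A (a *: (B - C)) = a *: (comm_br A B - comm_br A C).
    rewrite /comm_br scalerBr mulmxBr mulmxBl -!scalemxAl -!scalemxAr -!scalerBr.
    by congr (_ *: _); rewrite !opprB addrACA [RHS]addrACA [X in _ = _ + X]addrC.
  by rewrite cZ cZ !mxE.
have trA : \tr A = 0.
  by apply: opp_self_eq0; rewrite -[LHS]mxtrace_tr so_skew linearN.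
rewrite trace_ad_sq trace_ad_sq_tr so_skew mulmxN linearN /= trA -/A -mulr_natr.
by field.
Qed.

End SpecialOrthogonalAlgebra.

(** * The special unitary Lie algebras *)

Section ConjugateTranspose.
Variables (R : realType) (n : nat).
Local Notation C := (R[i]).
Implicit Types A B X : 'M[C]_n.

Lemma adjmx_mul A B : (A *m B)^t* = B^t* *m A^t*.
Proof. by rewrite trmx_mul map_mxM. Qed.
Lemma adjmxD A B : (A + B)^t* = A^t* + B^t*.
Proof. by rewrite linearD map_mxD. Qed.
Lemma adjmxB A B : (A - B)^t* = A^t* - B^t*.
Proof. by rewrite linearB map_mxB. Qed.
Lemma adjmxN A : (- A)^t* = - A^t*.
Proof. by rewrite linearN map_mxN. Qed.
Lemma adjmxZ a A : (a *: A)^t* = a^* *: A^t*.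
Proof. by rewrite linearZ map_mxZ. Qed.
Lemma adjmx1 : (1%:M : 'M[C]_n)^t* = 1%:M.
Proof. by rewrite trmx1 map_mx1. Qed.
Lemma adjmx_scalar (a : C) : (a%:M : 'M[C]_n)^t* = (a^*)%:M.
Proof. by rewrite tr_scalar_mx map_scalar_mx. Qed.
Lemma adjmx_trace A : \tr (A^t*) = (\tr A)^*.
Proof. by rewrite /mxtrace rmorph_sum; apply: eq_bigr => i _; rewrite !mxE. Qed.
Lemma adjmx_delta i k : (delta_mx i k : 'M[C]_n)^t* = delta_mx k i.
Proof. by rewrite trmx_delta map_delta_mx. Qed.

(** If v = vX, then v v^* = v X v^* is both Hermitian and skew-Hermitian, hence 0, and so is v. *)
Lemma skew_hermitian_unit X : X^t* = - X -> 1%:M - X \in unitmx.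
Proof.
move=> XS; rewrite -row_free_unit -kermx_eq0; apply/eqP/row_matrixP => i.
rewrite row0; have : row i (kermx (1%:M - X)) *m (1%:M - X) = 0.
  by rewrite -row_mul mulmx_ker row0.
move: (row i _) => v; rewrite mulmxBr mulmx1 => /eqP; rewrite subr_eq0 => /eqP vX.
pose c := v *m v^t*.
have cc : c^t* = c by rewrite /c trmx_mul map_mxM trmxCK.
have cN : c^t* = - c.
  rewrite /c {1}vX trmx_mul map_mxM trmxCK trmx_mul map_mxM XS mulNmx mulmxN.
  by rewrite mulmxA -vX.
have c0 : c 0 0 = 0.
  by apply: opp_self_eq0; rewrite -[LHS]/(c 0 0) -{1}cc cN mxE.
apply/rowP => k; rewrite [RHS]mxE; apply/eqP; rewrite -mul_conjC_eq0; apply/eqP.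
move: c0; rewrite mxE => /eqP; rewrite psumr_eq0 => [/allP/(_ k)|j _].
  by rewrite mem_index_enum !mxE => /(_ isT)/eqP.
by rewrite !mxE mul_conjC_ge0.
Qed.

End ConjugateTranspose.

(* S, mx, mk and br stand for su, su_mx, mk_su and su_br. They are kept abstract
   because comparing two distinct terms su_mx (su_br _ _) unfolds the projection
   onto su_space. *)
Section SpecialUnitaryAlgebra.
Variables (R : realType) (n : nat) (S : vectType R).
Local Notation C := (R[i]).
Variables (mx : S -> 'M[C]_n) (mk : 'M[C]_n -> S) (br : S -> S -> S).
Hypothesis n_gt0 : (0 < n)%N.
Hypothesis mx_inj : injective mx.
Hypothesis mxD : forall X Y, mx (X + Y) = mx X + mx Y.
Hypothesis mxZ : forall a X, mx (a *: X) = a%:C *: mx X.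
Hypothesis mx_skew : forall X, (mx X)^t* = - mx X.
Hypothesis mx_tr : forall X, \tr (mx X) = 0.
Hypothesis mkK : forall M : 'M[C]_n, M^t* = - M -> \tr M = 0 -> mx (mk M) = M.
Hypothesis brE : forall X Y, mx (br X Y) = comm_br (mx X) (mx Y).
Implicit Types X Y Z W : S.
Let Ad A X := mk (conj_mx A (mx X)).

Let mx0 : mx 0 = 0.
Proof. by apply: (addrI (mx 0)); rewrite -mxD !addr0. Qed.
Let mxN X : mx (- X) = - mx X.
Proof. by apply: (addrI (mx X)); rewrite -mxD !subrr mx0. Qed.
Let br_linear_l (a : R) X Y Z : br (a *: X + Y) Z = a *: br X Z + br Y Z.
Proof. by apply: mx_inj; rewrite mxD mxZ !brE mxD mxZ comm_br_linear_l. Qed.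
Let brC X Y : br X Y = - br Y X.
Proof. by apply: mx_inj; rewrite mxN !brE comm_brC. Qed.
Let br_jacobi X Y Z : br X (br Y Z) = br (br X Y) Z + br Y (br X Z).
Proof. by apply: mx_inj; rewrite mxD !brE comm_br_jacobi. Qed.

Let AdE A X : special_unitary A -> mx (Ad A X) = conj_mx A (mx X).
Proof.
move=> [AU _]; apply: mkK; rewrite /conj_mx; last first.
  by rewrite mxtrace_mulC mulmxA mulVmx ?unitarymx_unit // mul1mx mx_tr.
rewrite invmx_unitary // !adjmx_mul trmxCK mx_skew.
by rewrite mulNmx mulmxN mulmxA.
Qed.

Let Ad_linear A : special_unitary A -> linear (Ad A).
Proof.
move=> AO a X Y; apply: mx_inj; rewrite mxD mxZ !AdE // mxD mxZ.
by rewrite /conj_mx mulmxDr mulmxDl -scalemxAr -scalemxAl.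
Qed.

Let Ad_br A X Y : special_unitary A -> Ad A (br X Y) = br (Ad A X) (Ad A Y).
Proof.
move=> AS; apply: mx_inj; rewrite brE !AdE // brE conj_comm_br //.
by case: AS => AU _; exact: unitarymx_unit.
Qed.

Definition traceless_part (M : 'M[C]_n) : 'M[C]_n := M - (\tr M / n%:R)%:M.
(** This is twice the projection onto skew-Hermitian matrices; the missing 1/2 reappears in
    [frame]. *)
Definition skew_part (M : 'M[C]_n) : 'M[C]_n := M - M^t*.
Definition su_part (M : 'M[C]_n) : S := mk (traceless_part M).

Lemma traceless_part_linear : linear traceless_part.
Proof.
move=> a A B; rewrite /traceless_part linearP /= mulrDl -mulrA.
by rewrite raddfD /= scalerBr opprD addrACA scale_scalar_mx.
Qed.

Lemma skew_part_skew M : (skew_part M)^t* = - skew_part M.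
Proof. by rewrite adjmxB trmxCK opprB. Qed.

Lemma su_partE M : M^t* = - M -> mx (su_part M) = traceless_part M.
Proof.
move=> MS; apply: mkK.
  have tE : (\tr M)^* = - \tr M by rewrite -adjmx_trace MS raddfN.
  have cE : (\tr M / n%:R)^* = - (\tr M / n%:R).
    by rewrite rmorphM fmorphV rmorph_nat /= tE mulNr.
  by rewrite adjmxB MS adjmx_scalar cE raddfN opprK /traceless_part opprB addrC.
rewrite raddfB /= mxtrace_scalar -[X in _ - X]mulr_natr divfK ?subrr //.
by rewrite pnatr_eq0 lt0n_neq0.
Qed.

Lemma su_part_linear (a : R) M N : M^t* = - M -> N^t* = - N ->
  su_part (a%:C *: M + N) = a *: su_part M + su_part N.
Proof.
move=> MS NS; apply: mx_inj; rewrite mxD mxZ !su_partE ?traceless_part_linear //.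
have aR : (a%:C)^* = a%:C by rewrite conj_Creal // complex_real.
by rewrite adjmxD adjmxZ aR MS NS scalerN opprD.
Qed.

Lemma su_part_mx X : su_part (mx X) = X.
Proof.
apply: mx_inj; rewrite su_partE // /traceless_part mx_tr mul0r.
by rewrite raddf0 subr0.
Qed.

Lemma su_part_scale_linear (a : R) M N :
  su_part (skew_part (a%:C *: M + N)) =
  a *: su_part (skew_part M) + su_part (skew_part N).
Proof.
rewrite -su_part_linear ?skew_part_skew //; congr su_part.
have aR : (a%:C)^* = a%:C by rewrite conj_Creal // complex_real.
by rewrite /skew_part adjmxD adjmxZ aR scalerBr opprD addrACA.
Qed.

Lemma comm_traceless_part A M : comm_br A (traceless_part M) = comm_br A M.
Proof.
rewrite /comm_br /traceless_part mulmxBr mulmxBl scalar_mxC.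
by rewrite opprB addrA subrK.
Qed.

(** The real basis E_ik, i E_ik of all complex matrices is projected to su(n). With the real and
    imaginary parts of the entries as coefficients, it gives a redundant spanning family in which
    traces over su(n) can be computed. *)
Let w (b : bool) : C := if b then 'i%C else 1.
Let frame (r : bool * ('I_n * 'I_n)) : S :=
  2^-1 *: su_part (skew_part (w r.1 *: delta_mx r.2.1 r.2.2)).
Let frame_coord (r : bool * ('I_n * 'I_n)) X : R :=
  let x := mx X r.2.1 r.2.2 in if r.1 then complex.Im x else complex.Re x.

Let frame_coord_linear r a X Y :
  frame_coord r (a *: X + Y) = a * frame_coord r X + frame_coord r Y.
Proof.
rewrite /frame_coord mxD mxZ !mxE; case: (mx X _ _) (mx Y _ _) => [x x'] [y y'].
by case: r.1; rewrite /= ?mul0r ?subr0 ?addr0.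
Qed.

Let frame_sum X : X = \sum_r frame_coord r X *: frame r.
Proof.
pose q M := 2^-1 *: su_part (skew_part M).
have qD (a : R) M N : q (a%:C *: M + N) = a *: q M + q N.
  by rewrite /q su_part_scale_linear scalerDr !scalerA mulrC.
have q0 : q 0 = 0.
  by have := qD (-1) 0 0; rewrite scaler0 addr0 scaleN1r addNr.
have q_sum I (r : seq I) F (c : I -> R) :
    q (\sum_(i <- r) (c i)%:C *: F i) = \sum_(i <- r) c i *: q (F i).
  by elim/big_rec2: _ => [|i x y _ <-]; rewrite ?q0 // qD.
have qX : q (mx X) = X.
  rewrite /q /skew_part mx_skew opprK -mulr2n -scaler_nat.
  have -> : (2%:R : C) = (2 : R)%:C by rewrite rmorph_nat.
  rewrite -[_ *: mx X]addr0 su_part_linear ?mx_skew //; last first.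
    by rewrite trmx0 map_mx0 oppr0.
  rewrite su_part_mx scalerDr scalerA mulVf ?pnatr_eq0 // scale1r.
  suff -> : su_part 0 = 0 by rewrite scaler0 addr0.
  apply: mx_inj; rewrite su_partE ?mx0 ?trmx0 ?map_mx0 ?oppr0 //.
  by rewrite /traceless_part mxtrace0 mul0r raddf0 subrr.
rewrite -[LHS]qX.
have -> : mx X = \sum_r (frame_coord r X)%:C *: (w r.1 *: delta_mx r.2.1 r.2.2).
  rewrite -(pair_bigA _ (fun b p => (frame_coord (b, p) X)%:C *: (w b *: delta_mx p.1 p.2))).
  rewrite big_bool /= -big_split [LHS]matrix_sum_delta pair_bigA.
  apply: eq_bigr => -[i k] _ /=; rewrite !scalerA -scalerDl; congr (_ *: _).
  rewrite /frame_coord /=; case: (mx X i k) => x y /=.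
  by apply/eqP; rewrite eq_complex /=; apply/andP; split; apply/eqP; ring.
exact: q_sum.
Qed.

Lemma su_killing X :
  killing br X X = n%:R * complex.Re (\tr (mx X *m mx X)) *+ 2.
Proof.
have br_lin Y : linear (br Y).
  by move=> a U V; rewrite !(brC Y) br_linear_l opprD scalerN.
have ll : linear (fun Y => br X (br X Y)) by move=> a Y Z; rewrite !br_lin.
rewrite /killing (endo_trace_frame frame_coord_linear frame_sum ll).
set A := mx X.
pose a i k := comm_br A (comm_br A (delta_mx i k)) i k.
pose b i k := comm_br A (comm_br A (delta_mx k i)) i k.
have brZ (c : C) B : comm_br A (c *: B) = c *: comm_br A B.
  by rewrite /comm_br -scalemxAl -scalemxAr scalerBr.
have brB B D : comm_br A (B - D) = comm_br A B - comm_br A D.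
  rewrite /comm_br mulmxBr mulmxBl.
  by rewrite !opprB addrACA [RHS]addrACA [X in _ = _ + X]addrC.
have brL u v P Q : comm_br A (u *: P - v *: Q) = u *: comm_br A P - v *: comm_br A Q.
  by rewrite (brB (u *: P) (v *: Q)) (brZ u P) (brZ v Q).
have adE r : mx (br X (br X (frame r))) r.2.1 r.2.2 =
    (2^-1)%:C * (w r.1 * a r.2.1 r.2.2 - (w r.1)^* * b r.2.1 r.2.2).
  rewrite !brE /frame mxZ su_partE ?skew_part_skew // !brZ comm_traceless_part.
  rewrite /skew_part adjmxZ adjmx_delta.
  rewrite (brL (w r.1) (w r.1)^* (delta_mx r.2.1 r.2.2) (delta_mx r.2.2 r.2.1)).
  rewrite (brL (w r.1) (w r.1)^* (comm_br A (delta_mx r.2.1 r.2.2))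
    (comm_br A (delta_mx r.2.2 r.2.1))).
  have ent (c u v : C) (P Q : 'M[C]_n) i k :
    (c *: (u *: P - v *: Q)) i k = c * (u * P i k - v * Q i k) by rewrite !mxE.
  exact: ent.
have fc r : frame_coord r (br X (br X (frame r))) =
    let x := (2^-1)%:C * (w r.1 * a r.2.1 r.2.2 - (w r.1)^* * b r.2.1 r.2.2) in
    if r.1 then complex.Im x else complex.Re x.
  by rewrite /frame_coord adE.
(* The contributions of E_ik and i E_ik are 1/2 Re (a - b) and 1/2 Im (i a + i b) = 1/2 Re (a + b),
   so that b cancels. *)
transitivity (complex.Re (\sum_i \sum_k a i k)).
  rewrite pair_bigA Re_sum -(pair_bigA _ (fun b p =>
    frame_coord (b, p) (br X (br X (frame (b, p)))))).
  rewrite big_bool -big_split; apply: eq_bigr => p _.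
  rewrite (fc (true, p)) (fc (false, p)) /=.
  case: (a p.1 p.2) (b p.1 p.2) => [x y] [x' y'] /=.
  by field.
rewrite trace_ad_sq mx_tr expr0n /= subr0.
have reMn (u : C) k : complex.Re (u *+ k) = complex.Re u *+ k.
  elim: k => [|k IH] //; rewrite !mulrS -IH.
  by move: (u *+ k); case: (u) => ? ? [? ?].
by rewrite !reMn mulr_natl.
Qed.

(** * From invariance under SU(n) to ad-invariance *)

Section BiinvariantForm.
Variable ip : S -> S -> R.
Hypothesis ip_sp : scalar_product ip.
Hypothesis ip_Ad : forall A, special_unitary A ->
  forall X Y, ip (Ad A X) (Ad A Y) = ip X Y.

(** Dividing [U] by an n-th root of its determinant, a scalar of modulus 1, gives an element of
    SU(n) without changing the conjugation. Cayley transforms are unitary but need not have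
    determinant 1. *)
Lemma ip_unitary_conj (U M N : 'M[C]_n) : U \is unitarymx -> M^t* = - M -> N^t* = - N ->
  ip (su_part (U *m M *m U^t*)) (su_part (U *m N *m U^t*)) = ip (su_part M) (su_part N).
Proof.
move=> UU MS NS; pose mu := n.-root (\det U).
have muE : mu ^+ n = \det U by rewrite rootCK.
have detU : \det U * (\det U)^* = 1.
  have /unitarymxP/(congr1 determinant) := UU.
  by rewrite det_mulmx det1 det_map_mx det_tr.
have mu1 : mu * mu^* = 1.
  have : (mu * mu^*) ^+ n = 1 by rewrite exprMn -rmorphXn /= muE.
  move/eqP; rewrite pexpr_eq1 ?mul_conjC_ge0 // => /eqP //.
pose V := mu^* *: U.
have VS : special_unitary V.
  split; first last.
    by rewrite detZ -muE -exprMn mulrC mu1 expr1n.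
  apply/unitarymxP; rewrite adjmxZ -scalemxAl -scalemxAr scalerA.
  by rewrite conjCK mulrC mu1 scale1r; apply/unitarymxP.
have VE L : L^t* = - L -> Ad V (su_part L) = su_part (U *m L *m U^t*).
  move=> LS; apply: mx_inj; rewrite AdE // !su_partE //; last first.
    by rewrite !adjmx_mul trmxCK LS mulNmx mulmxN mulmxA.
  have [VU _] := VS; rewrite /conj_mx invmx_unitary // adjmxZ conjCK.
  rewrite -!scalemxAl -scalemxAr scalerA mulrC mu1 scale1r.
  rewrite /traceless_part mulmxBr mulmxBl; congr (_ - _).
  rewrite [\tr (U *m _ *m _)]mxtrace_mulC mulmxA.
  have /unitarymxP UUt := UU; have UtU := mulmx1C UUt.
  by rewrite UtU mul1mx mul_mx_scalar -scalemxAl UUt scalemx1.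
by rewrite -(VE M MS) -(VE N NS) ip_Ad.
Qed.

(* The unitary matrix (1 + X) (1 - X)^-1 is the Cayley transform of X; putting
   (1 - X) M (1 + X) in place of M clears the denominators. *)
Lemma ip_cayley (X M N : 'M[C]_n) : X^t* = - X -> M^t* = - M -> N^t* = - N ->
  let P := 1%:M + X in let Q := 1%:M - X in
  ip (su_part (P *m M *m Q)) (su_part (P *m N *m Q)) =
  ip (su_part (Q *m M *m P)) (su_part (Q *m N *m P)).
Proof.
move=> XS MS NS P Q.
have Qu : Q \in unitmx by exact: skew_hermitian_unit.
have Pu : P \in unitmx.
  by rewrite /P -[X]opprK; apply: skew_hermitian_unit; rewrite adjmxN XS.
have PQ : P *m Q = Q *m P.
  rewrite /P [LHS]mulmxDl [RHS]mulmxBl !mul1mx /Q mulmxBr mulmxDr !mulmx1.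
  by rewrite opprD !addrA subrK addrK.
have Pt : P^t* = Q by rewrite /P adjmxD adjmx1 XS.
have Qt : Q^t* = P by rewrite /Q adjmxB adjmx1 XS opprK.
clearbody P Q; pose U := P *m invmx Q.
have Ut : U^t* = invmx P *m Q by rewrite /U adjmx_mul trmx_inv map_invmx Qt Pt.
have UU : U \is unitarymx.
  apply/unitarymxP; rewrite Ut /U.
  have ic : invmx Q *m invmx P = invmx P *m invmx Q.
    apply: (can_inj (mulKmx Qu)); apply: (can_inj (mulKmx Pu)).
    rewrite mulKVmx // mulmxV // [Q *m (_ *m _)]mulmxA [P *m (_ *m _)]mulmxA.
    by rewrite [P *m (Q *m _)]mulmxA PQ mulmxK // mulmxV.
  by rewrite mulmxA -(mulmxA P) ic mulmxA mulmxV // mul1mx mulVmx.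
have sk L : L^t* = - L -> (Q *m L *m P)^t* = - (Q *m L *m P).
  by move=> LS; rewrite !adjmx_mul LS Pt Qt mulNmx mulmxN mulmxA.
have cE L : U *m (Q *m L *m P) *m U^t* = P *m L *m Q.
  by rewrite Ut /U !mulmxA mulmxKV // mulmxK.
by rewrite -(ip_unitary_conj UU (sk M MS) (sk N NS)) !cE.
Qed.

Lemma su_ip_br X Y W : ip (br X Y) W = ip X (br Y W).
Proof.
set A := mx Y.
(* The odd part in s of ip_cayley for the scalars s = 1, 2 kills the cubic term. *)
have AS : A^t* = - A by exact: mx_skew.
pose a1 L := br Y L; pose a2 L := su_part (A *m mx L *m A).
have skAA L : (A *m mx L *m A)^t* = - (A *m mx L *m A).
  by rewrite !adjmx_mul mx_skew AS !(mulmxN, mulNmx) !opprK mulmxA.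
have poly (s : R) L : (1%:M + s%:C *: A) *m mx L *m (1%:M - s%:C *: A) =
    (- s ^+ 2)%:C *: (A *m mx L *m A) + (s%:C *: mx (br Y L) + mx L).
  rewrite brE /comm_br -/A rmorphN rmorphXn /= scalerBr.
  rewrite mulmxDl mul1mx mulmxBr mulmx1 -scalemxAl -scalemxAr mulmxDl -scalemxAl.
  move: (mx L) (A *m mx L *m A) (A *m mx L) (mx L *m A) => L0 L1 L2 L3.
  apply/matrixP => i k; rewrite !mxE; ring.
have expand (s : R) L :
    su_part ((1%:M + s%:C *: A) *m mx L *m (1%:M - s%:C *: A)) =
    L + s *: a1 L - (s ^+ 2) *: a2 L.
  rewrite poly !su_part_linear ?mx_skew //; last first.
    rewrite -mxZ -mxD mx_skew //.
  rewrite !su_part_mx scaleNr addrC [_ + L]addrC //.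
have AsS (s : R) : (s%:C *: A)^t* = - (s%:C *: A).
  have aR : (s%:C)^* = s%:C by rewrite conj_Creal // complex_real.
  by rewrite adjmxZ aR AS scalerN.
have key (s : R) : ip (X + s *: a1 X - (s ^+ 2) *: a2 X) (W + s *: a1 W - (s ^+ 2) *: a2 W) =
    ip (X - s *: a1 X - (s ^+ 2) *: a2 X) (W - s *: a1 W - (s ^+ 2) *: a2 W).
  rewrite -!expand (ip_cayley (AsS s)) ?mx_skew //.
  have eN : 1%:M - s%:C *: A = 1%:M + (- s)%:C *: A by rewrite rmorphN scaleNr.
  have eN' : 1%:M + s%:C *: A = 1%:M - (- s)%:C *: A by rewrite rmorphN scaleNr opprK.
  by rewrite eN eN' !expand sqrrN !scaleNr.
have := key 1; have := key 2.
rewrite !(ipDl ip_sp, ipZl ip_sp, ipNl ip_sp, ipDr ip_sp, ipZr ip_sp, ipNr ip_sp).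
rewrite /a1 [br X Y]brC (ipNl ip_sp); lra.
Qed.

Lemma su_metric_lie_algebra : metric_lie_algebra br ip.
Proof. by split=> //; exact: su_ip_br. Qed.

Lemma su_Ad_isometric_automorphism A : special_unitary A ->
  isometric_automorphism br ip (Ad A).
Proof. by move=> AS; split=> [|X Y|X Y]; [exact: Ad_linear|exact: Ad_br|exact: ip_Ad]. Qed.

End BiinvariantForm.

(* The i-multiples in the formula turn the Hermitian parts of P and Q into
   skew-Hermitian ones. *)
Lemma su_part_comm (P Q : 'M[C]_n) : su_part (skew_part (comm_br P Q)) =
  2^-1 *: (br (su_part (skew_part P)) (su_part (skew_part Q))
    - br (su_part (skew_part ('i%C *: P))) (su_part (skew_part ('i%C *: Q)))).
Proof.
have ii : 'i%C * 'i%C = -1 :> C.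
  by apply/eqP; rewrite eq_complex /=; apply/andP; split; apply/eqP; ring.
have iC : ('i%C : C)^* = - 'i%C by rewrite complexiE conjCi.
have skI (M : 'M[C]_n) : skew_part ('i%C *: M) = 'i%C *: (M + M^t*).
  by rewrite /skew_part adjmxZ iC scaleNr opprK scalerDr.
have commI (U V : 'M[C]_n) : comm_br ('i%C *: U) ('i%C *: V) = - comm_br U V.
  rewrite /comm_br -!scalemxAl -!scalemxAr !scalerA ii -scalerBr scaleN1r //.
have tr_comm (U V : 'M[C]_n) : \tr (comm_br U V) = 0.
  by rewrite /comm_br raddfB /= mxtrace_mulC subrr.
have comm_tl (U V : 'M[C]_n) : comm_br (traceless_part U) (traceless_part V) = comm_br U V.
  by rewrite comm_traceless_part comm_brC comm_traceless_part -comm_brC.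
apply: mx_inj; rewrite mxZ mxD mxN !brE !su_partE ?skew_part_skew // !comm_tl.
rewrite !skI commI opprK /traceless_part /skew_part.
have -> : \tr (comm_br P Q - (comm_br P Q)^t*) = 0.
  by rewrite raddfB /= adjmx_trace tr_comm rmorph0 subr0.
rewrite mul0r raddf0 subr0.
have -> : (comm_br P Q)^t* = comm_br (Q^t*) (P^t*) by rewrite /comm_br adjmxB !adjmx_mul.
move: (P^t*) (Q^t*) => P' Q'; rewrite /comm_br.
rewrite !(mulmxDl, mulmxDr, mulNmx, mulmxN).
have -> : (2^-1)%:C = 2^-1 :> C by rewrite fmorphV rmorph_nat.
move: (P *m Q) (Q *m P) (Q' *m P') (P' *m Q') (P *m Q') (P' *m Q) (Q *m P') (Q' *m P).
by move=> A1 A2 A3 A4 A5 A6 A7 A8; apply/matrixP => i k; rewrite !mxE; field.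
Qed.

(* n M is the sum of the commutators of E_ik and E_ki M if M is traceless. *)
Lemma su_perfect (f : S -> R) : (forall a X Y, f (a *: X + Y) = a * f X + f Y) ->
  (forall X Y, f (br X Y) = 0) -> forall X, f X = 0.
Proof.
move=> fl fbr X.
have f0 : f 0 = 0 by have := fl (-1) 0 0; rewrite scaler0 addr0 mulN1r addNr.
have fZ a Y : f (a *: Y) = a * f Y by have := fl a Y 0; rewrite f0 !addr0.
pose g M := f (su_part (skew_part M)).
have gl (a : R) M N : g (a%:C *: M + N) = a * g M + g N.
  by rewrite /g su_part_scale_linear fl.
have g0 : g 0 = 0 by have := gl (-1) 0 0; rewrite scaler0 addr0 mulN1r addNr.
have gZ (a : R) M : g (a%:C *: M) = a * g M by have := gl a M 0; rewrite g0 !addr0.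
have gD M N : g (M + N) = g M + g N by have := gl 1 M N; rewrite scale1r mul1r.
have g_comm P Q : g (comm_br P Q) = 0.
  rewrite /g su_part_comm fZ addrC -scaleN1r fl !fbr !mulr0 addr0 mulr0 //.
have gX : g (mx X) = 2 * f X.
  rewrite /g /skew_part mx_skew opprK -[_ + _]addr0.
  have -> : mx X + mx X + 0 = mx (2 *: X) by rewrite addr0 -mulr2n -scaler_nat mxZ rmorph_nat.
  by rewrite su_part_mx fZ.
have nX : n%:R *: mx X = \sum_(r : 'I_n * 'I_n)
    comm_br (delta_mx r.1 r.2) (delta_mx r.2 r.1 *m mx X).
  rewrite -(pair_bigA _ (fun i k => comm_br (delta_mx i k) (delta_mx k i *m mx X))) /=.
  have cE i k : comm_br (delta_mx i k) (delta_mx k i *m mx X) =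
      delta_mx i i *m mx X - mx X i i *: delta_mx k k.
    rewrite /comm_br mulmxA mul_delta_mx; congr (_ - _).
    apply/matrixP => a b; rewrite -[delta_mx k i]mulmx1 -[_ *m mx X]mulmxA mul1mx.
    rewrite mxE (bigD1 i) //= big1 ?addr0 => [|l li].
      rewrite !mxE (bigD1 i) //= big1 ?addr0 => [|l li].
        by rewrite !mxE !eqxx /= andbT; case: eqP; case: eqP; rewrite ?mulr1 ?mulr0 ?mul1r ?mul0r.
      by rewrite mxE (negPf li) andbF mul0r.
    by rewrite [delta_mx i k _ _]mxE (negPf li) mulr0.
  under eq_bigr do (under eq_bigr do rewrite cE; rewrite sumrB sumr_const card_ord -scaler_sumr).
  rewrite sumrB -scaler_suml -/(\tr (mx X)) mx_tr scale0r subr0 sumrMnl scaler_nat.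
  by rewrite -mulmx_suml -mx1_sum_delta mul1mx.
have : g (n%:R *: mx X) = 0.
  by rewrite nX (big_morph g gD g0) big1 // => r _; exact: g_comm.
have -> : (n%:R : C) = (n%:R : R)%:C by rewrite rmorph_nat.
rewrite gZ gX => /eqP; rewrite !mulf_eq0 !pnatr_eq0 (negPf (lt0n_neq0 n_gt0)) /=.
by move=> /eqP.
Qed.

End SpecialUnitaryAlgebra.

(** * The five constructions *)

Lemma conj_mx_mul (T : comUnitRingType) n (A X Y : 'M[T]_n) : A \in unitmx ->
  conj_mx A X *m conj_mx A Y = conj_mx A (X *m Y).
Proof. by move=> Au; rewrite /conj_mx !mulmxA mulmxKV. Qed.

(** The expansion of the trace contains 2 tr (X1^2 X2^2), to which [mxtrace_sq_sq] applies as it did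
    for ad. Integer parameters of the pencil make sense over the reals and over the complex numbers
    alike. *)
Lemma trace_sq_sum_sq (T : numFieldType) n (X1 X2 Y1 Y2 : 'M[T]_n) :
  (forall a : int, exists2 A, A \in unitmx &
     Y1 + a%:~R *: Y2 = conj_mx A (X1 + a%:~R *: X2)) ->
  (exists2 A, A \in unitmx & Y2 = conj_mx A X2) ->
  \tr (comm_br X1 X2 *m comm_br X1 X2) = \tr (comm_br Y1 Y2 *m comm_br Y1 Y2) ->
  \tr ((X1 ^+ 2 + X2 ^+ 2) ^+ 2) = \tr ((Y1 ^+ 2 + Y2 ^+ 2) ^+ 2).
Proof.
move=> pencil [A2 A2u Y2E] c2.
pose t4 (A : 'M[T]_n) := \tr (A *m A *m (A *m A)).
have t4c A X : A \in unitmx -> t4 (conj_mx A X) = t4 X.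
  by move=> Au; rewrite /t4 (conj_mx_mul X X Au) conj_mx_trace.
have t4p (a : int) : t4 (Y1 + a%:~R *: Y2) = t4 (X1 + a%:~R *: X2).
  by have [A Au ->] := pencil a; rewrite t4c.
have t42 : t4 Y2 = t4 X2 by rewrite Y2E t4c.
have sqE (A B : 'M[T]_n) : \tr ((A ^+ 2 + B ^+ 2) ^+ 2) *+ 6 =
    t4 A *+ 4 + t4 B *+ 4 + t4 (A + 1 *: B) + t4 (A + (-1) *: B)
    - \tr (comm_br A B *m comm_br A B) *+ 2.
  have := mxtrace_sq_sq A B; rewrite /= scale1r scaleN1r -!/(t4 _) => e.
  have -> : \tr ((A ^+ 2 + B ^+ 2) ^+ 2) = t4 A + \tr (A *m A *m (B *m B)) *+ 2 + t4 B.
    rewrite !expr2 -[_ * _]/((A *m A + B *m B) *m (A *m A + B *m B)).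
    rewrite mulmxDl !mulmxDr !mxtraceD (mxtrace_mulC (B *m B)) /t4; ring.
  have -> : (t4 A + \tr (A *m A *m (B *m B)) *+ 2 + t4 B) *+ 6 =
    t4 A *+ 6 + t4 B *+ 6 + \tr (A *m A *m (B *m B)) *+ 12 by ring.
  by rewrite e; ring.
have t41 : t4 Y1 = t4 X1 by have := t4p 0; rewrite mulr0z !scale0r !addr0.
have t4D := t4p 1; have t4B := t4p (-1); rewrite mulrNz mulr1z in t4B.
apply: (pmulrnI (n := 6)) => //.
by rewrite !sqE c2 t4D t4B t41 t42.
Qed.

(** * From the variation formula to nonconstancy *)

Section Nonconstancy.
Variables (R : realType) (eps : R) (F : metric_family R) (Z1 Z2 : torus_alg F).
Local Notation br := (@bracket R F).
Local Notation g0 := (@base_metric R F).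
Local Notation incl := (@torus_incl R F).
Local Notation jm := (@j_map R F).
Hypothesis eps_gt0 : 0 < eps.
Hypothesis mla : metric_lie_algebra br g0.
Hypothesis incl_linear : linear incl.
Hypothesis Z_on : orthonormal_basis (@torus_metric R F) [:: Z1; Z2].
Hypothesis j_linear : forall t, linear (jm t).
Hypothesis incl_abelian : forall Y Z, br (incl Y) (incl Z) = 0.
Hypothesis br_j_incl : forall u Y Z, br (jm u Y) (incl Z) = 0.
Hypothesis ip_j_incl : forall u Y Z, g0 (jm u Y) (incl Z) = 0.
Hypothesis isospectral : forall s t, inI eps s -> inI eps t -> forall Z, exists f,
  [/\ isometric_automorphism br g0 f, forall Y, f (incl Y) = incl Y
    & f (jm s Z) = jm t Z].
(** [q] stands for the trace in the admissibility condition, which is real for so(m) and complex for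
    su(m). *)
Variables (T : Type) (q : R -> T).
Hypothesis q_nonconstant : nonconstant_near0 eps q.
Hypothesis killing_q : forall s t, inI eps s -> inI eps t ->
  killing br (br (jm t Z1) (jm t Z2)) (br (jm t Z1) (jm t Z2))
    = killing br (br (jm s Z1) (jm s Z2)) (br (jm s Z1) (jm s Z2)) -> q s = q t.

(** If the norms agreed at two parameters with different [q], the variation formula would make the
    Killing squares of [j_1, j_2] agree there, and with them [q]. *)
Lemma ricci_norm2_nonconstant : exists s t : R,
  - eps < s < eps /\ - eps < t < eps /\ ricci_norm2 F s <> ricci_norm2 F t.
Proof.
have [|||//|s [t [sI [tI qst]]]] := q_nonconstant (a := - eps) (b := eps) => //.
  by rewrite oppr_lt0.
exists s, t; split=> //; split=> // nst; apply: qst; apply: killing_q => //.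
have := ricci_norm2_variation mla incl_linear Z_on (j_linear s) (j_linear t)
  incl_abelian br_j_incl ip_j_incl (isospectral sI tI).
rewrite nst subrr; lra.
Qed.

End Nonconstancy.

(** * Products with a torus *)

Section ProductAlgebra.
Variables (R : realType) (V W : vectType R) (br : V -> V -> V).
Variables (ipV : V -> V -> R) (ipW : W -> W -> R).
Hypothesis mla : metric_lie_algebra br ipV.
Hypothesis ipW_sp : scalar_product ipW.
Let ipV_sp : scalar_product ipV. Proof. by case: mla. Qed.
Local Notation pbr := (@prod_br R V W br).
Local Notation pip := (prod_ip ipV ipW).

Lemma prod_ip_sp : scalar_product pip.
Proof.
split=> [a x y z|x y|[x1 x2] x0]; rewrite /prod_ip /=.
- rewrite (ip_l_linear ipV_sp) (ip_l_linear ipW_sp); ring.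
- by rewrite (ip_sym ipV_sp) (ip_sym ipW_sp).
have ge (U : vectType R) (ip : U -> U -> R) (x : U) : scalar_product ip -> 0 <= ip x x.
  move=> sp; have [->|xN0] := eqVneq x 0; first by rewrite (ip0l sp).
  by case: sp => _ _ /(_ x xN0)/ltW.
have [x10|x1N0] := eqVneq x1 0; last first.
  by case: (ipV_sp) => _ _ /(_ x1 x1N0) p; rewrite ltr_wpDr // ge.
have x2N0 : x2 != 0 by apply: contra x0 => /eqP->; rewrite x10.
by case: (ipW_sp) => _ _ /(_ x2 x2N0) p; rewrite ltr_wpDl // ge.
Qed.

Lemma prod_metric_lie_algebra : metric_lie_algebra pbr pip.
Proof.
split; first exact: prod_ip_sp; rewrite /prod_br.
- move=> a x y z; rewrite (br_linear_l mla); congr pair.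
  by rewrite /= scaler0 addr0.
- by move=> x y; rewrite (brC mla); congr pair; rewrite /= oppr0.
- by move=> x y z /=; rewrite (br_jacobi mla); congr pair; rewrite /= addr0.
by move=> x y z; rewrite /prod_ip /= (ip_br mla) (ip0l ipW_sp) (ip0r ipW_sp).
Qed.

Lemma prod_isometric_automorphism f : isometric_automorphism br ipV f ->
  isometric_automorphism pbr pip (fun x => (f x.1, x.2)).
Proof.
move=> [lf fbr fip]; split=> [a x y|x y|x y].
- by rewrite /= lf.
- by rewrite /prod_br /= fbr.
by rewrite /prod_ip /= fip.
Qed.

(** Brackets have no component in the abelian factor, which thus contributes nothing to the
    trace. *)
Lemma killing_prod x y : killing pbr x y = killing br x.1 y.1.
Proof.
pose I := ('I_(\dim {:V}) + 'I_(\dim {:W}))%type.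
pose p (i : I) (v : V * W) : R := match i with
  | inl a => coord (vbasis {:V}) a v.1 | inr a => coord (vbasis {:W}) a v.2 end.
pose u (i : I) : (V * W)%type := match i with
  | inl a => ((vbasis {:V})`_a, 0) | inr a => (0, (vbasis {:W})`_a) end.
have pl i a v w : p i (a *: v + w) = a * p i v + p i w.
  by case: i => i; rewrite /p linearP.
have pu v : v = \sum_i p i v *: u i.
  rewrite big_sumType /=.
  have s1 n (F : 'I_n -> V) (c : 'I_n -> R) :
      \sum_i c i *: ((F i, 0) : V * W) = (\sum_i c i *: F i, 0).
    by elim/big_rec2: _ => [|i a b _ ->] //; congr pair; rewrite /= scaler0 addr0.
  have s2 n (F : 'I_n -> W) (c : 'I_n -> R) :
      \sum_i c i *: ((0, F i) : V * W) = (0, \sum_i c i *: F i).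
    by elim/big_rec2: _ => [|i a b _ ->] //; congr pair; rewrite /= scaler0 addr0.
  by rewrite s1 s2 -!vbasis_sum; case: v => a b; congr pair; rewrite /= ?addr0 ?add0r.
have ll : linear (fun v => pbr x (pbr y v)).
  have m := prod_metric_lie_algebra.
  by move=> a v w; rewrite (br_linear m y) (br_linear m x).
rewrite /killing (endo_trace_frame pl pu ll) big_sumType /=.
by rewrite [X in _ + X]big1 ?addr0 // => i _; rewrite linear0.
Qed.

End ProductAlgebra.

Lemma natr_double_inj (R : numFieldType) n (x y : R) : (0 < n)%N ->
  n%:R * x *+ 2 = n%:R * y *+ 2 -> x = y.
Proof.
move=> n0 /(pmulrnI (isT : (0 < 2)%N))/mulfI; apply.
by rewrite pnatr_eq0 -lt0n.
Qed.

Section SpecialUnitaryInstance.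
Variables (R : realType) (n : nat).
Hypothesis n_gt0 : (0 < n)%N.
Local Notation su := (su R n).

Lemma su_mx_inj : injective (@su_mx R n). Proof. exact: val_inj. Qed.
Lemma su_mxD (X Y : su) : su_mx (X + Y) = su_mx X + su_mx Y. Proof. by []. Qed.
Lemma su_mxZ (a : R) (X : su) : su_mx (a *: X) = a%:C *: su_mx X. Proof. by []. Qed.

Lemma su_mx_comb (a : int) (X Y : su) :
  su_mx (X + a%:~R *: Y) = su_mx X + a%:~R *: su_mx Y.
Proof. by rewrite su_mxD su_mxZ rmorph_int. Qed.

Lemma su_br_metric_lie_algebra ip : su_biinvariant ip ->
  metric_lie_algebra (@su_br R n) ip.
Proof.
case=> ip_sp ip_Ad; exact: (su_metric_lie_algebra n_gt0 su_mx_inj su_mxD su_mxZ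
  (@su_skew R n) (@su_traceless R n) (@mk_suK R n) (@su_brE R n) ip_sp ip_Ad).
Qed.

Lemma su_Ad_aut ip A : su_biinvariant ip -> special_unitary A ->
  isometric_automorphism (@su_br R n) ip (@su_Ad R n A).
Proof.
case=> ip_sp ip_Ad; exact: (su_Ad_isometric_automorphism su_mx_inj su_mxD su_mxZ
  (@su_skew R n) (@su_traceless R n) (@mk_suK R n) (@su_brE R n) ip_Ad).
Qed.

Lemma su_br_killing X : killing (@su_br R n) X X =
  n%:R * complex.Re (\tr (su_mx X *m su_mx X)) *+ 2.
Proof.
exact: (su_killing n_gt0 su_mx_inj su_mxD su_mxZ
  (@su_skew R n) (@su_traceless R n) (@mk_suK R n) (@su_brE R n)).
Qed.

Lemma su_killing_comm (X Y : su) : killing (@su_br R n) (su_br X Y) (su_br X Y) =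
  n%:R * complex.Re (\tr (comm_br (su_mx X) (su_mx Y) *m comm_br (su_mx X) (su_mx Y))) *+ 2.
Proof. by rewrite su_br_killing su_brE. Qed.

Lemma su_br_perfect (f : su -> R) : (forall a X Y, f (a *: X + Y) = a * f X + f Y) ->
  (forall X Y, f (su_br X Y) = 0) -> forall X, f X = 0.
Proof.
exact: (su_perfect n_gt0 su_mx_inj su_mxD su_mxZ
  (@su_skew R n) (@su_traceless R n) (@mk_suK R n) (@su_brE R n)).
Qed.

Lemma skew_hermitian_trace_sq (M : 'M[R[i]]_n) : M^t* = - M ->
  complex.Im (\tr (M *m M)) = 0.
Proof.
move=> MS; set z := \tr _; have : z^* = z.
  by rewrite /z -adjmx_trace adjmx_mul MS mulmxN mulNmx opprK.
case: z => a b /eqP; rewrite eq_complex /= => /andP[_ /eqP].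
by move/esym/opp_self_eq0.
Qed.

(** The Killing form of su(n) yields only the real part of the trace, whereas admissibility concerns
    the complex trace; for squares of skew-Hermitian matrices there is no imaginary part. *)
Lemma skew_hermitian_trace_sq_inj (M N : 'M[R[i]]_n) : M^t* = - M -> N^t* = - N ->
  complex.Re (\tr (M *m M)) = complex.Re (\tr (N *m N)) ->
  \tr (M *m M) = \tr (N *m N).
Proof.
move=> /skew_hermitian_trace_sq + /skew_hermitian_trace_sq.
by case: (\tr _) => a b; case: (\tr _) => a' b' /= -> -> ->.
Qed.

Lemma su_comm_skew (X Y : su) :
  (comm_br (su_mx X) (su_mx Y))^t* = - comm_br (su_mx X) (su_mx Y).
Proof. by rewrite -su_brE su_skew. Qed.

End SpecialUnitaryInstance.

Section AdmissibleTraces.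
Variables (R : realType) (eps : R) (h : vectType R) (Z1 Z2 : h) (m : nat).

Lemma so_admissible_trace (j : R -> 'Hom(h, so R m)) s t :
    so_admissible eps Z1 Z2 j -> inI eps s -> inI eps t ->
    let c u := so_mx (so_br (j u Z1) (j u Z2)) in
    \tr (c t *m c t) = \tr (c s *m c s) ->
  \tr ((so_mx (j s Z1) ^+ 2 + so_mx (j s Z2) ^+ 2) ^+ 2) =
  \tr ((so_mx (j t Z1) ^+ 2 + so_mx (j t Z2) ^+ 2) ^+ 2).
Proof.
move=> [_ iso _] sI tI; rewrite /= !so_brE => c2.
apply: trace_sq_sum_sq => [a||//].
  have [A AO] := iso s t sI tI (Z1 + a%:~R *: Z2).
  have jE u : j u (Z1 + a%:~R *: Z2) = j u Z1 + a%:~R *: j u Z2.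
    by rewrite linearD linearZ.
  rewrite !jE !so_mxD !so_mxZ; exists A => //; exact: orthogonal_unit.
have [A AO ->] := iso s t sI tI Z2.
by exists A => //; exact: orthogonal_unit.
Qed.

Lemma su_admissible_trace (j : R -> 'Hom(h, su R m)) s t :
    su_admissible eps Z1 Z2 j -> inI eps s -> inI eps t ->
    let c u := comm_br (su_mx (j u Z1)) (su_mx (j u Z2)) in
    complex.Re (\tr (c t *m c t)) = complex.Re (\tr (c s *m c s)) ->
  \tr ((su_mx (j s Z1) ^+ 2 + su_mx (j s Z2) ^+ 2) ^+ 2) =
  \tr ((su_mx (j t Z1) ^+ 2 + su_mx (j t Z2) ^+ 2) ^+ 2).
Proof.
move=> [_ iso _] sI tI c /(skew_hermitian_trace_sq_inj (su_comm_skew _ _) (su_comm_skew _ _)) c2.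
apply: trace_sq_sum_sq; last exact: esym c2.
  move=> a.
  have [A [AU _] AE] := iso s t sI tI (Z1 + a%:~R *: Z2).
  have jE u : su_mx (j u (Z1 + a%:~R *: Z2)) = su_mx (j u Z1) + a%:~R *: su_mx (j u Z2).
    by rewrite linearD linearZ; exact: su_mx_comb.
  exists A; first exact: unitarymx_unit.
  exact: etrans (esym (jE t)) (etrans AE (congr1 (conj_mx A) (jE s))).
have [A [AU _] AE] := iso s t sI tI Z2.
by exists A; first exact: unitarymx_unit.
Qed.

End AdmissibleTraces.

Section Families.
Variables (R : realType) (eps : R).
Hypothesis eps_gt0 : 0 < eps.
Local Notation nonconstant F := (exists s t : R, - eps < s < eps /\ - eps < t < eps /\
  ricci_norm2 F s <> ricci_norm2 F t).

Lemma familyA_nonconstant m (h : vectType R) gS gH (j : R -> 'Hom(h, so R m)) (Z1 Z2 : h) :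
  (5 <= m)%N -> so_biinvariant gS -> scalar_product gH ->
  orthonormal_basis (@torus_metric R (@familyA R m h gS gH j)) [:: Z1; Z2] ->
  so_admissible eps Z1 Z2 j -> nonconstant (@familyA R m h gS gH j).
Proof.
move=> m5 gSb gHsp Zon adm.
have mS := so_metric_lie_algebra gSb m5.
have gSsp : scalar_product gS by case: gSb.
have mla := prod_metric_lie_algebra mS gHsp.
have [_ iso nonc] := adm.
apply: (ricci_norm2_nonconstant (F := familyA gS gH j) eps_gt0 mla _ Zon _ _ _ _ _ nonc) => /=.
- by move=> a Y Z; congr pair; rewrite /= scaler0 addr0.
- by move=> t a Y Z; congr pair; rewrite ?linearP //= scaler0 addr0.
- by move=> Y Z; rewrite /prod_br /= (br0l mS).
- by move=> u Y Z; rewrite /prod_br /= (br0r mS).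
- by move=> u Y Z; rewrite /prod_ip /= (ip0r gSsp) (ip0l gHsp) addr0.
- move=> s t sI tI Z; have [A AO AE] := iso s t sI tI Z.
  exists (fun x => (so_Ad A x.1, x.2)); split=> [|Y|] /=.
  + exact: prod_isometric_automorphism (so_Ad_isometric_automorphism gSb m5 AO).
  + by congr pair; exact: linear_fun0 (so_Ad_linear AO).
  by congr pair; apply: so_mx_inj; rewrite so_AdE.
move=> s t sI tI; rewrite !(killing_prod mS gHsp) /= !so_killing => /mulfI e.
apply: (so_admissible_trace adm sI tI); apply: e.
by rewrite subr_eq0 eqr_nat; apply/eqP => m2; move: m5; rewrite m2.
Qed.

Lemma familyB_nonconstant m (h : vectType R) gS gH (j : R -> 'Hom(h, su R m)) (Z1 Z2 : h) :
  (3 <= m)%N -> su_biinvariant gS -> scalar_product gH ->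
  orthonormal_basis (@torus_metric R (@familyB R m h gS gH j)) [:: Z1; Z2] ->
  su_admissible eps Z1 Z2 j -> nonconstant (@familyB R m h gS gH j).
Proof.
move=> m3 gSb gHsp Zon adm.
have m0 : (0 < m)%N by exact: leq_trans m3.
have mS := su_br_metric_lie_algebra m0 gSb.
have gSsp : scalar_product gS by case: gSb.
have mla := prod_metric_lie_algebra mS gHsp.
have [_ iso nonc] := adm.
apply: (ricci_norm2_nonconstant (F := familyB gS gH j) eps_gt0 mla _ Zon _ _ _ _ _ nonc) => /=.
- by move=> a Y Z; congr pair; rewrite /= scaler0 addr0.
- by move=> t a Y Z; congr pair; rewrite ?linearP //= scaler0 addr0.
- by move=> Y Z; rewrite /prod_br /= (br0l mS).
- by move=> u Y Z; rewrite /prod_br /= (br0r mS).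
- by move=> u Y Z; rewrite /prod_ip /= (ip0r gSsp) (ip0l gHsp) addr0.
- move=> s t sI tI Z; have [A AS AE] := iso s t sI tI Z.
  have Af := su_Ad_aut gSb AS; have [Al _ _] := Af.
  exists (fun x => (su_Ad A x.1, x.2)); split=> [|Y|] /=.
  + exact: prod_isometric_automorphism Af.
  + by congr pair; exact: linear_fun0 Al.
  congr pair; apply: su_mx_inj; exact: etrans (su_AdE _ AS) (esym AE).
move=> s t sI tI e; apply: (su_admissible_trace adm sI tI).
pose b (X Y : su R m) := prod_br (@su_br R m) (X, 0 : h) (Y, 0).
have kE X Y := etrans (killing_prod mS gHsp (b X Y) (b X Y)) (su_killing_comm m0 X Y).
exact: (natr_double_inj m0 (etrans (esym (kE _ _)) (etrans e (kE _ _)))).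
Qed.

End Families.

(** * Block embeddings *)

Section BlockDiagonal.
Variables (T : comUnitRingType) (m n : nat).
Implicit Types (A X : 'M[T]_m) (Y : 'M[T]_n).

Definition diag2 X Y : 'M[T]_(m + n) := block_mx X 0 0 Y.

Lemma mul_diag2 X Y X' Y' : diag2 X Y *m diag2 X' Y' = diag2 (X *m X') (Y *m Y').
Proof. by rewrite mulmx_block !mul0mx !mulmx0 !addr0 add0r. Qed.

Lemma diag2B X Y X' Y' : diag2 X Y - diag2 X' Y' = diag2 (X - X') (Y - Y').
Proof. by rewrite opp_block_mx add_block_mx !oppr0 !addr0. Qed.

Lemma comm_diag2 X Y X' Y' :
  comm_br (diag2 X Y) (diag2 X' Y') = diag2 (comm_br X X') (comm_br Y Y').
Proof. by rewrite /comm_br !mul_diag2 diag2B. Qed.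

Lemma trace_diag2 X Y : \tr (diag2 X Y) = \tr X + \tr Y.
Proof. exact: mxtrace_block. Qed.

Lemma conj_diag2 A X Y : A \in unitmx ->
  conj_mx (diag2 A 1%:M) (diag2 X Y) = diag2 (conj_mx A X) Y.
Proof.
move=> Au; have BV : diag2 A 1%:M *m diag2 (invmx A) 1%:M = 1%:M.
  by rewrite mul_diag2 mulmxV // mulmx1 [RHS]scalar_mx_block.
have [Bu _] := mulmx1_unit BV.
have BI : invmx (diag2 A 1%:M) = diag2 (invmx A) 1%:M.
  by rewrite -[LHS]mulmx1 -BV mulKmx.
by rewrite /conj_mx BI !mul_diag2 mul1mx mulmx1.
Qed.

Lemma comm_br0r X : comm_br X 0 = 0. Proof. by rewrite /comm_br mulmx0 mul0mx subrr. Qed.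
Lemma comm_br0l X : comm_br 0 X = 0. Proof. by rewrite comm_brC comm_br0r oppr0. Qed.

End BlockDiagonal.

Section SpecialOrthogonalBlocks.
Variables (R : realType) (m n : nat).

Lemma orthogonal_diag2 (A : 'M[R]_m) : Defs.orthogonal A -> Defs.orthogonal (diag2 A (1%:M : 'M_n)).
Proof.
rewrite /Defs.orthogonal => AO.
by rewrite tr_block_mx !trmx0 trmx1 [LHS]mul_diag2 AO mulmx1 [RHS]scalar_mx_block.
Qed.

Lemma so_ul_linear : linear (@so_ul R m n).
Proof.
move=> a X Y; apply: so_mx_inj; rewrite so_mxD so_mxZ !so_ulE so_mxD so_mxZ.
by rewrite /corner_ul scale_block_mx add_block_mx !scaler0 !addr0.
Qed.

Lemma so_dr_linear : linear (@so_dr R m n).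
Proof.
move=> a X Y; apply: so_mx_inj; rewrite so_mxD so_mxZ !so_drE so_mxD so_mxZ.
by rewrite /corner_dr scale_block_mx add_block_mx !scaler0 !addr0.
Qed.

Lemma so_br_ul X Y : so_br (@so_ul R m n X) (so_ul n Y) = so_ul n (so_br X Y).
Proof.
by apply: so_mx_inj; rewrite so_brE !so_ulE so_brE [LHS]comm_diag2 comm_br0r.
Qed.

Lemma so_br_dr X Y : so_br (@so_dr R m n X) (so_dr m Y) = so_dr m (so_br X Y).
Proof.
by apply: so_mx_inj; rewrite so_brE !so_drE so_brE [LHS]comm_diag2 comm_br0r.
Qed.

Lemma so_killing_ul X : killing (@so_br R (m + n)) (so_ul n X) (so_ul n X) =
  ((m + n)%:R - 2) * \tr (so_mx X *m so_mx X).
Proof.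
rewrite so_killing so_ulE [corner_ul n _ *m _]mul_diag2 trace_diag2.
by rewrite mulmx0 mxtrace0 addr0.
Qed.

End SpecialOrthogonalBlocks.

Section SpecialUnitaryBlocks.
Variables (R : realType) (m n : nat).

Lemma special_unitary_diag2 (A : 'M[R[i]]_m) :
  special_unitary A -> special_unitary (diag2 A (1%:M : 'M_n)).
Proof.
move=> [/unitarymxP AU detA]; split.
  apply/unitarymxP; rewrite tr_block_mx map_block_mx !trmx0 !map_mx0 trmx1 map_mx1.
  by rewrite [LHS]mul_diag2 AU mulmx1 [RHS]scalar_mx_block.
by rewrite /diag2 det_ublock detA det1 mulr1.
Qed.

Lemma corner_ul_linear (a : R[i]) (X Y : 'M[R[i]]_m) :
  corner_ul n (a *: X + Y) = a *: corner_ul n X + corner_ul n Y.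
Proof. by rewrite /corner_ul scale_block_mx add_block_mx !scaler0 !addr0. Qed.

Lemma corner_dr_linear (a : R[i]) (X Y : 'M[R[i]]_n) :
  corner_dr m (a *: X + Y) = a *: corner_dr m X + corner_dr m Y.
Proof. by rewrite /corner_dr scale_block_mx add_block_mx !scaler0 !addr0. Qed.

Lemma su_ul_linear : linear (@su_ul R m n).
Proof.
move=> a X Y; apply: su_mx_inj; apply: etrans (su_ulE _ _) _.
apply: etrans (corner_ul_linear a%:C (su_mx X) (su_mx Y)) _.
exact: esym (congr2 (fun U V : 'M[R[i]]_(m + n) => a%:C *: U + V) (su_ulE n X) (su_ulE n Y)).
Qed.

Lemma su_dr_linear : linear (@su_dr R m n).
Proof.
move=> a X Y; apply: su_mx_inj; apply: etrans (su_drE _ _) _.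
apply: etrans (corner_dr_linear a%:C (su_mx X) (su_mx Y)) _.
exact: esym (congr2 (fun U V : 'M[R[i]]_(m + n) => a%:C *: U + V) (su_drE m X) (su_drE m Y)).
Qed.

Lemma su_br_ul X Y : su_br (@su_ul R m n X) (su_ul n Y) = su_ul n (su_br X Y).
Proof.
apply: su_mx_inj; apply: etrans (su_brE _ _) _.
apply: etrans (congr2 (@comm_br _ _) (su_ulE n X) (su_ulE n Y)) _.
apply: etrans (comm_diag2 _ _ _ _) _; rewrite comm_br0r.
exact: esym (etrans (su_ulE _ _) (congr1 (corner_ul n) (su_brE X Y))).
Qed.

Lemma su_br_dr X Y : su_br (@su_dr R m n X) (su_dr m Y) = su_dr m (su_br X Y).
Proof.
apply: su_mx_inj; apply: etrans (su_brE _ _) _.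
apply: etrans (congr2 (@comm_br _ _) (su_drE m X) (su_drE m Y)) _.
apply: etrans (comm_diag2 _ _ _ _) _; rewrite comm_br0r.
apply: esym; apply: etrans (su_drE m _) _.
by apply: (congr1 (fun M : 'M[R[i]]_n => diag2 0 M)); exact: su_brE.
Qed.

Lemma su_br_ul_dr X Y : su_br (@su_ul R m n X) (su_dr m Y) = 0.
Proof.
apply: su_mx_inj; apply: etrans (su_brE _ _) _.
apply: etrans (congr2 (@comm_br _ _) (su_ulE n X) (su_drE m Y)) _.
apply: etrans (comm_diag2 _ _ _ _) _; rewrite comm_br0r comm_br0l.
by rewrite /diag2 block_mx_const raddf0.
Qed.

Lemma su_Ad_ul A X : special_unitary A ->
  su_Ad (diag2 A 1%:M) (@su_ul R m n X) = su_ul n (su_Ad A X).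
Proof.
move=> AS; have [AU _] := AS.
apply: su_mx_inj; apply: etrans (su_AdE _ (special_unitary_diag2 AS)) _.
apply: etrans (congr1 (conj_mx _) (su_ulE n X)) _.
apply: etrans (conj_diag2 _ _ (unitarymx_unit AU)) _.
exact: esym (etrans (su_ulE _ _) (congr1 (corner_ul n) (su_AdE X AS))).
Qed.

Lemma su_Ad_dr A Y : special_unitary A ->
  su_Ad (diag2 A 1%:M) (@su_dr R m n Y) = su_dr m Y.
Proof.
move=> AS; have [AU _] := AS.
apply: su_mx_inj; apply: etrans (su_AdE _ (special_unitary_diag2 AS)) _.
apply: etrans (congr1 (conj_mx _) (su_drE m Y)) _.
apply: etrans (conj_diag2 _ _ (unitarymx_unit AU)) _.
rewrite /conj_mx mulmx0 mul0mx; exact: esym (su_drE m Y).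
Qed.

Lemma su_killing_ul_comm X Y : (0 < m)%N ->
  let c := su_ul n (su_br X Y) in killing (@su_br R (m + n)) c c = (m + n)%:R *
  complex.Re (\tr (comm_br (su_mx X) (su_mx Y) *m comm_br (su_mx X) (su_mx Y))) *+ 2.
Proof.
move=> m0 c; have cE : su_mx c = corner_ul n (comm_br (su_mx X) (su_mx Y)).
  exact: etrans (su_ulE _ _) (congr1 (corner_ul n) (su_brE X Y)).
rewrite su_br_killing ?addn_gt0 ?m0 // cE [corner_ul n _ *m _]mul_diag2 trace_diag2.
by rewrite mulmx0 mxtrace0 addr0.
Qed.

End SpecialUnitaryBlocks.

Section Families.
Variables (R : realType) (eps : R).
Hypothesis eps_gt0 : 0 < eps.
Local Notation nonconstant F := (exists s t : R, - eps < s < eps /\ - eps < t < eps /\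
  ricci_norm2 F s <> ricci_norm2 F t).

Lemma familyC_nonconstant m g0 (h : {vspace so R 4}) (j : R -> 'Hom(subvs_of h, so R m))
    (Z1 Z2 : subvs_of h) :
  (5 <= m)%N -> so_biinvariant g0 -> maximal_torus_alg (@so_br R 4) h ->
  orthonormal_basis (@torus_metric R (@familyC R m g0 h j)) [:: Z1; Z2] ->
  so_admissible eps Z1 Z2 j -> nonconstant (@familyC R m g0 h j).
Proof.
move=> m5 g0b [abel _] Zon adm.
have m45 : (5 <= m + 4)%N by exact: leq_trans m5 (leq_addr _ _).
have mla := so_metric_lie_algebra g0b m45.
have [c ipE] := so_biinvariant_form g0b m45.
have [_ iso nonc] := adm.
apply: (ricci_norm2_nonconstant (F := familyC g0 j) eps_gt0 mla _ Zon _ _ _ _ _ nonc) => /=.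
- by move=> a Y Z; rewrite linearP so_dr_linear.
- by move=> t a Y Z; rewrite linearP so_ul_linear.
- move=> Y Z; rewrite so_br_dr abel ?subvsP //; exact: linear_fun0 (@so_dr_linear R m 4).
- move=> u Y Z; apply: so_mx_inj; rewrite so_brE so_ulE so_drE.
  by rewrite [LHS]comm_diag2 comm_br0l comm_br0r /diag2 block_mx_const raddf0.
- move=> u Y Z; rewrite ipE so_ulE so_drE [corner_ul _ _ *m _]mul_diag2.
  by rewrite mulmx0 mul0mx trace_diag2 !mxtrace0 addr0 mulr0.
- move=> s t sI tI Z; have [A AO AE] := iso s t sI tI Z.
  (* The block matrix may have determinant -1; it still acts isometrically, since [g0] is a multiple
     of the trace form. *)
  have BO := @orthogonal_diag2 R m 4 A AO; have Au := orthogonal_unit AO.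
  exists (so_Ad (diag2 A 1%:M)); split=> [|Y|] /=.
  + exact: so_Ad_isometric_automorphism.
  + apply: so_mx_inj; rewrite so_AdE // so_drE [LHS]conj_diag2 //.
    by rewrite /conj_mx mulmx0 mul0mx.
  by apply: so_mx_inj; rewrite so_AdE // !so_ulE [LHS]conj_diag2 // AE.
move=> s t sI tI; rewrite !so_br_ul !so_killing_ul => /mulfI e.
apply: (so_admissible_trace adm sI tI); apply: e.
rewrite subr_eq0 eqr_nat; apply/eqP => m2; move: m45; by rewrite m2.
Qed.

Lemma familyD_nonconstant m g0 (h : {vspace su R 3}) (j : R -> 'Hom(subvs_of h, su R m))
    (Z1 Z2 : subvs_of h) :
  (3 <= m)%N -> su_biinvariant g0 -> maximal_torus_alg (@su_br R 3) h ->
  orthonormal_basis (@torus_metric R (@familyD R m g0 h j)) [:: Z1; Z2] ->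
  su_admissible eps Z1 Z2 j -> nonconstant (@familyD R m g0 h j).
Proof.
move=> m3 g0b [abel _] Zon adm.
have m0 : (0 < m)%N by exact: leq_trans m3.
have mn0 : (0 < m + 3)%N by rewrite addn_gt0 m0.
have mla := su_br_metric_lie_algebra mn0 g0b.
have g0sp : scalar_product g0 by case: g0b.
have [_ iso nonc] := adm.
apply: (ricci_norm2_nonconstant (F := familyD g0 j) eps_gt0 mla _ Zon _ _ _ _ _ nonc) => /=.
- by move=> a Y Z; rewrite linearP su_dr_linear.
- by move=> t a Y Z; rewrite linearP su_ul_linear.
- move=> Y Z; apply: etrans (su_br_dr m _ _) _.
  rewrite abel ?subvsP //; exact: linear_fun0 (@su_dr_linear R m 3).
- by move=> u Y Z; exact: su_br_ul_dr.
(* The blocks commute, so ad-invariance makes the second block orthogonal to all commutators of the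
   first, and these span su(m). *)
- move=> u Y Z; pose f X := g0 (su_ul 3 X) (su_dr m (vsval Z)).
  apply: (su_br_perfect m0 (f := f)) => [a X X'|X X'].
    by rewrite /f su_ul_linear (ip_l_linear g0sp).
  by rewrite /f -su_br_ul (ip_br mla) su_br_ul_dr (ip0r g0sp).
- move=> s t sI tI Z; have [A AS AE] := iso s t sI tI Z.
  exists (su_Ad (diag2 A 1%:M)); split=> [|Y|] /=.
  + exact: su_Ad_aut g0b (special_unitary_diag2 3 AS).
  + exact: su_Ad_dr.
  apply: etrans (su_Ad_ul 3 _ AS) _; congr su_ul.
  apply: su_mx_inj; exact: etrans (su_AdE _ AS) (esym AE).
move=> s t sI tI e; apply: (su_admissible_trace adm sI tI).
pose kil c := killing (@su_br R (m + 3)) c c.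
have kE X Y := etrans (congr1 kil (su_br_ul 3 X Y)) (su_killing_ul_comm 3 X Y m0).
exact: (natr_double_inj mn0 (etrans (esym (kE _ _)) (etrans e (kE _ _)))).
Qed.

End Families.

(** * Realification of complex matrices *)

Section Realify.
Variables (R : realType) (m : nat).
Local Notation C := (R[i]).
Implicit Types A X Y : 'M[C]_m.

Lemma cmx_Re_mul X Y : cmx_Re (X *m Y) = cmx_Re X *m cmx_Re Y - cmx_Im X *m cmx_Im Y.
Proof.
apply/matrixP => i k; rewrite !mxE Re_sum -sumrB; apply: eq_bigr => l _.
by rewrite !mxE; case: (X i l) (Y l k) => [a b] [c d].
Qed.

Lemma cmx_Im_mul X Y : cmx_Im (X *m Y) = cmx_Re X *m cmx_Im Y + cmx_Im X *m cmx_Re Y.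
Proof.
apply/matrixP => i k; rewrite !mxE Im_sum -big_split; apply: eq_bigr => l _.
by rewrite !mxE; case: (X i l) (Y l k) => [a b] [c d].
Qed.

Lemma realify_mul X Y : realify (X *m Y) = realify X *m realify Y.
Proof.
rewrite /realify cmx_Re_mul cmx_Im_mul mulmx_block !(mulNmx, mulmxN).
congr block_mx.
- by rewrite opprD.
- by rewrite addrC.
by rewrite addrC.
Qed.

Lemma realifyB X Y : realify (X - Y) = realify X - realify Y.
Proof.
rewrite /realify opp_block_mx add_block_mx; congr block_mx; apply/matrixP => i k;
  rewrite !mxE; case: (X i k) (Y i k) => [a b] [c d] //=; by rewrite opprB opprK addrC.
Qed.

Lemma realify_linear (a : R) X Y : realify (a%:C *: X + Y) = a *: realify X + realify Y.
Proof.
rewrite /realify scale_block_mx add_block_mx; congr block_mx; apply/matrixP => i k;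
  rewrite !mxE; case: (X i k) (Y i k) => [x x'] [y y'] /=; ring.
Qed.

Lemma realify1 : realify (1%:M : 'M[C]_m) = 1%:M.
Proof.
rewrite /realify [RHS]scalar_mx_block; congr block_mx; apply/matrixP => i k; rewrite !mxE;
  by case: (i == k); rewrite /= ?oppr0.
Qed.

Lemma realify_comm X Y : realify (comm_br X Y) = comm_br (realify X) (realify Y).
Proof. by rewrite /comm_br realifyB !realify_mul. Qed.

Lemma trace_realify X : \tr (realify X) = complex.Re (\tr X) *+ 2.
Proof.
rewrite mxtrace_block -mulr2n; congr (_ *+ 2).
by rewrite /mxtrace Re_sum; apply: eq_bigr => i _; rewrite mxE.
Qed.

Lemma realify_adj X : realify (X^t*) = (realify X)^T.
Proof.
rewrite tr_block_mx; congr block_mx; apply/matrixP => i k; rewrite !mxE;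
  by case: (X k i) => a b /=; rewrite ?opprK.
Qed.

Lemma realify_orthogonal A : A \is unitarymx -> Defs.orthogonal (realify A).
Proof.
move=> /unitarymxP AU; rewrite /Defs.orthogonal -realify_adj -realify_mul AU.
exact: realify1.
Qed.

Lemma realify_conj A X : A \is unitarymx ->
  realify (conj_mx A X) = conj_mx (realify A) (realify X).
Proof.
move=> AU; rewrite /conj_mx (orthogonal_inv (realify_orthogonal AU)).
by rewrite invmx_unitary // !realify_mul realify_adj.
Qed.

(** J is the realification of i, which commutes with every complex linear map. *)
Lemma realify_Jmx X : realify X *m Jmx R m = Jmx R m *m realify X.
Proof.
rewrite /realify /Jmx !mulmx_block !mulmx0 !mul0mx !mulmxN !mulNmx !mulmx1 !mul1mx.
by rewrite !addr0 !add0r ?opprK.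
Qed.

Lemma conj_realify_Jmx A : A \is unitarymx -> conj_mx (realify A) (Jmx R m) = Jmx R m.
Proof.
move=> AU; rewrite /conj_mx realify_Jmx mulmxK //.
exact: orthogonal_unit (realify_orthogonal AU).
Qed.

(** The trace equals 2 Re (i tr X). It gives the orthogonality of j to J, which rests on the
    matrices in su(m) being traceless. *)
Lemma trace_realify_Jmx X : \tr X = 0 -> \tr (realify X *m Jmx R m) = 0.
Proof.
move=> X0; rewrite /realify /Jmx mulmx_block mxtrace_block.
rewrite !mulmx0 !mulmx1 mulmxN mulmx1 !addr0 !add0r raddfN /=.
have -> : \tr (cmx_Im X) = 0; last by rewrite oppr0 addr0.
have <- : complex.Im (\tr X) = \tr (cmx_Im X).
  by rewrite /mxtrace Im_sum; apply: eq_bigr => i _; rewrite mxE.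
by rewrite X0.
Qed.

End Realify.

Lemma so2_abelian (R : realType) (X Y : so R 2) : so_br X Y = 0.
Proof.
apply: so_mx_inj; rewrite so_brE /comm_br.
have sk (A : so R 2) i k : so_mx A i k = - so_mx A k i.
  by have /matrixP/(_ k i) := so_skew A; rewrite !mxE.
have d0 (A : so R 2) i : so_mx A i i = 0 by apply: opp_self_eq0; exact: sk.
have i01 (i : 'I_2) : i = 0 \/ i = 1.
  by case: i => [[|[|//]] ?]; [left|right]; apply/val_inj.
apply/matrixP => i k; rewrite !mxE !big_ord_recl !big_ord0.
have -> : lift ord0 ord0 = 1 :> 'I_2 by apply/val_inj.
have -> : ord0 = 0 :> 'I_2 by apply/val_inj.
by case: (i01 i) (i01 k) => -> [] ->; rewrite ?d0 ?(sk _ 1 0); ring.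
Qed.

Section TorusE.
Variables (R : realType) (m : nat).

Lemma torusE_decomp (Z : so R ((m + m) + 2)) : Z \in torusE R m ->
  exists a X, Z = a *: so_ul 2 (mk_so (Jmx R m)) + so_dr (m + m) X.
Proof.
move=> /memv_addP[u /vlineP[a ->] [v vs ->]]; exists a.
set s := map _ _ in vs.
have [X ->] : exists X, v = so_dr (m + m) X; last by exists X.
have -> := coord_span (X := in_tuple s) vs.
exists (\sum_(i < size s) coord (in_tuple s) i v *: (vbasis {:so R 2})`_i).
have dl := @so_dr_linear R (m + m) 2; have d0 := linear_fun0 dl.
rewrite [RHS](big_morph (@so_dr R (m + m) 2) (id1 := 0) (op1 := +%R)) //.
- apply: eq_bigr => i _.
  have -> : (in_tuple s)`_i = so_dr (m + m) (vbasis {:so R 2})`_i.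
    by rewrite (nth_map 0) // -(size_map (@so_dr R (m + m) 2)).
  by rewrite -[in RHS](addr0 (_ *: _)) dl d0 addr0.
by move=> x y; rewrite -[in LHS](scale1r x) dl scale1r.
Qed.

Lemma so_mx_torusE a X : so_mx (a *: so_ul 2 (mk_so (Jmx R m)) + so_dr (m + m) X) =
  diag2 (a *: Jmx R m) (so_mx X).
Proof.
rewrite so_mxD so_mxZ so_ulE so_drE Jmx_so /corner_ul /corner_dr scale_block_mx.
by rewrite add_block_mx !scaler0 !addr0 add0r.
Qed.

Lemma phi_linear : linear (@phi R m).
Proof.
move=> a X Y; apply: so_mx_inj; rewrite so_mxD so_mxZ !phiE.
exact: (realify_linear a (su_mx X) (su_mx Y)).
Qed.

Lemma so_br_phi X Y : so_mx (so_br (@phi R m X) (phi Y)) =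
  realify (comm_br (su_mx X) (su_mx Y)).
Proof. by rewrite so_brE !phiE realify_comm. Qed.

Lemma killing_phi_comm X Y :
  let c := so_br (so_ul 2 (@phi R m X)) (so_ul 2 (phi Y)) in
  killing (@so_br R (m + m + 2)) c c = ((m + m + 2)%:R - 2) * (complex.Re
    (\tr (comm_br (su_mx X) (su_mx Y) *m comm_br (su_mx X) (su_mx Y))) *+ 2).
Proof. by rewrite /= so_br_ul so_killing_ul so_br_phi -realify_mul trace_realify. Qed.

End TorusE.

Section Families.
Variables (R : realType) (eps : R).
Hypothesis eps_gt0 : 0 < eps.
Local Notation nonconstant F := (exists s t : R, - eps < s < eps /\ - eps < t < eps /\
  ricci_norm2 F s <> ricci_norm2 F t).

Lemma familyE_nonconstant m g0 (j : R -> 'Hom(subvs_of (torusE R m), su R m))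
    (Z1 Z2 : subvs_of (torusE R m)) :
  (3 <= m)%N -> so_biinvariant g0 ->
  orthonormal_basis (@torus_metric R (@familyE R m g0 j)) [:: Z1; Z2] ->
  su_admissible eps Z1 Z2 j -> nonconstant (@familyE R m g0 j).
Proof.
move=> m3 g0b Zon adm.
have m0 : (0 < m)%N by exact: leq_trans m3.
have n5 : (5 <= m + m + 2)%N.
  by rewrite (@leq_trans (3 + 3 + 2)%N) // !leq_add.
have mla := so_metric_lie_algebra g0b n5.
have [c ipE] := so_biinvariant_form g0b n5.
have [_ iso nonc] := adm.
have jZ u Y (Z : subvs_of (torusE R m)) : so_mx (so_br (so_ul 2 (phi (j u Y))) (vsval Z)) = 0.
  have [a [X ->]] := torusE_decomp (subvsP Z).
  rewrite so_brE so_ulE so_mx_torusE phiE [LHS]comm_diag2 comm_br0l.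
  have -> : comm_br (realify (su_mx (j u Y))) (a *: Jmx R m) = 0.
    by rewrite /comm_br -scalemxAr -scalemxAl realify_Jmx subrr.
  by rewrite /diag2 block_mx_const raddf0.
apply: (ricci_norm2_nonconstant (F := familyE g0 j) eps_gt0 mla _ Zon _ _ _ _ _ nonc) => /=.
- by move=> a Y Z; rewrite linearP.
- by move=> t a Y Z; rewrite linearP phi_linear so_ul_linear.
- move=> Y Z; apply: so_mx_inj; rewrite so_brE.
  have [a [X ->]] := torusE_decomp (subvsP Y).
  have [b [X' ->]] := torusE_decomp (subvsP Z).
  rewrite !so_mx_torusE comm_diag2 -so_brE so2_abelian.
  rewrite /comm_br -!scalemxAr -!scalemxAl !scalerA mulrC subrr.
  by rewrite /diag2 block_mx_const raddf0.
- by move=> u Y Z; apply: so_mx_inj; rewrite jZ.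
- move=> u Y Z; rewrite ipE.
  have [a [X ->]] := torusE_decomp (subvsP Z).
  rewrite so_ulE so_mx_torusE phiE [corner_ul _ _ *m _]mul_diag2 trace_diag2.
  rewrite mul0mx mxtrace0 -scalemxAr linearZ /= trace_realify_Jmx ?su_traceless //.
  by rewrite mulr0 addr0 mulr0.
- move=> s t sI tI Z; have [A [AU detA] AE] := iso s t sI tI Z.
  have AO := realify_orthogonal AU; have Au := orthogonal_unit AO.
  have BO := @orthogonal_diag2 R (m + m) 2 _ AO.
  (* [realify A] commutes with J and the second block is 1, so all of h is fixed. *)
  exists (so_Ad (diag2 (realify A) 1%:M)); split=> [|Y|] /=.
  + exact: so_Ad_isometric_automorphism.
  + have [a [X ->]] := torusE_decomp (subvsP Y).
    apply: so_mx_inj; rewrite so_AdE // so_mx_torusE conj_diag2 //; congr diag2.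
    by rewrite /conj_mx -scalemxAr -scalemxAl -/(conj_mx _ _) conj_realify_Jmx.
  apply: so_mx_inj; rewrite so_AdE // !so_ulE [LHS]conj_diag2 // !phiE AE.
  by rewrite realify_conj.
move=> s t sI tI e; apply: (su_admissible_trace adm sI tI).
have kE := @killing_phi_comm R m.
(* The factor 2 comes from the trace of a realification. *)
apply: (pmulrnI (isT : (0 < 2)%N)).
have nz : (m + m + 2)%:R - 2 != 0 :> R.
  by rewrite subr_eq0 eqr_nat; apply/eqP => m2; move: n5; rewrite m2.
exact: mulfI nz _ _ (etrans (esym (kE _ _)) (etrans e (kE _ _))).
Qed.

End Families.

Theorem proposition3p15 (R : realType) (eps : R) (F : metric_family R)
    (eps_gt0 : 0 < eps) (F_constr : construction eps F) :
  exists s t : R,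
    - eps < s < eps /\ - eps < t < eps /\ ricci_norm2 F s <> ricci_norm2 F t.
Proof.
case: F_constr => [m h gS gH j Z1 Z2|m h gS gH j Z1 Z2|m g0 h j Z1 Z2|m g0 h j Z1 Z2|m g0 j Z1 Z2].
- exact: familyA_nonconstant.
- exact: familyB_nonconstant.
- exact: familyC_nonconstant.
- exact: familyD_nonconstant.
- exact: familyE_nonconstant.
Qed.
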